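(* Let $(M,g)$ be a compact Riemannian manifold with nonnegative sectional curvature and parallel Ricci curvature. Let $F:\mathbb{R}\to\mathbb{R}$ be a smooth convex function, i.e. $F''\ge0$, and let $L$ be a smooth solution on $M\times[0,T)$, $0<T\le\infty$, of the nonlinear heat equation $$\frac{\partial}{\partial t}L=\Delta L+|\nabla L|^2+F(L).$$ Let $f:[0,T)\to\mathbb{R}$ be a $C^1$ function such that $$2f^2(t)-F'(L)f(t)+f'(t)\ge0$$ at every point of $M\times[0,T)$. If $$\nabla_i\nabla_jL+f(t)g_{ij}\ge0$$ on $M$ at $t=0$, then this inequality holds on $M$ for all $t\in(0,T)$.
   Context: $\nabla$ is the Levi-Civita connection of $g$, $\Delta=g^{ij}\nabla_i\nabla_j$ and $|\nabla L|^2=g^{ij}\nabla_iL\nabla_jL$. The Ricci curvature is parallel if $\nabla_kR_{ij}=0$ for all $i,j,k$. An inequality $S_{ij}\ge0$ means that the symmetric bilinear form $S$ is positive semidefinite at each point. *)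

(* Defs.v *)
From HB Require Import structures.
From mathcomp Require Import all_boot all_order all_algebra.
From mathcomp Require Import all_classical all_reals all_analysis.
From mathcomp Require Import lra.
Import Order.TTheory GRing.Theory Num.Theory.
Import numFieldNormedType.Exports.

Set Implicit Arguments.
Unset Strict Implicit.
Unset Printing Implicit Defensive.

Local Open Scope classical_set_scope.
Local Open Scope ring_scope.

(** * Smooth functions *)

Section Smooth.
Variables (R : realType) (V : normedModType R).

Definition iter_derive (s : seq V) (u : V -> R) : V -> R :=
  foldr (fun v w => fun x => 'D_v w x) u s.

(* C^oo on an open subset U of a finite-dimensional V.  The values of u outside
   U are irrelevant, because directional derivatives at a point only depend on
   the germ there. *)
Definition smooth_on (U : set V) (u : V -> R) : Prop :=
  forall (s : seq V) (x : V), U x ->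
    {for x, continuous (iter_derive s u)} /\
    (forall v : V, derivable (iter_derive s u) x v).

(* Smoothness on a set that need not be open, such as U x [0,T): locally the
   restriction of a smooth function on an open set. *)
Definition smooth_within (A : set V) (u : V -> R) : Prop :=
  forall p, A p -> exists (W : set V) (w : V -> R),
    [/\ open W, W p, smooth_on W w & forall q, W q -> A q -> w q = u q].

End Smooth.

(* The derivative of u relative to D; for D = [0,T) it is one-sided at 0. *)
Definition has_derivative_within (R : realType) (D : set R) (u : R -> R)
    (t l : R) : Prop :=
  (u s - u t) / (s - t) @[s --> within D t^'] --> l.

(* u is C^1 on D, with derivative du. *)
Definition C1_within (R : realType) (D : set R) (u du : R -> R) : Prop :=
  (forall t, D t -> has_derivative_within D u t (du t)) /\
  {within D, continuous du}.

(* [0,T), where T may be +oo. *)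
Definition time_interval (R : realType) (T : \bar R) : set R :=
  [set t | 0 <= t /\ (t%:E < T)%E].

(* M need not be symmetric here; it is in every use below. *)
Definition psd (R : realType) (n : nat) (M : 'M[R]_n) : Prop :=
  forall v : 'rV[R]_n, 0 <= (v *m M *m v^T) 0 0.

(** * Tensor calculus in one coordinate chart *)

(* Here gm x is the matrix of components g_ij(x) of the metric, and the
   components of all other tensors are functions of the coordinates x too. *)
Section LocalGeometry.
Variables (R : realType) (n : nat).
Implicit Types (gm : 'rV[R]_n -> 'M[R]_n) (u : 'rV[R]_n -> R).

Definition pd (i : 'I_n) u (x : 'rV[R]_n) : R := 'D_(delta_mx 0 i) u x.

(* Gamma^k_ij, the coefficients of the Levi-Civita connection *)
Definition christoffel gm (k i j : 'I_n) (x : 'rV[R]_n) : R :=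
  2^-1 * \sum_l invmx (gm x) k l *
    (pd i (fun y => gm y j l) x + pd j (fun y => gm y i l) x
     - pd l (fun y => gm y i j) x).

(* nabla_i nabla_j u *)
Definition hessian gm u (x : 'rV[R]_n) : 'M[R]_n :=
  \matrix_(i, j) (pd i (pd j u) x - \sum_k christoffel gm k i j x * pd k u x).

Definition laplacian gm u (x : 'rV[R]_n) : R :=
  \sum_i \sum_j invmx (gm x) i j * hessian gm u x i j.

Definition grad_sq gm u (x : 'rV[R]_n) : R :=
  \sum_i \sum_j invmx (gm x) i j * pd i u x * pd j u x.

(* R(d_i, d_j) d_k = sum_l (riemann gm l k i j) d_l, where
   R(X, Y) Z = nabla_X nabla_Y Z - nabla_Y nabla_X Z - nabla_[X, Y] Z *)
Definition riemann gm (l k i j : 'I_n) (x : 'rV[R]_n) : R :=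
  pd i (christoffel gm l j k) x - pd j (christoffel gm l i k) x
  + \sum_m (christoffel gm m j k x * christoffel gm l i m x
            - christoffel gm m i k x * christoffel gm l j m x).

Definition inner gm (x v w : 'rV[R]_n) : R := (v *m gm x *m w^T) 0 0.

(* R(v, w) w *)
Definition curvature_vww gm (x v w : 'rV[R]_n) : 'rV[R]_n :=
  \row_l \sum_i \sum_j \sum_k v 0 i * w 0 j * w 0 k * riemann gm l k i j x.

Definition sectional gm (x v w : 'rV[R]_n) : R :=
  inner gm x (curvature_vww gm x v w) v /
  (inner gm x v v * inner gm x w w - inner gm x v w ^+ 2).

(* Ric(Y, Z) is the trace of X |-> R(X, Y) Z. *)
Definition ricci gm (j k : 'I_n) (x : 'rV[R]_n) : R :=
  \sum_i riemann gm i k i j x.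

(* nabla_k R_ij *)
Definition nabla_ricci gm (k i j : 'I_n) (x : 'rV[R]_n) : R :=
  pd k (ricci gm i j) x
  - \sum_m christoffel gm m k i x * ricci gm m j x
  - \sum_m christoffel gm m k j x * ricci gm i m x.

End LocalGeometry.

(** The coefficients [christoffel] define the Levi-Civita connection: it is
    torsion-free and the metric is parallel. *)
Section LeviCivita.
Variables (R : realType) (n : nat) (gm : 'rV[R]_n -> 'M[R]_n).
Variable U : set 'rV[R]_n.
Hypothesis openU : open U.
Hypothesis gm_sym : forall y, U y -> (gm y)^T = gm y.

Lemma pd_metric_sym (x : 'rV[R]_n) (k i j : 'I_n) : U x ->
  pd k (fun y => gm y i j) x = pd k (fun y => gm y j i) x.
Proof.
move=> Ux; apply: near_eq_derive.
have : nbhs x U by exact: open_nbhs_nbhs.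
by apply: filterS => y /gm_sym E; rewrite -{1}E mxE.
Qed.

Lemma christoffel_torsion_free (x : 'rV[R]_n) (k i j : 'I_n) : U x ->
  christoffel gm k i j x = christoffel gm k j i x.
Proof.
move=> Ux; rewrite /christoffel; congr (_ * _); apply: eq_bigr => l _.
by rewrite (pd_metric_sym l i j Ux) [X in X - _]addrC.
Qed.

Lemma christoffel_metric_parallel (x : 'rV[R]_n) (k i j : 'I_n) :
  U x -> gm x \in unitmx ->
  pd k (fun y => gm y i j) x
  - \sum_m christoffel gm m k i x * gm x m j
  - \sum_m christoffel gm m k j x * gm x i m = 0.
Proof.
move=> Ux gU.
have lower a b c : \sum_m christoffel gm m a b x * gm x c m =
    2^-1 * (pd a (fun y => gm y b c) x + pd b (fun y => gm y a c) x
            - pd c (fun y => gm y a b) x).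
  pose B : 'cV[R]_n := \col_l (pd a (fun y => gm y b l) x
    + pd b (fun y => gm y a l) x - pd l (fun y => gm y a b) x).
  have -> : \sum_m christoffel gm m a b x * gm x c m =
      2^-1 * (gm x *m (invmx (gm x) *m B)) c 0.
    rewrite mxE big_distrr /=; apply: eq_bigr => m _.
    rewrite /christoffel mulrC mulrCA; congr (_ * (_ * _)).
    by rewrite mxE; apply: eq_bigr => l _; rewrite !mxE.
  by rewrite mulmxA mulmxV // mul1mx mxE.
have -> : \sum_m christoffel gm m k i x * gm x m j =
          \sum_m christoffel gm m k i x * gm x j m.
  by apply: eq_bigr => m _; rewrite -{1}(gm_sym Ux) mxE.
rewrite !lower (pd_metric_sym k j i Ux).
rewrite (pd_metric_sym i k j Ux) (pd_metric_sym j k i Ux).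
rewrite (pd_metric_sym i j k Ux) (pd_metric_sym j i k Ux).
set A := pd k _ _; set B := pd i _ _; set C := pd j _ _.
by lra.
Qed.

End LeviCivita.

(** * Riemannian manifolds *)

Record chart (R : realType) (n : nat) (M : topologicalType) := Chart {
  cdom : set M;
  cimg : set 'rV[R]_n;
  cmap : M -> 'rV[R]_n;
  cinv : 'rV[R]_n -> M;
  cdom_open : open cdom;
  cimg_open : open cimg;
  cmap_img : forall p, cdom p -> cimg (cmap p);
  cinv_dom : forall x, cimg x -> cdom (cinv x);
  cmapK : forall p, cdom p -> cinv (cmap p) = p;
  cinvK : forall x, cimg x -> cmap (cinv x) = x;
  cmap_continuous : {in cdom, continuous cmap};
  cinv_continuous : {in cimg, continuous cinv}
}.

(* The part of the image of the chart c that is also covered by c'. *)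
Definition overlap (R : realType) (n : nat) (M : topologicalType)
    (c c' : chart R n M) : set 'rV[R]_n :=
  [set x | cimg c x /\ cdom c' (cinv c x)].

Definition transition (R : realType) (n : nat) (M : topologicalType)
    (c c' : chart R n M) (k : 'I_n) (x : 'rV[R]_n) : R :=
  cmap c' (cinv c x) 0 k.

(* A smooth Riemannian n-manifold without boundary on the space M.  The metric
   is given by its components metric a x in the coordinates x of each chart
   atlas a, which transform as a covariant 2-tensor. *)
Record riemannianManifold (R : realType) (n : nat) (M : topologicalType) :=
  RiemannianManifold {
  atlas_index : Type;
  atlas : atlas_index -> chart R n M;
  metric : atlas_index -> 'rV[R]_n -> 'M[R]_n;
  manifold_hausdorff : hausdorff_space M;
  manifold_second_countable : @second_countable M;
  atlas_cover : forall p, exists a, cdom (atlas a) p;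
  atlas_smooth : forall a b k,
    smooth_on (overlap (atlas a) (atlas b)) (transition (atlas a) (atlas b) k);
  metric_smooth : forall a i j,
    smooth_on (cimg (atlas a)) (fun x => metric a x i j);
  metric_sym : forall a x, cimg (atlas a) x -> (metric a x)^T = metric a x;
  metric_pos : forall a x, cimg (atlas a) x ->
    forall v : 'rV[R]_n, v != 0 -> 0 < inner (metric a) x v v;
  metric_transform : forall a b x, overlap (atlas a) (atlas b) x ->
    forall i j, metric a x i j =
      \sum_k \sum_l pd i (transition (atlas a) (atlas b) k) x
                    * pd j (transition (atlas a) (atlas b) l) x
                    * metric b (cmap (atlas b) (cinv (atlas a) x)) k l
}.

Section Global.
Variables (R : realType) (n : nat) (M : topologicalType).
Variable g : riemannianManifold R n M.

Definition in_chart (a : atlas_index g) (u : M -> R) (x : 'rV[R]_n) : R :=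
  u (cinv (atlas a) x).

Definition nonneg_sectional : Prop :=
  forall (a : atlas_index g) (x v w : 'rV[R]_n), cimg (atlas a) x ->
    row_free (col_mx v w) -> 0 <= sectional (metric a) x v w.

Definition parallel_ricci : Prop :=
  forall (a : atlas_index g) (x : 'rV[R]_n), cimg (atlas a) x ->
    forall k i j, nabla_ricci (metric a) k i j x = 0.

Definition smooth_spacetime (D : set R) (L : R -> M -> R) : Prop :=
  forall a : atlas_index g,
    smooth_within (cimg (atlas a) `*` D)
      (fun p : 'rV[R]_n * R => in_chart a (L p.2) p.1).

(* dL/dt = Delta L + |nabla L|^2 + F(L) on M x D *)
Definition heat_solution (D : set R) (F : R -> R) (L : R -> M -> R) : Prop :=
  forall (a : atlas_index g) (x : 'rV[R]_n) (t : R),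
    cimg (atlas a) x -> D t ->
    has_derivative_within D (fun s => in_chart a (L s) x) t
      (laplacian (metric a) (in_chart a (L t)) x
       + grad_sq (metric a) (in_chart a (L t)) x
       + F (in_chart a (L t) x)).

(* nabla_i nabla_j u + c g_ij >= 0 on M *)
Definition hessian_lower_bound (u : M -> R) (c : R) : Prop :=
  forall (a : atlas_index g) (x : 'rV[R]_n), cimg (atlas a) x ->
    psd (hessian (metric a) (in_chart a u) x + c *: metric a x).

End Global.

(* Main.v *)
(** Set [H = hess L + c g] with [c = f + e exp (A t)], where [A] bounds
    [F' (L) - 4 f] on the compact manifold up to a given time and [e > 0].
    Then [H > 0] at time 0; suppose that [H] first acquires a null vector [v],
    at the point [x] and time [t].  There the time derivative of [H (v, v)] is
    nonpositive, and it equals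
    [hess (Delta L + |nabla L|^2 + F (L)) (v, v) + c' |v|^2].
    In coordinates that are normal at [x], the function [psi = H (v, v)] with
    constant [v] has a minimum at [x], so [d psi = 0] and [Delta psi >= 0].
    Subtracting [Delta psi] from the Hessian of the right-hand side cancels the
    fourth derivatives of [L]; the terms in [nabla L] alone are a combination
    of [nabla Ric], which vanishes; what is left is
    [2 <R (., v) v, .>] contracted with [H] and with [nabla L] (nonnegative by
    the curvature hypothesis), [F'' (L) (nabla_v L)^2 >= 0] and
    [(2 c^2 - F' (L) c) |v|^2].  Hence [2 c^2 - F' (L) c + c' <= 0], which the
    choice of [A] excludes.  Finally [e] tends to 0.

    The chart supplied by the atlas need not be normal at [x], so all the
    quantities above are first transported along the quadratic change of
    coordinates [normal_map], under which they are tensorial. *)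

Require Import Defs.
From HB Require Import structures.
From mathcomp Require Import all_boot all_order all_algebra.
From mathcomp Require Import all_classical all_reals all_analysis.
From mathcomp Require Import ring lra.
Import Order.TTheory GRing.Theory Num.Theory.
Import numFieldNormedType.Exports.

Set Implicit Arguments.
Unset Strict Implicit.
Unset Printing Implicit Defensive.

Local Open Scope classical_set_scope.
Local Open Scope ring_scope.

(** * Smooth functions *)

(** Strict positivity at time 0 forces any touching time to be positive, where the time derivative
    is two-sided and the equation holds on a whole neighbourhood in space, so that its spatial
    Hessian can be taken. Nullity is used through the kernel: [H >= 0] and [H (v, v) = 0] give
    [H (v, .) = 0], hence [hess L (v, .) = - c g (v, .)]. This is the origin of [2 c^2], from the
    squares in the second derivative of [|nabla L|^2], and of [- F' (L) c]. The vector [v] is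
    extended constantly, not by parallel transport, so ordinary derivatives of [g] and of the
    Christoffel symbols appear. Where [g = 1] and the symbols vanish, derivatives of the symbols are
    linear in derivatives of [g], and the curvature identities reduce to symmetry of mixed
    derivatives and linear arithmetic. Tensors are treated as multilinear maps of arbitrary vectors,
    which keeps the transformation laws free of indices. Compactness yields a bound [A] uniform on
    [M], and a uniform time during which a positive definite [H] stays semidefinite. *)

Section Ck.
Variables (R : realType) (V : normedModType R).
Implicit Types (U : set V) (u w : V -> R) (v x : V) (k : nat).

(** Finite-order counterpart of [smooth_on]. Derivatives of products, inverses and composites are
    sums of products, so closure has to be shown for all functions of one order at once, by
    induction on [k]; a list of directions offers no such induction. *)
Fixpoint Ck k U u : Prop :=
  (forall x, U x -> {for x, continuous u}) /\
  if k is k'.+1 then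
    (forall x v, U x -> derivable u x v) /\ (forall v, Ck k' U ('D_v u))
  else True.

Lemma Ck_continuous k U u x : Ck k U u -> U x -> {for x, continuous u}.
Proof. by case: k => [|k] [+ _]; apply. Qed.

Lemma Ck_derivable k U u x v : Ck k.+1 U u -> U x -> derivable u x v.
Proof. by move=> [_ [+ _]]; apply. Qed.

Lemma Ck_derive k U u v : Ck k.+1 U u -> Ck k U ('D_v u).
Proof. by move=> [_ [_]]; apply. Qed.

Lemma CkW k U u : Ck k.+1 U u -> Ck k U u.
Proof.
elim: k u => [|k IH] u [uc [ud uD]]; split=> //; split=> // v.
exact/IH/uD.
Qed.

Lemma iter_derive_rcons s v u :
  iter_derive (rcons s v) u = iter_derive s ('D_v u).
Proof. by rewrite /iter_derive foldr_rcons. Qed.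

Lemma smooth_derive U u v : smooth_on U u -> smooth_on U ('D_v u).
Proof. by move=> us s x Ux; rewrite -iter_derive_rcons; apply: us. Qed.

Lemma smooth_continuous U u x : smooth_on U u -> U x -> {for x, continuous u}.
Proof. by move=> us /(us [::]) []. Qed.

Lemma smooth_derivable U u x v : smooth_on U u -> U x -> derivable u x v.
Proof. by move=> us /(us [::]) [_]. Qed.

Lemma smooth_CkP U u : smooth_on U u <-> forall k, Ck k U u.
Proof.
split=> [us k|us].
  elim: k u us => [|k IH] u us.
    by split=> // x Ux; exact: smooth_continuous us Ux.
  split; first by move=> x Ux; exact: smooth_continuous us Ux.
  split=> [x v Ux|v]; first exact: smooth_derivable us Ux.
  exact/IH/smooth_derive.
(* [iter_derive] applies the last direction of the list first, and [Ck] also peels off the innermost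
   derivative; hence the induction from the end. *)
move=> s; elim/last_ind: s u us => [|s v IH] u us x Ux.
  by have [uc [ud _]] := us 1%N; split=> [|v]; [exact: uc|exact: ud].
rewrite iter_derive_rcons; apply: IH => // k.
by have [_ [_]] := us k.+1; apply.
Qed.

Lemma smooth_onS U U' u : U' `<=` U -> smooth_on U u -> smooth_on U' u.
Proof. by move=> sU us s x /sU; exact: us. Qed.

Lemma near_open U (P : V -> Prop) x : open U -> U x ->
  (forall y, U y -> P y) -> \forall y \near x, P y.
Proof.
move=> oU Ux UP; have : nbhs x U by exact: open_nbhs_nbhs.
exact: filterS.
Qed.

Lemma derive_eq_on U u w x v : open U -> {in U, u =1 w} -> U x ->
  'D_v u x = 'D_v w x.
Proof.
move=> oU uw Ux; apply: near_eq_derive.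
by apply: near_open oU Ux _ => y Uy; apply: uw; rewrite inE.
Qed.

Lemma derivable_eq_on U u w x v : open U -> {in U, u =1 w} -> U x ->
  derivable u x v -> derivable w x v.
Proof.
move=> oU uw Ux; apply: near_eq_derivable.
by apply: near_open oU Ux _ => y Uy; apply: uw; rewrite inE.
Qed.

Lemma continuous_eq_on U u w x : open U -> {in U, u =1 w} -> U x ->
  {for x, continuous u} -> {for x, continuous w}.
Proof.
move=> oU uw Ux uc; rewrite /prop_for /continuous_at -(uw x) ?inE//.
apply: cvg_trans uc; apply: near_eq_cvg.
by apply: near_open oU Ux _ => y Uy; rewrite uw// inE.
Qed.

Lemma Ck_eq k U u w : open U -> {in U, u =1 w} -> Ck k U u -> Ck k U w.
Proof.
move=> oU; elim: k u w => [|k IH] u w uw [uc ud];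
  split=> //; try by move=> x Ux; exact: continuous_eq_on uw Ux (uc x Ux).
have [ud1 ud2] := ud; split=> [x v Ux|v].
  exact: derivable_eq_on uw Ux (ud1 x v Ux).
apply: IH (ud2 v) => x; rewrite inE => Ux; exact: derive_eq_on uw Ux.
Qed.

Lemma Ck_cst k U (c : R) : Ck k U (fun=> c).
Proof.
elim: k c => [|k IH] c; split=> //; try by move=> x _; exact: cst_continuous.
split=> [x v _|v]; first exact: derivable_cst.
suff -> : 'D_v (fun=> c) = (fun=> 0) :> (V -> R) by exact: IH.
by apply/funext => x; exact: derive_cst.
Qed.

Lemma CkD k U u w : open U -> Ck k U u -> Ck k U w ->
  Ck k U (fun x => u x + w x).
Proof.
move=> oU; elim: k u w => [|k IH] u w [uc ud] [wc wd]; split=> //;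
  try by move=> x Ux; apply: cvgD; [exact: uc|exact: wc].
have [ud1 ud2] := ud; have [wd1 wd2] := wd.
split=> [x v Ux|v]; first exact: derivableD (ud1 _ _ Ux) (wd1 _ _ Ux).
apply: Ck_eq (IH _ _ (ud2 v) (wd2 v)) => // x; rewrite inE => Ux.
by rewrite (deriveD (ud1 _ _ Ux) (wd1 _ _ Ux)).
Qed.

Lemma CkM k U u w : open U -> Ck k U u -> Ck k U w ->
  Ck k U (fun x => u x * w x).
Proof.
move=> oU; elim: k u w => [|k IH] u w us ws; move: (us) (ws) => [uc ud] [wc wd];
  split=> //; try by move=> x Ux; apply: cvgM; [exact: uc|exact: wc].
have [ud1 ud2] := ud; have [wd1 wd2] := wd.
split=> [x v Ux|v]; first exact: derivableM (ud1 _ _ Ux) (wd1 _ _ Ux).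
apply: Ck_eq (CkD oU (IH _ _ (CkW us) (wd2 v)) (IH _ _ (CkW ws) (ud2 v))) => //.
move=> x; rewrite inE => Ux.
by rewrite (deriveM (ud1 _ _ Ux) (wd1 _ _ Ux)).
Qed.

(** The derivative [- u' / u ^ 2] contains the inverse again, but one order lower, so the induction
    closes. *)
Lemma CkV k U u : open U -> (forall x, U x -> u x != 0) -> Ck k U u ->
  Ck k U (fun x => (u x)^-1).
Proof.
move=> oU u0; elim: k => [|k IH] us; move: (us) => [uc ud]; split=> //;
  try by move=> x Ux; apply: cvgV; [exact: u0|exact: uc].
have [ud1 ud2] := ud.
split=> [x v Ux|v]; first by apply: derivableV (u0 _ Ux) (ud1 _ _ Ux).
have IH' := IH (CkW us).
apply: Ck_eq (CkM oU (Ck_cst k U (-1)) (CkM oU (CkM oU IH' IH') (ud2 v))) => //.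
move=> x; rewrite inE => Ux.
rewrite (deriveV (u0 _ Ux) (ud1 _ v Ux)) mulN1r -mulNr -invfM.
by [].
Qed.

Lemma smooth_eq U u w : open U -> {in U, u =1 w} ->
  smooth_on U u -> smooth_on U w.
Proof. by move=> oU uw /smooth_CkP us; apply/smooth_CkP => k; exact: Ck_eq uw _. Qed.

Lemma smooth_cst U (c : R) : smooth_on U (fun=> c).
Proof. by apply/smooth_CkP => k; exact: Ck_cst. Qed.

Lemma smoothD U u w : open U -> smooth_on U u -> smooth_on U w ->
  smooth_on U (fun x => u x + w x).
Proof.
by move=> oU /smooth_CkP us /smooth_CkP ws; apply/smooth_CkP => k; exact: CkD.
Qed.

Lemma smoothM U u w : open U -> smooth_on U u -> smooth_on U w ->
  smooth_on U (fun x => u x * w x).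
Proof.
by move=> oU /smooth_CkP us /smooth_CkP ws; apply/smooth_CkP => k; exact: CkM.
Qed.

Lemma smoothN U u : open U -> smooth_on U u -> smooth_on U (fun x => - u x).
Proof.
move=> oU us; apply: (smooth_eq oU _ (smoothM oU (@smooth_cst U (-1)) us)) => // x _.
by rewrite mulN1r.
Qed.

Lemma smoothB U u w : open U -> smooth_on U u -> smooth_on U w ->
  smooth_on U (fun x => u x - w x).
Proof. by move=> oU us ws; exact: (smoothD oU us (smoothN oU ws)). Qed.

Lemma smoothV U u : open U -> (forall x, U x -> u x != 0) -> smooth_on U u ->
  smooth_on U (fun x => (u x)^-1).
Proof. by move=> oU u0 /smooth_CkP us; apply/smooth_CkP => k; exact: CkV. Qed.

Lemma smooth_sum (I : Type) (r : seq I) (P : pred I) U (u : I -> V -> R) :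
  open U -> (forall i, P i -> smooth_on U (u i)) ->
  smooth_on U (fun x => \sum_(i <- r | P i) u i x).
Proof.
move=> oU us; elim: r => [|i r IH].
  by apply: (smooth_eq oU _ (@smooth_cst U 0)) => // x _; rewrite big_nil.
case Pi : (P i).
  apply: (smooth_eq oU _ (smoothD oU (us i Pi) IH)) => // x _.
  by rewrite big_cons Pi.
by apply: (smooth_eq oU _ IH) => // x _; rewrite big_cons Pi.
Qed.

Lemma smooth_prod (I : Type) (r : seq I) (P : pred I) U (u : I -> V -> R) :
  open U -> (forall i, P i -> smooth_on U (u i)) ->
  smooth_on U (fun x => \prod_(i <- r | P i) u i x).
Proof.
move=> oU us; elim: r => [|i r IH].
  by apply: (smooth_eq oU _ (@smooth_cst U 1)) => // x _; rewrite big_nil.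
case Pi : (P i).
  apply: (smooth_eq oU _ (smoothM oU (us i Pi) IH)) => // x _.
  by rewrite big_cons Pi.
by apply: (smooth_eq oU _ IH) => // x _; rewrite big_cons Pi.
Qed.

Lemma smooth_local (u : V -> R) U :
  (forall x, U x -> exists W w, [/\ open W, W x, smooth_on W w & {in W, w =1 u}]) ->
  smooth_on U u.
Proof.
move=> H s x /H [W [w [oW Wx ws wu]]].
exact: (smooth_eq oW wu ws).
Qed.

End Ck.
Arguments Ck_derive {R V k U u} v _.
Arguments smooth_derive {R V U u} v _.

(** * Directional derivatives: mean value theorem, additivity in the direction, symmetry of mixed
    derivatives *)

Section Directional.
Variables (R : realType) (V : normedModType R).
Implicit Types (U : set V) (u w : V -> R) (v x : V) (k : nat).

Lemma slice_quotient u x v (s : R) :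
  (fun h : R => h^-1 *: (((fun s => u (x + s *: v)) \o shift s) (h *: (1 : R))
                        - u (x + s *: v))) =
  (fun h : R => h^-1 *: ((u \o shift (x + s *: v)) (h *: v) - u (x + s *: v))).
Proof.
apply/funext => h /=; congr (_ *: (u _ - _)).
by rewrite scalerDl [h *: (1:R)]mulr1 addrCA.
Qed.

(** One-variable theorems (mean value, chain rule, critical points) are imported through this
    restriction to a line. *)
Lemma slice_is_derive u x v (s d : R) :
  is_derive s 1 (fun s => u (x + s *: v)) d <-> is_derive (x + s *: v) v u d.
Proof.
have E := slice_quotient u x v s.
by split=> -[H1 H2]; apply: DeriveDef; move: H1 H2; rewrite /derivable /derive E.
Qed.

Lemma is_deriveZ_dir u x v (a d : R) : is_derive x v u d ->
  is_derive x (a *: v) u (a * d).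
Proof.
move=> uxv; have g : is_derive (a * (0:R)) 1 (fun s => u (x + s *: v)) d.
  by apply/slice_is_derive; rewrite mulr0 scale0r addr0.
have h : is_derive (0:R) 1 ( *%R a) a.
  have := is_deriveZ a (is_derive_id (0:R) (1:R)).
  by rewrite [a *: (1:R)]mulr1.
suff : is_derive (x + (0:R) *: (a *: v)) (a *: v) u (a * d).
  by rewrite scale0r addr0.
apply/slice_is_derive; rewrite mulrC.
have := is_derive1_comp g h; congr is_derive.
by apply/funext => s /=; rewrite scalerA mulrC.
Qed.

Lemma deriveZ_dir u x v (a : R) : derivable u x v ->
  'D_(a *: v) u x = a * 'D_v u x.
Proof. by move=> /derivableP /(is_deriveZ_dir a) ?; exact: derive_val. Qed.

Lemma MVT_dir u x v :
  (forall s : R, 0 <= s <= 1 -> derivable u (x + s *: v) v) ->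
  exists2 s : R, 0 <= s <= 1 & u (x + v) - u x = 'D_v u (x + s *: v).
Proof.
move=> ud.
have gd (s : R) : 0 <= s <= 1 ->
    is_derive s 1 (fun s => u (x + s *: v)) ('D_v u (x + s *: v)).
  by move=> s01; apply/slice_is_derive/derivableP/ud.
have [| |s s01 E] := @MVT_segment R (fun s => u (x + s *: v))
    (fun s => 'D_v u (x + s *: v)) 0 1 ler01.
- by move=> s; rewrite in_itv/= => /andP[s0 s1]; apply: gd; rewrite !ltW.
- apply: derivable_within_continuous => s; rewrite in_itv/= => s01.
  by have [] := gd s s01.
- exists s; first by move: s01; rewrite in_itv.
  by move: E; rewrite scale1r scale0r addr0 subr0 mulr1.
Qed.

Lemma derive_dirN u x v : derivable u x v -> 'D_(- v) u x = - 'D_v u x.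
Proof. by move=> ud; rewrite -scaleN1r deriveZ_dir// mulN1r. Qed.

End Directional.

Section Directional2.
Variables (R : realType) (V : normedModType R).
Implicit Types (U : set V) (u : V -> R) (v w x : V) (k : nat).

Lemma near_box (P : V -> Prop) x v w : (\forall y \near x, P y) ->
  exists2 d : R, 0 < d &
    forall a b : R, `|a| <= d -> `|b| <= d -> P (x + a *: v + b *: w).
Proof.
move=> /nbhs_ballP [e /= e0 He].
(* The summand 1 keeps the divisor positive when [v] and [w] vanish; the factor 1/2 below makes the
   final bound strict. *)
pose n := `|v| + `|w| + 1.
have n0 : 0 < n by rewrite /n ltr_wpDl// addr_ge0.
exists (e / n / 2); first by rewrite !divr_gt0.
move=> a b ha hb; apply: He; rewrite -ball_normE /=.
rewrite -addrA opprD addNKr normrN.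
apply: le_lt_trans (ler_normD _ _) _; rewrite !normrZ.
apply: (@le_lt_trans _ _ (e / n / 2 * n)).
  have K0 : 0 <= e / n / 2 by rewrite !divr_ge0 ?ltW.
  move: K0 ha hb; set K := e / n / 2 => K0 ha hb.
  have hv := ler_wpM2r (normr_ge0 v) ha; have hw := ler_wpM2r (normr_ge0 w) hb.
  by rewrite /n !mulrDr mulr1; lra.
by rewrite mulrAC divfK ?gt_eqF// ltr_pdivrMr// ltr_pMr// ltr1n.
Qed.

Lemma near_box1 (P : V -> Prop) x v : (\forall y \near x, P y) ->
  exists2 d : R, 0 < d & forall a : R, `|a| <= d -> P (x + a *: v).
Proof.
move=> /(@near_box _ _ v 0) [d d0 H]; exists d => // a ad.
by have := H a a ad ad; rewrite scaler0 addr0.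
Qed.

(** Additivity in the direction is not part of directional differentiability; it comes from
    continuity of ['D_v u]. The increment along [v + w] is split at [x + h *: w], and the mean value
    theorem places the derivative of the second leg at a point tending to [x]. *)
Lemma is_derive_dirD U u x v w : open U -> Ck 1 U u -> U x ->
  is_derive x (v + w) u ('D_v u x + 'D_w u x).
Proof.
move=> oU us Ux.
have q1 : h^-1 *: (u (h *: w + x) - u x) @[h --> (0:R)^'] --> 'D_w u x.
  exact: (@Ck_derivable _ _ _ _ _ _ w us Ux).
have q2 : h^-1 *: (u (x + h *: w + h *: v) - u (x + h *: w)) @[h --> (0:R)^']
    --> 'D_v u x.
  apply/cvgrPdist_lt => e e0.
  have /cvgrPdist_lt/(_ e e0) N : {for x, continuous ('D_v u)}.
    exact: Ck_continuous (Ck_derive v us) Ux.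
  have oUx : \forall y \near x, U y by apply: open_nbhs_nbhs.
  have [d d0 H] := near_box w v (filterI N oUx).
  near=> h.
  have hd : `|h| <= d by near: h; apply: dnbhs0_le.
  have h0 : h != 0 by near: h; exact: nbhs_dnbhs_neq.
  have B s : 0 <= s <= 1 -> `|s * h| <= d.
    move=> /andP[s0 s1]; rewrite normrM ger0_norm//.
    by rewrite (le_trans _ hd)// ler_piMl.
  have [s s01|s s01 ->] := @MVT_dir R V u (x + h *: w) (h *: v).
    rewrite scalerA -[h *: v]scale1r scalerA mul1r.
    have [_ Us] := H h (s * h) hd (B s s01).
    exact: (ex_derive (is_derive := is_deriveZ_dir h (derivableP (Ck_derivable us Us)))).
  have [Hs Us] := H h (s * h) hd (B s s01).
  rewrite scalerA deriveZ_dir; last exact: Ck_derivable us Us.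
  by rewrite [_ *: _]mulrA mulVf// mul1r.
have q : h^-1 *: (u (h *: (v + w) + x) - u x) @[h --> (0:R)^']
    --> 'D_v u x + 'D_w u x.
  refine (cvg_trans _ (cvgD q2 q1)); apply: near_eq_cvg; near=> h.
  rewrite -[LHS]scalerDr; congr (_ *: _).
  have -> : h *: (v + w) + x = x + h *: w + h *: v.
    by rewrite scalerDr addrC [h *: v + _]addrC addrA.
  by rewrite [h *: w + x]addrC addrA subrK.
by apply: DeriveDef; [apply/cvg_ex; eexists; exact: q | exact: (cvg_lim _ q)].
Unshelve. all: by end_near. Qed.

Lemma derive_dirD U u x v w : open U -> Ck 1 U u -> U x ->
  'D_(v + w) u x = 'D_v u x + 'D_w u x.
Proof. by move=> oU us Ux; have [] := is_derive_dirD v w oU us Ux. Qed.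

Lemma derive_dir_sum U u x (I : Type) (r : seq I) (P : pred I) (v : I -> V) :
  open U -> Ck 1 U u -> U x ->
  'D_(\sum_(i <- r | P i) v i) u x = \sum_(i <- r | P i) 'D_(v i) u x.
Proof.
move=> oU us Ux; elim/big_rec2: _ => [|i a b _ <-]; first exact: derive0.
exact: derive_dirD oU us Ux.
Qed.

(** Apply the mean value theorem to [y |-> u (y + s *: w) - u y] along [v], then to ['D_v u] along
    [w]. For general [w] this gives the symmetry of mixed derivatives, for [w = - v] the second
    derivative test. *)
Lemma second_difference U u x v w (s : R) : Ck 2 U u ->
  (forall a b : R, `|a| <= `|s| -> `|b| <= `|s| -> U (x + a *: v + b *: w)) ->
  exists a b, [/\ `|a| <= `|s|, `|b| <= `|s| &
  u (x + s *: v + s *: w) - u (x + s *: v) - (u (x + s *: w) - u x)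
    = s ^+ 2 * 'D_w ('D_v u) (x + a *: v + b *: w)].
Proof.
move=> us H; have us1 := CkW us.
have B r : 0 <= r <= 1 -> `|r * s| <= `|s|.
  by move=> /andP[r0 r1]; rewrite normrM ger0_norm// ler_piMl.
have dsv y a : U y -> is_derive y (a *: v) u (a * 'D_v u y).
  by move=> Uy; exact/is_deriveZ_dir/derivableP/(Ck_derivable us1 Uy).
have Ub (r : R) : 0 <= r <= 1 ->
    U (x + (r * s) *: v + s *: w) /\ U (x + (r * s) *: v).
  move=> /B r01; split; first by apply: H.
  by have := H (r * s) 0 r01; rewrite normr0 scale0r addr0; apply.
pose p y := u (y + s *: w) - u y.
have dp (r : R) : 0 <= r <= 1 -> is_derive (x + (r * s) *: v) (s *: v) p
    (s * 'D_v u (x + (r * s) *: v + s *: w) - s * 'D_v u (x + (r * s) *: v)).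
  move=> /Ub [U1 U2]; apply: is_deriveB; last exact: dsv.
  have [d1 d2] := dsv _ s U1.
  have E : (fun h : R => h^-1 *: (((fun y => u (y + s *: w))
      \o shift (x + (r * s) *: v)) (h *: (s *: v)) - u (x + (r * s) *: v + s *: w)))
    = (fun h => h^-1 *: ((u \o shift (x + (r * s) *: v + s *: w)) (h *: (s *: v))
      - u (x + (r * s) *: v + s *: w))).
    by apply/funext => h /=; rewrite -!addrA.
  by apply: DeriveDef; [rewrite /derivable E | rewrite /derive E].
have [r r01|r r01] := @MVT_dir R V p x (s *: v).
  by rewrite scalerA; have [] := dp r r01.
rewrite scalerA; have [_ ->] := dp r r01; rewrite /p addrAC => ->.
rewrite -mulrBr.
have us2 := Ck_derive v us.
have B2 (t : R) : 0 <= t <= 1 -> U (x + (r * s) *: v + t *: (s *: w)).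
  by move=> /B t01; rewrite scalerA; apply: H; [exact: B|].
have d2 t : 0 <= t <= 1 -> is_derive (x + (r * s) *: v + t *: (s *: w)) (s *: w)
   ('D_v u) (s * 'D_w ('D_v u) (x + (r * s) *: v + t *: (s *: w))).
  by move=> /B2 Ut; exact/is_deriveZ_dir/derivableP/(Ck_derivable us2 Ut).
have [t /d2[]//|t t01 ->] := @MVT_dir R V ('D_v u) (x + (r * s) *: v) (s *: w).
have [_ ->] := d2 t t01; exists (r * s), (t * s); split; rewrite ?B//.
by rewrite expr2 mulrA scalerA.
Qed.

(** The second difference is unchanged when [v] and [w] are exchanged, so the two mixed derivatives
    agree at suitable points, possibly different, of every small parallelogram; continuity at [x]
    then excludes a gap. *)
Lemma schwarz U u x v w : open U -> Ck 2 U u -> U x ->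
  'D_w ('D_v u) x = 'D_v ('D_w u) x.
Proof.
move=> oU us Ux; apply/eqP/negPn/negP => neq.
pose e := `|'D_w ('D_v u) x - 'D_v ('D_w u) x| / 2.
have e0 : 0 < e by rewrite divr_gt0// normr_gt0 subr_eq0.
have c1 : {for x, continuous ('D_w ('D_v u))}.
  exact: Ck_continuous (Ck_derive w (Ck_derive v us)) Ux.
have c2 : {for x, continuous ('D_v ('D_w u))}.
  exact: Ck_continuous (Ck_derive v (Ck_derive w us)) Ux.
have /cvgrPdist_lt/(_ e e0) N1 := c1.
have /cvgrPdist_lt/(_ e e0) N2 := c2.
have N3 : \forall y \near x, U y by apply: open_nbhs_nbhs.
have [d d0 H] := near_box v w (filterI N1 (filterI N2 N3)).
have gd : `|d| = d by rewrite gtr0_norm.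
have [|a [b [ha hb E1]]] := @second_difference U u x v w d us.
  by move=> a b; rewrite gd => ha hb; have [_ []] := H a b ha hb.
have [|a' [b' [ha' hb' E2]]] := @second_difference U u x w v d us.
  by move=> a' b'; rewrite gd => ha' hb'; rewrite addrAC; have [_ []] := H b' a' hb' ha'.
move: ha hb ha' hb'; rewrite gd => ha hb ha' hb'.
have [{}N1 _] := H a b ha hb.
have [_ [{}N2 _]] := H b' a' hb' ha'; rewrite addrAC in N2.
have E : 'D_w ('D_v u) (x + a *: v + b *: w) = 'D_v ('D_w u) (x + a' *: w + b' *: v).
  apply: (@mulfI _ (d ^+ 2)); first by rewrite expf_neq0 ?gt_eqF.
  refine (etrans (esym E1) (etrans _ E2)).
  rewrite (addrAC x (d *: w)).
  have gen (p q r t : R) : p - q - (r - t) = p - r - (q - t) by clear; ring.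
  exact: gen.
suff : `|'D_w ('D_v u) x - 'D_v ('D_w u) x| < e + e.
  by rewrite /e -splitr ltxx.
rewrite -(subrKA ('D_w ('D_v u) (x + a *: v + b *: w))).
apply: le_lt_trans (ler_normD _ _) _; apply: (ltrD N1).
rewrite distrC (congr1 (fun z => `|_ - z|) E); exact: N2.
Qed.

End Directional2.

(** * Coordinates on row vectors and the chain rule *)

Lemma cvg_mx_entries (R : realType) (T : Type) (F : set_system T) (FF : Filter F)
    m n (M : T -> 'M[R]_(m, n)) (l : 'M[R]_(m, n)) :
  (forall i j, M x i j @[x --> F] --> l i j) -> M x @[x --> F] --> l.
Proof.
move=> H; apply/cvg_ballP => e e0; near=> x; split=> //.
near: x; apply: filter_forall => i'; apply: filter_forall => j'.
by move/cvg_ballP : (H i' j') => /(_ e e0).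
Unshelve. all: by end_near. Qed.

Lemma cvg_sum_seq (R : realType) (T : Type) (F : set_system T) (FF : Filter F)
    (I : Type) (r : seq I) (f : I -> T -> R) (l : I -> R) :
  (forall i, f i x @[x --> F] --> l i) ->
  \sum_(i <- r) f i x @[x --> F] --> \sum_(i <- r) l i.
Proof.
move=> H; elim: r => [|i r IH].
  by rewrite big_nil; under eq_fun do rewrite big_nil; exact: cvg_cst.
by rewrite big_cons; under eq_fun do rewrite big_cons; apply: cvgD.
Qed.

Section RowVectors.
Variables (R : realType) (n : nat).
Implicit Types (u : 'rV[R]_n -> R) (x h : 'rV[R]_n).

Lemma derive_coord U u x h : open U -> Ck 1 U u -> U x ->
  'D_h u x = \sum_k h 0 k * pd k u x.
Proof.
move=> oU us Ux; rewrite {1}(row_sum_delta h).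
rewrite (derive_dir_sum _ _ _ oU us Ux); apply: eq_bigr => k _.
by rewrite deriveZ_dir//; exact: Ck_derivable us Ux.
Qed.

(* The [q k] are the partial derivatives at the intermediate point of the mean
   value theorem. *)
Lemma caratheodory U u x0 : open U -> Ck 1 U u -> U x0 ->
  exists q : 'I_n -> 'rV[R]_n -> R,
    (forall k, q k x @[x --> x0] --> pd k u x0) /\
    \forall x \near x0, u x - u x0 = \sum_k (x - x0) 0 k * q k x.
Proof.
move=> oU us Ux0.
have /choice [s sP] : forall x, exists s : R, 0 <= s <= 1 /\
    ((forall r : R, 0 <= r <= 1 -> U (x0 + r *: (x - x0))) ->
     u x - u x0 = 'D_(x - x0) u (x0 + s *: (x - x0))).
  move=> x; have [H|nH] := pselect (forall r : R, 0 <= r <= 1 -> U (x0 + r *: (x - x0))).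
    have [r r01|r r01 E] := @MVT_dir R _ u x0 (x - x0).
      by apply: Ck_derivable us _; exact: H.
    by exists r; split=> // _; rewrite -E [x0 + _]addrC subrK.
  by exists 0; rewrite lexx ler01.
exists (fun k x => pd k u (x0 + s x *: (x - x0))); split.
  move=> k; have C : x0 + s x *: (x - x0) @[x --> x0] --> x0; last first.
    apply: (cvg_comp _ _ C).
    exact: Ck_continuous (Ck_derive (delta_mx 0 k) us) Ux0.
  apply/(@cvgrPdist_lt _ _ _ (nbhs x0) (nbhs_filter x0)) => e e0.
  suff : \forall x \near x0, `|x0 - (x0 + s x *: (x - x0))| < e by [].
  near=> x.
  rewrite opprD addNKr normrN normrZ.
  have [/andP[s0 s1] _] := sP x; rewrite ger0_norm//.
  apply: (@le_lt_trans _ _ `|x - x0|); first by rewrite ler_piMl.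
  rewrite distrC; near: x; exact: cvgr_dist_lt.
have /nbhs_ballP[e /= e0 eU] : nbhs x0 U by exact: open_nbhs_nbhs.
apply/nbhs_ballP; exists e => // x; rewrite -ball_normE /= distrC => xe.
have xU (r : R) : 0 <= r <= 1 -> U (x0 + r *: (x - x0)).
  move=> /andP[r0 r1]; apply: eU; rewrite -ball_normE /= opprD addNKr normrN.
  by rewrite normrZ ger0_norm// (le_lt_trans _ xe)// ler_piMl.
have [s01 ->//] := sP x.
exact: derive_coord oU us (xU _ s01).
Unshelve. all: by end_near. Qed.

Lemma is_derive_coord j x h : is_derive x h (fun z : 'rV[R]_n => z 0 j) (h 0 j).
Proof.
have di : derivable (@id 'rV[R]_n) x h by exact: derivable_id.
have dj := (derivable_mxP _ x h).1 di 0 j.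
apply: DeriveDef; first exact: dj.
by have := derive_mx di; rewrite derive_id => {2}->; rewrite mxE.
Qed.

Lemma smooth_coord U j : smooth_on U (fun z : 'rV[R]_n => z 0 j).
Proof.
apply/smooth_CkP => -[|k]; split=> //;
  try by move=> x _; exact: coord_continuous.
split=> [x v _|v]; first by have [] := is_derive_coord j x v.
suff -> : 'D_v (fun z : 'rV[R]_n => z 0 j) = (fun=> v 0 j) :> (_ -> R).
  exact: Ck_cst.
by apply/funext => x; have [_ ->] := is_derive_coord j x v.
Qed.

Variable V : normedModType R.
Implicit Types phi : V -> 'rV[R]_n.

(** The Caratheodory factorization writes the difference quotient as a finite sum of component
    quotients times convergent factors, so a vanishing increment of [phi] needs no separate
    treatment. *)
Lemma chain_rule W u phi (y v : V) : open W -> Ck 1 W u -> W (phi y) ->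
  (forall k, {for y, continuous (fun z => phi z 0 k)}) ->
  (forall k, derivable (fun z => phi z 0 k) y v) ->
  is_derive y v (fun z => u (phi z))
    (\sum_k 'D_v (fun z => phi z 0 k) y * pd k u (phi y)).
Proof.
move=> oW us Wy phic phid.
have [q [qc qE]] := caratheodory oW us Wy.
have cphi : phi z @[z --> y] --> phi y.
  by apply: cvg_mx_entries => i j; rewrite ord1; exact: phic.
have cline : h *: v + y @[h --> (0:R)^'] --> y.
  have c0 : h *: v + y @[h --> (0:R)] --> (0:R) *: v + y.
    by apply: cvgD; [exact: scalel_continuous|exact: cvg_cst].
  rewrite scale0r add0r in c0; move=> P /c0; exact: nbhs_dnbhs.
have E : \forall h \near (0:R)^', h^-1 *: (u (phi (h *: v + y)) - u (phi y)) =
    \sum_k (h^-1 *: (phi (h *: v + y) 0 k - phi y 0 k)) * q k (phi (h *: v + y)).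
  have H1 : \forall h \near (0:R)^', u (phi (h *: v + y)) - u (phi y) =
      \sum_k (phi (h *: v + y) - phi y) 0 k * q k (phi (h *: v + y)).
    exact: (cline _ (cphi _ qE)).
  near=> h; rewrite (near H1 h)//.
  rewrite scaler_sumr; apply: eq_bigr => k _.
  by rewrite !mxE -scalerAl.
have C : h^-1 *: (u (phi (h *: v + y)) - u (phi y)) @[h --> (0:R)^'] -->
    \sum_k 'D_v (fun z => phi z 0 k) y * pd k u (phi y).
  apply: (cvg_trans (near_eq_cvg _)).
    near=> h; apply/esym; exact: (near E h).
  apply: cvg_sum_seq => k; apply: cvgM; first exact: phid.
  have C2 : phi (h *: v + y) @[h --> (0:R)^'] --> phi y.
    exact: (cvg_comp _ _ cline cphi).
  exact: (cvg_comp _ _ C2 (qc k)).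
by apply: DeriveDef; [apply/cvg_ex; eexists; exact: C | exact: (cvg_lim _ C)].
Unshelve. all: by end_near. Qed.

(** The derivative is a sum of products in which [pd j u] composed with [phi] falls under the
    induction hypothesis; hence the induction generalizes over [u] and keeps [phi] fixed. *)
Lemma Ck_comp k U W u phi : open U -> open W ->
  (forall y, U y -> W (phi y)) -> (forall j, Ck k U (fun z => phi z 0 j)) ->
  Ck k W u -> Ck k U (fun z => u (phi z)).
Proof.
move=> oU oW UW; elim: k u => [|k IH] u phis us; split=> //;
  try by move=> y Uy; apply: (cvg_comp phi u);
    [apply: cvg_mx_entries => i j; rewrite ord1; exact: Ck_continuous (phis j) Uy
    |exact: Ck_continuous us (UW y Uy)].
have CkS_1 (X : normedModType R) m Y (w : X -> R) : Ck m.+1 Y w -> Ck 1 Y w.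
  by elim: m => // m IHm /CkW.
have D y v : U y -> is_derive y v (fun z => u (phi z))
    (\sum_k 'D_v (fun z => phi z 0 k) y * pd k u (phi y)).
  move=> Uy; apply: (chain_rule oW (CkS_1 _ _ _ _ us) (UW y Uy)) => j.
    exact: Ck_continuous (phis j) Uy.
  exact: Ck_derivable (phis j) Uy.
split=> [y v Uy|v]; first by have [] := D y v Uy.
have H : Ck k U (fun y => \sum_j 'D_v (fun z => phi z 0 j) y * pd j u (phi y)).
  have S (r : seq 'I_n) : Ck k U (fun y => \sum_(j <- r) 'D_v (fun z => phi z 0 j) y * pd j u (phi y)).
    elim: r => [|j r IHr].
      apply: Ck_eq (Ck_cst k U 0) => // y _; by rewrite big_nil.
    have M : Ck k U (fun y => 'D_v (fun z => phi z 0 j) y * pd j u (phi y)).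
      apply: CkM => //; first exact: (Ck_derive v (phis j)).
      apply: IH; last exact: (Ck_derive _ us).
      by move=> i; exact: CkW.
    by apply: Ck_eq (CkD oU M IHr) => // y _; rewrite big_cons.
  exact: S.
apply: Ck_eq H => // y; rewrite inE => Uy.
by have [_ ->] := D y v Uy.
Qed.

Lemma smooth_comp U W u phi : open U -> open W ->
  (forall y, U y -> W (phi y)) -> (forall j, smooth_on U (fun z => phi z 0 j)) ->
  smooth_on W u -> smooth_on U (fun z => u (phi z)).
Proof.
move=> oU oW UW phis /smooth_CkP us; apply/smooth_CkP => k.
by apply: Ck_comp UW _ (us k) => // j; have /smooth_CkP := phis j; apply.
Qed.

End RowVectors.

(** * Composition with a real function; derivative tests at a minimum *)

Section RealComp.
Variables (R : realType) (V : normedModType R).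
Implicit Types (U : set V) (u : V -> R) (F : R -> R).

Lemma is_derive_real_comp F u (x v : V) : derivable F (u x) 1 ->
  derivable u x v ->
  is_derive x v (fun y => F (u y)) ('D_1 F (u x) * 'D_v u x).
Proof.
move=> dF du.
have E : x = x + (0:R) *: v by rewrite scale0r addr0.
rewrite {1}E; apply/(@slice_is_derive _ _ (fun y => F (u y))).
have h : is_derive (0:R) 1 (fun s => u (x + s *: v)) ('D_v u x).
  by apply/slice_is_derive; rewrite -E; exact: derivableP.
apply: (@is_derive1_comp _ F (fun s => u (x + s *: v)) 0 ('D_1 F (u x))).
by rewrite -E; exact: derivableP.
Qed.

Lemma smooth_real_comp F U u : open U -> smooth_on [set: R] F ->
  smooth_on U u -> smooth_on U (fun y => F (u y)).
Proof.
move=> oU /smooth_CkP Fs /smooth_CkP us; apply/smooth_CkP => k.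
elim: k F Fs => [|k IH] F Fs; split=> //;
  try by move=> x Ux; apply: (cvg_comp u F);
    [exact: Ck_continuous (us 0) Ux|exact: Ck_continuous (Fs 0) I].
have D x v : U x -> is_derive x v (fun y => F (u y)) ('D_1 F (u x) * 'D_v u x).
  move=> Ux; apply: is_derive_real_comp; first exact: Ck_derivable (Fs 1) I.
  exact: Ck_derivable (us 1) Ux.
split=> [x v Ux|v]; first by have [] := D x v Ux.
have H : Ck k U (fun y => 'D_1 F (u y) * 'D_v u y).
  apply: CkM => //; last exact: (Ck_derive v (us k.+1)).
  by apply: (IH ('D_1 F)) => m; have := Ck_derive (1:R) (Fs m.+1).
apply: Ck_eq H => // x; rewrite inE => Ux.
by have [_ ->] := D x v Ux.
Qed.

Lemma local_min_derive U u x v : open U -> Ck 1 U u -> U x ->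
  (forall y, U y -> u x <= u y) -> 'D_v u x = 0.
Proof.
move=> oU us Ux umin.
have N : \forall y \near x, U y by apply: open_nbhs_nbhs.
have [d d0 H] := near_box1 v N.
have dg (s : R) : `|s| <= d -> is_derive s 1 (fun s => u (x + s *: v)) ('D_v u (x + s *: v)).
  by move=> sd; apply/slice_is_derive/derivableP/(Ck_derivable us)/H.
have E : x = x + (0:R) *: v by rewrite scale0r addr0.
have gd (s : R) : s \in `]-d, d[%R -> `|s| <= d.
  by rewrite in_itv/= => sd; rewrite ltW// ltr_norml.
have m0 : 0 \in `]-d, d[%R by rewrite in_itv/= oppr_lt0 d0.
have [_] := @derive1_at_min R (fun s => u (x + s *: v)) (-d) d 0 (ltW (gt0_cp d0).2)
   (fun s sd => ex_derive (is_derive := dg s (gd s sd))) m0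
   (fun s sd => ltac:(rewrite /= -E; exact: umin (H s (gd s sd)))).
by have [_ ->] := dg 0 (gd 0 m0); rewrite -E.
Qed.

(** A negative second derivative at [x] would stay negative nearby, and the second difference along
    [v] and [- v], which is [2 u x - u (x + d v) - u (x - d v)], would be positive, against
    minimality. *)
Lemma local_min_derive2 U u x v : open U -> Ck 2 U u -> U x ->
  (forall y, U y -> u x <= u y) -> 0 <= 'D_v ('D_v u) x.
Proof.
move=> oU us Ux umin; rewrite leNgt; apply/negP => neg.
have c : {for x, continuous ('D_v ('D_v u))}.
  exact: Ck_continuous (Ck_derive v (Ck_derive v us)) Ux.
have N1 : \forall y \near x, 'D_v ('D_v u) y < 0 by exact: (cvgr_lt _ c).
have N2 : \forall y \near x, U y by apply: open_nbhs_nbhs.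
have [d d0 H] := near_box v (- v) (filterI N1 N2).
have gd : `|d| = d by rewrite gtr0_norm.
have [|a [b [ha hb E]]] := @second_difference R V U u x v (- v) d us.
  by move=> a b; rewrite gd => ha hb; have [] := H a b ha hb.
rewrite gd in ha hb; have [{}N1 Uab] := H a b ha hb.
have d1 : `|0 : R| <= d by rewrite normr0 ltW.
have [_ U1] := H d 0 ltac:(by rewrite gd) d1.
have [_ U2] := H 0 d d1 ltac:(by rewrite gd).
rewrite scale0r addr0 in U1; rewrite scale0r addr0 in U2.
move: E; rewrite scalerN addrK derive_dirN; last first.
  exact: Ck_derivable (Ck_derive v us) Uab.
rewrite mulrN => E.
have P : 0 < - (d ^+ 2 * 'D_v ('D_v u) (x + a *: v + b *: - v)).
  by rewrite oppr_gt0 pmulr_rlt0// exprn_gt0.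
rewrite -E in P; have := umin _ U1; have := umin _ U2.
move: P; rewrite scalerN; clear; move: (u _) (u _) (u _) => p q r; lra.
Qed.

End RealComp.

(** * Positive semidefinite matrices *)

Section PSD.
Variable R : realType.

Lemma trmx11 (A : 'M[R]_1) : A^T = A.
Proof. by apply/matrixP => i j; rewrite !ord1 mxE. Qed.

Lemma row_sqr_le0 n (r : 'rV[R]_n) : (r *m r^T) 0 0 <= 0 -> r = 0.
Proof.
rewrite mxE => H; apply/rowP => j; rewrite [RHS]mxE; apply/eqP.
rewrite -sqrf_eq0 -normr_le0 ger0_norm ?sqr_ge0//; apply: le_trans H.
rewrite (bigD1 j)//= mxE -expr2 lerDl sumr_ge0// => i _.
by rewrite mxE -expr2 sqr_ge0.
Qed.

Lemma psd_block n (a : R) (r : 'rV[R]_n) (D : 'M[R]_n) (c : R) (y : 'rV[R]_n) :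
  let w : 'rV[R]_(1 + n) := row_mx c%:M y in
  (w *m block_mx a%:M r r^T D *m w^T) 0 0 =
  c ^+ 2 * a + 2 * c * (y *m r^T) 0 0 + (y *m D *m y^T) 0 0.
Proof.
rewrite /= mul_row_block tr_row_mx mul_row_col tr_scalar_mx !mulmxDl.
rewrite -!scalar_mxM !mul_mx_scalar !mul_scalar_mx -!scalemxAl.
have -> : r *m y^T = y *m r^T.
  by rewrite -[LHS]trmx11 trmx_mul trmxK.
by rewrite !mxE eqxx mulr1n; ring.
Qed.

(** Induction on the dimension, splitting off the first pivot as in the Cholesky factorization. The
    factor turns statements on semidefinite forms into statements on sums of squares, without
    eigenvalues. *)
Lemma psd_factor n (S : 'M[R]_n) : S^T = S -> psd S ->
  exists B : 'M[R]_n, S = B^T *m B.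
Proof.
elim: n S => [|n IH] S symS psdS.
  by exists 0; apply/matrixP => -[].
pose a : R := S 0 0.
pose r : 'rV[R]_n := @ursubmx _ 1 n 1 n S.
pose D : 'M[R]_n := @drsubmx _ 1 n 1 n S.
have SE : S = block_mx a%:M r r^T D :> 'M[R]_(1 + n).
  rewrite -[LHS](@submxK _ 1 n 1 n); congr (@block_mx _ 1 n 1 n _ _ _ _).
    rewrite [LHS]mx11_scalar; congr (scalar_mx _); rewrite !mxE; by congr (S _ _); apply/val_inj.
  by rewrite /r trmx_ursub symS.
suff [B SB] : exists B : 'M[R]_(1 + n), block_mx a%:M r r^T D = B^T *m B.
  by exists B; rewrite [LHS]SE.
have symD : D^T = D by rewrite /D trmx_drsub symS.
have q c (y : 'rV[R]_n) :
    0 <= c ^+ 2 * a + 2 * c * (y *m r^T) 0 0 + (y *m D *m y^T) 0 0.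
  by rewrite -psd_block -SE; exact: psdS.
have a0 : 0 <= a.
  by have := q 1 0; rewrite !mul0mx !mxE; lra.
have [az|an] := eqVneq a 0.
  have r0 : r = 0.
    apply: row_sqr_le0; rewrite leNgt; apply/negP => s0.
    pose s := (r *m r^T) 0 0; pose d := (r *m D *m r^T) 0 0.
    (* With a zero pivot and [r] nonzero the form would be unbounded below: this coefficient gives
       it the value -1. *)
    have := q (- (d + 1) / s / 2) r; rewrite az mulr0 add0r -/s -/d.
    have -> : 2 * (- (d + 1) / s / 2) * s + d = -1.
      by field; rewrite gt_eqF.
    by rewrite lerNr oppr0 ler10.
  have [] := IH D symD => [y|B DE]; first by have := q 0 y; rewrite !(expr2,mul0r,mulr0,add0r).
  exists (block_mx 0 0 0 B).
  rewrite az r0 DE tr_block_mx mulmx_block !trmx0 !mul0mx !mulmx0 !addr0 !add0r.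
  by rewrite [0%:M]raddf0.
have ap : 0 < a by rewrite lt_neqAle eq_sym an.
pose D' := D - a^-1 *: (r^T *m r).
have [||B DE] := IH D'.
- by rewrite /D' linearB /= linearZ /= trmx_mul trmxK symD.
(* Completing the square: this first coordinate minimizes the form for given [y], and the minimum is
   the quadratic form of the Schur complement [D']. *)
- move=> y; have := q (- a^-1 * (y *m r^T) 0 0) y.
  rewrite /D' mulmxBr mulmxBl -scalemxAr -scalemxAl [X in _ -> 0 <= X]mxE.
  rewrite [X in _ -> 0 <= _ + X]mxE [X in _ -> 0 <= _ - X]mxE.
  have -> : (y *m (r^T *m r) *m y^T) 0 0 = ((y *m r^T) 0 0) ^+ 2.
    rewrite mulmxA -mulmxA.
    have -> : r *m y^T = y *m r^T by rewrite -[LHS]trmx11 trmx_mul trmxK.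
    by rewrite [LHS]mxE big_ord1 expr2.
  set s := (y *m r^T) 0 0; set e := (y *m D *m y^T) 0 0.
  suff -> : (- a^-1 * s) ^+ 2 * a + 2 * (- a^-1 * s) * s + e = e - a^-1 * s ^+ 2 by [].
  by field.
pose sa := Num.sqrt a.
have sa0 : sa != 0 by rewrite gt_eqF// sqrtr_gt0.
have saE : sa * sa = a by rewrite -expr2 sqr_sqrtr.
exists (block_mx sa%:M (sa^-1 *: r) 0 B).
rewrite tr_block_mx mulmx_block tr_scalar_mx !trmx0 !mul0mx !mulmx0 !addr0.
rewrite -scalar_mxM saE mul_scalar_mx scalerA divff// scale1r.
rewrite linearZ /= mul_mx_scalar scalerA divff// scale1r -DE /D'.
rewrite -scalemxAl -scalemxAr scalerA -invfM saE.
by rewrite addrC subrK.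
Qed.

(** Factoring [A = B^T B] turns the double sum into the sum of the quadratic form of [C] over the
    rows of [B]. *)
Lemma trace_psd_ge0 n (A C : 'M[R]_n) : A^T = A -> psd A -> psd C ->
  0 <= \sum_i \sum_j A i j * C i j.
Proof.
move=> sA pA pC; have [B ->] := psd_factor sA pA.
have -> : \sum_i \sum_j (B^T *m B) i j * C i j =
    \sum_k (row k B *m C *m (row k B)^T) 0 0.
  under eq_bigr do under eq_bigr do rewrite mxE big_distrl/=.
  under eq_bigr do rewrite exchange_big/=.
  rewrite exchange_big/=; apply: eq_bigr => k _.
  rewrite mxE exchange_big /=; apply: eq_bigr => j _.
  rewrite !mxE big_distrl/=; apply: eq_bigr => i _.
  by rewrite !mxE mulrAC.
by apply: sumr_ge0 => k _; exact: pC.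
Qed.

(** With [g = B^T B] the inverse of [B^T] works. Its rows are a [g]-orthonormal basis, later the
    linear part of [normal_map]. *)
Lemma posdef_orthonormal n (g : 'M[R]_n) : g^T = g ->
  (forall v : 'rV[R]_n, v != 0 -> 0 < (v *m g *m v^T) 0 0) ->
  exists2 A : 'M[R]_n, A \in unitmx & A *m g *m A^T = 1%:M.
Proof.
move=> sg pg.
have psg : psd g.
  by move=> v; have [->|/pg/ltW//] := eqVneq v 0; rewrite !mul0mx mxE.
have [B gE] := psd_factor sg psg.
have BU : B^T \in unitmx.
  rewrite -row_free_unit -kermx_eq0; apply/negPn/negP => /rowV0Pn[v].
  move=> /sub_kermxP vB /pg; rewrite gE mulmxA vB mul0mx mul0mx mxE.
  by rewrite ltxx.
exists (invmx B^T); first by rewrite unitmx_inv.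
by rewrite gE mulmxA mulVmx// mul1mx trmx_inv trmxK mulmxV// -unitmx_tr.
Qed.

Lemma posdef_unitmx n (g : 'M[R]_n) :
  (forall v : 'rV[R]_n, v != 0 -> 0 < (v *m g *m v^T) 0 0) -> g \in unitmx.
Proof.
move=> pg; rewrite -row_free_unit -kermx_eq0; apply/negPn/negP => /rowV0Pn[v].
by move=> /sub_kermxP vB /pg; rewrite vB mul0mx mxE ltxx.
Qed.

(** After factoring the form, its value at [v] is a squared norm. Applied to the touching Hessian,
    this determines [hess u (v, .)] completely. *)
Lemma psd_null n (S : 'M[R]_n) (v : 'rV[R]_n) : S^T = S -> psd S ->
  (v *m S *m v^T) 0 0 = 0 -> v *m S = 0.
Proof.
move=> sS pS; have [B SE] := psd_factor sS pS.
rewrite SE mulmxA => H.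
suff -> : v *m B^T = 0 by rewrite mul0mx.
by apply: row_sqr_le0; rewrite trmx_mul trmxK mulmxA H.
Qed.

End PSD.

(** * Bilinear forms and differentiation of vector fields *)

(* These are locked because unification would otherwise unfold the limits hidden in ['D_a]. *)
HB.lock Definition bil (R : realType) n (M : 'M[R]_n) (a b : 'rV[R]_n) : R :=
  (a *m M *m b^T) 0 0.

HB.lock Definition vderive (R : realType) n (a : 'rV[R]_n) (X : 'rV[R]_n -> 'rV[R]_n)
    (y : 'rV[R]_n) : 'rV[R]_n :=
  \row_k 'D_a (fun z => X z 0 k) y.

HB.lock Definition mderive (R : realType) n (w : 'rV[R]_n) (B : 'rV[R]_n -> 'M[R]_n)
    (x : 'rV[R]_n) : 'M[R]_n :=
  \matrix_(i, j) 'D_w (fun z => B z i j) x.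

Section Bilinear.
Variables (R : realType) (n : nat).
Implicit Types (a b c : 'rV[R]_n) (M : 'M[R]_n).

Lemma bilM M a b : bil M a b = (a *m M *m b^T) 0 0.
Proof. by rewrite bil.unlock. Qed.

Lemma bilE M a b : bil M a b = \sum_i \sum_j a 0 i * b 0 j * M i j.
Proof.
rewrite !bilM mxE exchange_big; apply: eq_bigr => j _.
rewrite mxE big_distrl /=; apply: eq_bigr => i _.
by rewrite [b^T _ _]mxE mulrAC.
Qed.

Lemma bilDl M a b c : bil M (a + b) c = bil M a c + bil M b c.
Proof. by rewrite !bilM !mulmxDl [LHS]mxE. Qed.

Lemma bilDr M a b c : bil M a (b + c) = bil M a b + bil M a c.
Proof. by rewrite !bilM linearD /= mulmxDr [LHS]mxE. Qed.

Lemma bilZl M k a b : bil M (k *: a) b = k * bil M a b.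
Proof. by rewrite !bilM -!scalemxAl [LHS]mxE. Qed.

Lemma bilZr M k a b : bil M a (k *: b) = k * bil M a b.
Proof. by rewrite !bilM linearZ /= -scalemxAr [LHS]mxE. Qed.

Lemma bilNl M a b : bil M (- a) b = - bil M a b.
Proof. by rewrite -scaleN1r bilZl mulN1r. Qed.

Lemma bilNr M a b : bil M a (- b) = - bil M a b.
Proof. by rewrite -scaleN1r bilZr mulN1r. Qed.

Lemma bilBl M a b c : bil M (a - b) c = bil M a c - bil M b c.
Proof. by rewrite bilDl bilNl. Qed.

Lemma bilBr M a b c : bil M a (b - c) = bil M a b - bil M a c.
Proof. by rewrite bilDr bilNr. Qed.

Lemma bilDm M N a b : bil (M + N) a b = bil M a b + bil N a b.
Proof. by rewrite !bilM mulmxDr mulmxDl [LHS]mxE. Qed.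

Lemma bilZm k M a b : bil (k *: M) a b = k * bil M a b.
Proof. by rewrite !bilM -scalemxAr -scalemxAl [LHS]mxE. Qed.

Lemma bil0l M b : bil M 0 b = 0.
Proof. by rewrite !bilM !mul0mx mxE. Qed.

Lemma bil0r M b : bil M b 0 = 0.
Proof. by rewrite !bilM trmx0 mulmx0 mxE. Qed.

Lemma bilC M a b : M^T = M -> bil M a b = bil M b a.
Proof.
by move=> sM; rewrite !bilM -[a *m M *m b^T]trmx11 !trmx_mul trmxK sM mulmxA.
Qed.

Lemma bil_delta M i j : bil M (delta_mx 0 i) (delta_mx 0 j) = M i j.
Proof. by rewrite !bilM -rowE trmx_delta -colE !mxE. Qed.

Lemma bil_suml (I : Type) (r : seq I) (P : pred I) (f : I -> 'rV[R]_n) M b :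
  bil M (\sum_(i <- r | P i) f i) b = \sum_(i <- r | P i) bil M (f i) b.
Proof. by elim/big_rec2: _ => [|i x y _ <-]; rewrite ?bil0l// bilDl. Qed.

Lemma bil_mul (J M : 'M[R]_n) a b : bil (J *m M *m J^T) a b = bil M (a *m J) (b *m J).
Proof. by rewrite !bilM trmx_mul !mulmxA. Qed.

Lemma bil_nondegenerate M a b : M \in unitmx ->
  (forall c, bil M a c = bil M b c) -> a = b.
Proof.
move=> uM H; suff : (a - b) *m M = 0.
  move=> /(congr1 (mulmx^~ (invmx M))); rewrite mulmxK// mul0mx => /eqP.
  by rewrite subr_eq0 => /eqP.
apply/rowP => j; have := H (delta_mx 0 j).
rewrite !bilM !trmx_delta -!colE !mxE => /eqP; rewrite -subr_eq0 => /eqP {2}<-.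
rewrite -sumrB; apply: eq_bigr => i _; by rewrite !mxE mulrBl.
Qed.

End Bilinear.

Section VectorCalculus.
Variables (R : realType) (n : nat).
Local Notation rV := 'rV[R]_n.
Implicit Types (a b c v w x y : rV) (U W : set rV) (X Y : rV -> rV) (B : rV -> 'M[R]_n).

Lemma vderiveE a X y k : vderive a X y 0 k = 'D_a (fun z => X z 0 k) y.
Proof. by rewrite vderive.unlock mxE. Qed.

Lemma mderiveE w B x i j : mderive w B x i j = 'D_w (fun z => B z i j) x.
Proof. by rewrite mderive.unlock mxE. Qed.

Definition vsmooth U (X : rV -> rV) := forall k, smooth_on U (fun z => X z 0 k).
Definition msmooth U (B : rV -> 'M[R]_n) := forall i j, smooth_on U (fun z => B z i j).

Lemma vderive_entry a X k : (fun z => vderive a X z 0 k) = 'D_a (fun z => X z 0 k).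
Proof. by apply/funext => z; rewrite vderiveE. Qed.

Lemma smooth_Ck (V : normedModType R) (U : set V) (u : V -> R) k :
  smooth_on U u -> Ck k U u.
Proof. by move=> /smooth_CkP. Qed.

Lemma vsmooth_cst U a : vsmooth U (fun=> a).
Proof. by move=> k; exact: smooth_cst. Qed.

Lemma vsmooth_vderive U X a : open U -> vsmooth U X -> vsmooth U (vderive a X).
Proof.
move=> oU sX k; apply: (smooth_eq oU _ (smooth_derive a (sX k))) => z _.
by rewrite vderiveE.
Qed.

Lemma msmooth_mderive U B a : open U -> msmooth U B -> msmooth U (mderive a B).
Proof.
move=> oU sB i j; apply: (smooth_eq oU _ (smooth_derive a (sB i j))) => z _.
by rewrite mderiveE.
Qed.

Lemma smooth_bil U B X Y : open U -> msmooth U B -> vsmooth U X -> vsmooth U Y ->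
  smooth_on U (fun z => bil (B z) (X z) (Y z)).
Proof.
move=> oU sB sX sY.
apply: (@smooth_eq _ _ _ (fun z => \sum_i \sum_j X z 0 i * Y z 0 j * B z i j)) => //.
  by move=> z _; rewrite bilE.
apply: smooth_sum => // i _; apply: smooth_sum => // j _.
by do 2?apply: smoothM => //.
Qed.

Lemma smooth_is_derive (V : normedModType R) (U : set V) (u : V -> R) (x v : V) :
  smooth_on U u -> U x -> is_derive x v u ('D_v u x).
Proof. by move=> us Ux; apply/derivableP/(smooth_derivable us). Qed.

Lemma is_derive_sum_fun (V : normedModType R) (I : Type) (r : seq I)
    (h : I -> V -> R) (dh : I -> R) (x v : V) :
  (forall i, is_derive x v (h i) (dh i)) ->
  is_derive x v (fun z => \sum_(i <- r) h i z) (\sum_(i <- r) dh i).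
Proof.
move=> H; elim: r => [|i r IH].
  by rewrite big_nil; under eq_fun do rewrite big_nil; exact: is_derive_cst.
by rewrite big_cons; under eq_fun do rewrite big_cons; exact: is_deriveD.
Qed.

Lemma is_derive_bil (B : rV -> 'M[R]_n) X Y a y :
  (forall i j, derivable (fun z => B z i j) y a) ->
  (forall i, derivable (fun z => X z 0 i) y a) ->
  (forall i, derivable (fun z => Y z 0 i) y a) ->
  is_derive y a (fun z => bil (B z) (X z) (Y z))
    (bil (mderive a B y) (X y) (Y y) + bil (B y) (vderive a X y) (Y y)
     + bil (B y) (X y) (vderive a Y y)).
Proof.
move=> dB dX dY.
under eq_fun do rewrite bilE.
rewrite !bilE -!big_split/=; apply: is_derive_sum_fun => i.
rewrite -!big_split/=; apply: is_derive_sum_fun => j.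
have dXi := derivableP (dX i); have dYj := derivableP (dY j).
have dBij := derivableP (dB i j).
apply: (is_derive_eq (is_deriveM (is_deriveM dXi dYj) dBij)).
rewrite mderiveE !vderiveE mulrfctE /GRing.scale/=; ring.
Qed.

Lemma derive_pd_sum U (u : rV -> R) a w x : open U -> smooth_on U u -> U x ->
  'D_a ('D_w u) x = \sum_k w 0 k * 'D_a (pd k u) x.
Proof.
move=> oU us Ux.
have E : {in U, 'D_w u =1 (fun z => \sum_k w 0 k * pd k u z)}.
  by move=> z; rewrite inE => Uz; exact: (derive_coord _ oU (smooth_Ck 1 us) Uz).
rewrite (derive_eq_on _ oU E Ux).
have [] // := @is_derive_sum_fun _ _ (index_enum 'I_n) (fun k z => w 0 k * pd k u z)
  (fun k => w 0 k * 'D_a (pd k u) x) x a.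
move=> k; apply: is_deriveZ.
exact: (smooth_is_derive _ (smooth_derive (delta_mx 0 k) us)).
Qed.

Variables (U W : set rV) (phi : rV -> rV).
Hypothesis oU : open U.
Hypothesis oW : open W.
Hypothesis phiUW : forall y, U y -> W (phi y).
Hypothesis phis : vsmooth U phi.

Lemma derive_phi (u : rV -> R) a y : smooth_on W u -> U y ->
  is_derive y a (fun z => u (phi z)) ('D_(vderive a phi y) u (phi y)).
Proof.
move=> us Uy.
rewrite (derive_coord _ oW (smooth_Ck 1 us) (phiUW Uy)).
under eq_bigr do rewrite vderiveE.
apply: (chain_rule oW (smooth_Ck 1 us) (phiUW Uy)) => k.
  exact: smooth_continuous (phis k) Uy.
exact: smooth_derivable (phis k) Uy.
Qed.

Lemma vderive_linear a b (k : R) y : U y ->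
  vderive (k *: a + b) phi y = k *: vderive a phi y + vderive b phi y.
Proof.
move=> Uy; apply/rowP => j; rewrite !(mxE, vderiveE).
rewrite (derive_dirD _ _ oU (smooth_Ck 1 (phis j)) Uy) deriveZ_dir//.
exact: smooth_derivable (phis j) Uy.
Qed.

(** Rows are indexed by the source: the differential acts on row vectors by right multiplication,
    and a covariant 2-tensor [B] pulls back to [J B J^T]. *)
Definition jac y : 'M[R]_n := \matrix_(i, k) pd i (fun z => phi z 0 k) y.

Lemma vderive_jac a y : U y -> vderive a phi y = a *m jac y.
Proof.
move=> Uy; apply/rowP => k; rewrite vderiveE [RHS]mxE.
rewrite (derive_coord _ oU (smooth_Ck 1 (phis k)) Uy); apply: eq_bigr => i _.
by rewrite mxE.
Qed.

Lemma vderive_sym a b y : U y -> vderive a (vderive b phi) y = vderive b (vderive a phi) y.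
Proof.
move=> Uy; apply/rowP => k; rewrite 2!vderiveE.
rewrite (vderive_entry b) (vderive_entry a).
exact: (schwarz _ _ oU (smooth_Ck 2 (phis k)) Uy).
Qed.

(** [X] is a vector field along [phi], with values in the target. It is used with
    [X = vderive b phi] for the Hessian of a composite, and with [phi] the identity for fields on
    the domain. *)
Lemma derive_vfield (u : rV -> R) (X : rV -> rV) a y : smooth_on W u ->
  vsmooth U X -> U y ->
  'D_a (fun z => 'D_(X z) u (phi z)) y =
   'D_(vderive a X y) u (phi y) + 'D_(vderive a phi y) ('D_(X y) u) (phi y).
Proof.
move=> us sX Uy.
have E : {in U, (fun z => 'D_(X z) u (phi z)) =1
    (fun z => \sum_k X z 0 k * pd k u (phi z))}.
  by move=> z; rewrite inE => Uz; exact: (derive_coord _ oW (smooth_Ck 1 us) (phiUW Uz)).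
rewrite (derive_eq_on _ oU E Uy).
rewrite (derive_coord _ oW (smooth_Ck 1 us) (phiUW Uy)).
rewrite (derive_pd_sum _ _ oW us (phiUW Uy)).
rewrite -big_split/=.
have [] // := @is_derive_sum_fun _ _ (index_enum 'I_n) (fun k z => X z 0 k * pd k u (phi z))
  (fun k => vderive a X y 0 k * pd k u (phi y) + X y 0 k * 'D_(vderive a phi y) (pd k u) (phi y)) y a.
move=> k; have dX := smooth_is_derive a (sX k) Uy.
have du := derive_phi a (smooth_derive (delta_mx 0 k) us) Uy.
apply: (is_derive_eq (is_deriveM dX du)).
rewrite vderiveE addrC; congr (_ + _); exact: mulrC.
Qed.

Lemma derive_bil_phi (B : rV -> 'M[R]_n) X Y a y : msmooth W B ->
  vsmooth U X -> vsmooth U Y -> U y ->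
  'D_a (fun z => bil (B (phi z)) (X z) (Y z)) y =
    bil (mderive (vderive a phi y) B (phi y)) (X y) (Y y)
    + bil (B (phi y)) (vderive a X y) (Y y) + bil (B (phi y)) (X y) (vderive a Y y).
Proof.
move=> sB sX sY Uy.
have -> : mderive (vderive a phi y) B (phi y) = mderive a (fun z => B (phi z)) y.
  apply/matrixP => i j; rewrite 2!mderiveE.
  by have [_ ->] := derive_phi a (sB i j) Uy.
have [] // := @is_derive_bil (fun z => B (phi z)) X Y a y.
- by move=> i j; have [] := derive_phi a (sB i j) Uy.
- by move=> i; exact: smooth_derivable (sX i) Uy.
- by move=> i; exact: smooth_derivable (sY i) Uy.
Qed.

End VectorCalculus.

HB.lock Definition christoffel_mx (R : realType) n (gm : 'rV[R]_n -> 'M[R]_n) (k : 'I_n)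
    (x : 'rV[R]_n) : 'M[R]_n :=
  \matrix_(i, j) christoffel gm k i j x.

HB.lock Definition chris (R : realType) n (gm : 'rV[R]_n -> 'M[R]_n)
    (x a b : 'rV[R]_n) : 'rV[R]_n :=
  \row_k bil (christoffel_mx gm k x) a b.

(** * Christoffel symbols as a bilinear map *)

Section SmoothMatrices.
Variables (R : realType) (V : normedModType R).

Lemma smooth_det m (U : set V) (A : V -> 'M[R]_m) : open U ->
  (forall i j, smooth_on U (fun z => A z i j)) ->
  smooth_on U (fun z => \det (A z)).
Proof.
move=> oU sA; rewrite /determinant; apply: smooth_sum => // s _.
by apply: smoothM => //; [exact: smooth_cst|exact: smooth_prod].
Qed.

Lemma smooth_invmx m (U : set V) (A : V -> 'M[R]_m) : open U ->
  (forall i j, smooth_on U (fun z => A z i j)) ->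
  (forall z, U z -> A z \in unitmx) ->
  forall i j, smooth_on U (fun z => invmx (A z) i j).
Proof.
move=> oU sA uA i j.
apply: (@smooth_eq _ _ _ (fun z => (\det (A z))^-1 *
   ((-1) ^+ (j + i) * \det (row' j (col' i (A z)))))) => //.
  move=> z; rewrite inE => Uz; rewrite /invmx uA// !mxE.
  by [].
apply: smoothM => //.
  apply: smoothV => //; last exact: smooth_det.
  by move=> z /uA; rewrite unitmxE unitfE.
apply: smoothM => //; first exact: smooth_cst.
apply: smooth_det => // k l.
apply: (smooth_eq oU _ (sA (lift j k) (lift i l))) => z _.
by rewrite !mxE.
Qed.

End SmoothMatrices.

Section Metric.
Variables (R : realType) (n : nat).
Local Notation rV := 'rV[R]_n.
Implicit Types (a b c v w x y : rV).
Implicit Type gm : rV -> 'M[R]_n.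

Definition linear_form (f : rV -> R) := forall (k : R) a b, f (k *: a + b) = k * f a + f b.

Lemma linear_form_coord f a : linear_form f -> f a = \sum_i a 0 i * f (delta_mx 0 i).
Proof.
move=> lf; rewrite {1}(row_sum_delta a).
elim/big_rec2: _ => [|i x y _ <-]; last exact: lf.
by have := lf 1 0 0; rewrite scale1r addr0 mul1r; lra.
Qed.

(** Identities for arbitrary vectors are checked on basis vectors, one slot at a time; this links
    the index definitions with the vector form used from here on. *)
Lemma linear_form_eq f g : linear_form f -> linear_form g ->
  (forall i, f (delta_mx 0 i) = g (delta_mx 0 i)) -> forall a, f a = g a.
Proof.
move=> lf lg fg a; rewrite (linear_form_coord a lf) (linear_form_coord a lg).
by apply: eq_bigr => i _; rewrite fg.
Qed.

Lemma linear_formD f g : linear_form f -> linear_form g -> linear_form (fun a => f a + g a).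
Proof. by move=> lf lg k a b; rewrite lf lg mulrDr addrACA. Qed.

Lemma linear_formZ (c : R) f : linear_form f -> linear_form (fun a => c * f a).
Proof. by move=> lf k a b; rewrite lf mulrDr mulrCA. Qed.

Lemma linear_formB f g : linear_form f -> linear_form g -> linear_form (fun a => f a - g a).
Proof. by move=> lf lg k a b; rewrite lf lg mulrBr addrACA opprD. Qed.

Lemma linear_form_bil1 (M : 'M[R]_n) b : linear_form (fun a => bil M a b).
Proof. by move=> k a a'; rewrite bilDl bilZl. Qed.

Lemma linear_form_bil2 (M : 'M[R]_n) b : linear_form (fun a => bil M b a).
Proof. by move=> k a a'; rewrite bilDr bilZr. Qed.

Lemma christoffel_mxE gm k x i j : christoffel_mx gm k x i j = christoffel gm k i j x.
Proof. by rewrite christoffel_mx.unlock mxE. Qed.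

Lemma chrisE gm x a b k : chris gm x a b 0 k = bil (christoffel_mx gm k x) a b.
Proof. by rewrite chris.unlock mxE. Qed.

Lemma chris_linl gm x k a b c : chris gm x (k *: a + b) c = k *: chris gm x a c + chris gm x b c.
Proof. by apply/rowP => i; rewrite !(mxE, chrisE) bilDl bilZl. Qed.

Lemma chris_linr gm x k a b c : chris gm x c (k *: a + b) = k *: chris gm x c a + chris gm x c b.
Proof. by apply/rowP => i; rewrite !(mxE, chrisE) bilDr bilZr. Qed.

Lemma chrisDr gm x a b c : chris gm x c (a + b) = chris gm x c a + chris gm x c b.
Proof. by rewrite -[a]scale1r chris_linr !scale1r. Qed.

(** Nondegenerate metrics, so that [J g J^T] qualifies as soon as [J] is invertible; positivity is
    brought in pointwise. *)
Definition metric_on (W : set rV) gm := [/\ open W, msmooth W gm,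
  forall x, W x -> (gm x)^T = gm x & forall x, W x -> gm x \in unitmx].

Variables (W : set rV) (gm : rV -> 'M[R]_n).
Hypothesis gmW : metric_on W gm.
Let oW : open W. Proof. by case: gmW. Qed.
Let gs : msmooth W gm. Proof. by case: gmW. Qed.
Let gsym x : W x -> (gm x)^T = gm x. Proof. by case: gmW => _ _ + _; apply. Qed.
Let gU x : W x -> gm x \in unitmx. Proof. by case: gmW => _ _ _; apply. Qed.

Lemma smooth_christoffel k i j : smooth_on W (christoffel gm k i j).
Proof.
rewrite /christoffel; apply: smoothM => //; first exact: smooth_cst.
apply: smooth_sum => // l _; apply: smoothM => //.
  exact: (smooth_invmx oW gs gU).
apply: smoothB => //; first apply: smoothD => //; exact: (smooth_derive _ (gs _ _)).
Qed.

Lemma msmooth_christoffel_mx k : msmooth W (christoffel_mx gm k).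
Proof.
move=> i j; apply: (smooth_eq oW _ (smooth_christoffel k i j)) => z _.
by rewrite christoffel_mxE.
Qed.

Lemma vsmooth_chris a b : vsmooth W (fun z => chris gm z a b).
Proof.
move=> k; apply: (@smooth_eq _ _ _ (fun z => bil (christoffel_mx gm k z) a b)) => //.
  by move=> z _; rewrite chrisE.
exact: (smooth_bil oW (msmooth_christoffel_mx k) (@vsmooth_cst R n W a) (@vsmooth_cst R n W b)).
Qed.

Lemma chris_sym x a b : W x -> chris gm x a b = chris gm x b a.
Proof.
move=> Wx; apply/rowP => k; rewrite !chrisE; apply: bilC.
apply/matrixP => i j; rewrite mxE !christoffel_mxE.
exact: (christoffel_torsion_free oW gsym _ _ _ Wx).
Qed.

Lemma mderive_linear a b k x (B : rV -> 'M[R]_n) : msmooth W B -> W x ->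
  mderive (k *: a + b) B x = k *: mderive a B x + mderive b B x.
Proof.
move=> sB Wx; apply/matrixP => i j; rewrite !(mxE, mderiveE).
rewrite (derive_dirD _ _ oW (smooth_Ck 1 (sB i j)) Wx) deriveZ_dir//.
exact: smooth_derivable (sB i j) Wx.
Qed.

Lemma linear_form_mderive x (B : rV -> 'M[R]_n) b c : msmooth W B -> W x ->
  linear_form (fun a => bil (mderive a B x) b c).
Proof. by move=> sB Wx k a a'; rewrite (mderive_linear a a' k sB Wx) bilDm bilZm. Qed.

Lemma linear_form_chris1 x M b c : linear_form (fun a => bil M (chris gm x a b) c).
Proof. by move=> k a a'; rewrite chris_linl bilDl bilZl. Qed.

Lemma linear_form_chris2 x M b c : linear_form (fun a => bil M (chris gm x b a) c).
Proof. by move=> k a a'; rewrite chris_linr bilDl bilZl. Qed.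

(** The Koszul formula for constant fields, whose brackets vanish. On basis vectors the metric
    cancels the inverse metric in [christoffel]. *)
Lemma koszul x a b c : W x -> 2 * bil (gm x) (chris gm x a b) c =
  bil (mderive a gm x) b c + bil (mderive b gm x) a c - bil (mderive c gm x) a b.
Proof.
move=> Wx; move: a; apply: linear_form_eq => [||i].
- by apply: linear_formZ; exact: linear_form_chris1.
- apply: linear_formB; first by apply: linear_formD; [exact: linear_form_mderive|exact: linear_form_bil1].
  exact: linear_form_bil1.
move: b; apply: linear_form_eq => [||j].
- by apply: linear_formZ; exact: linear_form_chris2.
- apply: linear_formB; first by apply: linear_formD; [exact: linear_form_bil1|exact: linear_form_mderive].
  exact: linear_form_bil2.
move: c; apply: linear_form_eq => [||k].
- by apply: linear_formZ; exact: linear_form_bil2.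
- apply: linear_formB; last exact: linear_form_mderive.
  by apply: linear_formD; exact: linear_form_bil2.
rewrite !bil_delta !mderiveE.
have -> : bil (gm x) (chris gm x (delta_mx 0 i) (delta_mx 0 j)) (delta_mx 0 k) =
    \sum_m christoffel gm m i j x * gm x m k.
  rewrite !bilM trmx_delta -mulmxA -colE mxE; apply: eq_bigr => m _.
  by rewrite chrisE bil_delta christoffel_mxE mxE.
pose B : 'cV[R]_n := \col_l (pd i (fun y => gm y j l) x
    + pd j (fun y => gm y i l) x - pd l (fun y => gm y i j) x).
have -> : \sum_m christoffel gm m i j x * gm x m k =
      2^-1 * (gm x *m (invmx (gm x) *m B)) k 0.
  rewrite mxE big_distrr /=; apply: eq_bigr => m _.
  rewrite /christoffel mulrC mulrCA.
  have -> : gm x m k = gm x k m by rewrite -{1}(gsym Wx) mxE.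
  congr (_ * (_ * _)).
  by rewrite mxE; apply: eq_bigr => l _; rewrite !mxE.
by rewrite mulmxA mulmxV ?gU// mul1mx mxE mulrA divff// mul1r.
Qed.

Lemma bil_hessian u x a b : smooth_on W u -> W x ->
  bil (hessian gm u x) a b = 'D_a ('D_b u) x - 'D_(chris gm x a b) u x.
Proof.
move=> us Wx; rewrite bilE (derive_pd_sum _ _ oW us Wx).
rewrite (derive_coord _ oW (smooth_Ck 1 us) Wx).
have -> : \sum_k b 0 k * 'D_a (pd k u) x =
    \sum_i \sum_k a 0 i * b 0 k * pd i (pd k u) x.
  rewrite exchange_big /=; apply: eq_bigr => k _.
  rewrite (derive_coord _ oW (smooth_Ck 1 (smooth_derive (delta_mx 0 k) us)) Wx).
  by rewrite big_distrr /=; apply: eq_bigr => i _; rewrite mulrCA mulrA.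
have -> : \sum_k chris gm x a b 0 k * pd k u x =
    \sum_i \sum_j a 0 i * b 0 j * \sum_k christoffel gm k i j x * pd k u x.
  under eq_bigr do rewrite chrisE bilE big_distrl/=.
  rewrite exchange_big/=; apply: eq_bigr => i _.
  under eq_bigr do rewrite big_distrl/=.
  rewrite exchange_big/=; apply: eq_bigr => j _.
  by rewrite big_distrr/=; apply: eq_bigr => k _; rewrite christoffel_mxE mulrA.
rewrite -sumrB; apply: eq_bigr => i _; rewrite -sumrB; apply: eq_bigr => j _.
by rewrite mxE mulrBr.
Qed.

End Metric.

(** * Pulling a metric back along a smooth map *)

Section Pullback.
Variables (R : realType) (n : nat).
Local Notation rV := 'rV[R]_n.
Implicit Types (a b c v w x y : rV).
Variables (U W : set rV) (phi : rV -> rV) (g' gm : rV -> 'M[R]_n).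
Hypothesis gmW : metric_on W gm.
Hypothesis gmU : metric_on U g'.
Hypothesis phiUW : forall y, U y -> W (phi y).
Hypothesis phis : vsmooth U phi.
Local Notation J := (jac phi).
Definition pulled (B' B : rV -> 'M[R]_n) :=
  forall y, U y -> B' y = J y *m B (phi y) *m (J y)^T.
Hypothesis gE : pulled g' gm.

Let oW : open W. Proof. by case: gmW. Qed.
Let gs : msmooth W gm. Proof. by case: gmW. Qed.
Let gsym x : W x -> (gm x)^T = gm x. Proof. by case: gmW => _ _ + _; apply. Qed.
Let gU x : W x -> gm x \in unitmx. Proof. by case: gmW => _ _ _; apply. Qed.
Let oU : open U. Proof. by case: gmU. Qed.
Let gs' : msmooth U g'. Proof. by case: gmU. Qed.
Let gU' x : U x -> g' x \in unitmx. Proof. by case: gmU => _ _ _; apply. Qed.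

Local Notation F a := (vderive a phi).

Lemma jac_unit y : U y -> J y \in unitmx.
Proof. by move=> Uy; have := gU' Uy; rewrite gE// !unitmx_mul => /andP[/andP[]]. Qed.

Lemma vsmooth_F a : vsmooth U (F a). Proof. exact: vsmooth_vderive. Qed.

Lemma bil_pulled B' B y a b : pulled B' B -> U y ->
  bil (B' y) a b = bil (B (phi y)) (F a y) (F b y).
Proof.
by move=> BE Uy; rewrite (vderive_jac oU phis a Uy) (vderive_jac oU phis b Uy) BE// bil_mul.
Qed.

Lemma bil_mderive B y a b c : msmooth U B -> U y ->
  bil (mderive a B y) b c = 'D_a (fun z => bil (B z) b c) y.
Proof.
move=> sB Uy.
have [|||_ ->] := @is_derive_bil R n B (fun=> b) (fun=> c) a y.
- by move=> i j; exact: smooth_derivable (sB i j) Uy.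
- by move=> i; exact: derivable_cst.
- by move=> i; exact: derivable_cst.
have E d : vderive a (fun=> d) y = 0.
  by apply/rowP => k; rewrite vderiveE [RHS]mxE; exact: derive_cst.
by rewrite !E bil0l bil0r !addr0.
Qed.

Lemma bil_mderive_pulled B' B y a b c : pulled B' B -> msmooth W B -> msmooth U B' ->
  U y ->
  bil (mderive a B' y) b c = bil (mderive (F a y) B (phi y)) (F b y) (F c y)
    + bil (B (phi y)) (vderive a (F b) y) (F c y)
    + bil (B (phi y)) (F b y) (vderive a (F c) y).
Proof.
move=> BE sB sB' Uy; rewrite (bil_mderive a b c sB' Uy).
rewrite -(derive_bil_phi oW phiUW phis a sB (vsmooth_F b) (vsmooth_F c) Uy).
apply: (derive_eq_on _ oU _ Uy) => z; rewrite inE => Uz.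
exact: bil_pulled.
Qed.

(* Koszul formula for both metrics; the second derivatives of [phi] enter
   symmetrically. *)
Lemma christoffel_pulled y a b : U y ->
  F (chris g' y a b) y = vderive a (F b) y + chris gm (phi y) (F a y) (F b y).
Proof.
move=> Uy; have Wy := phiUW Uy.
apply: (bil_nondegenerate (gU Wy)) => c'.
pose c := c' *m invmx (J y).
have -> : c' = F c y by rewrite (vderive_jac oU phis c Uy) mulmxKV// jac_unit.
rewrite -(bil_pulled _ _ gE Uy) bilDl.
have K := koszul gmU a b c Uy.
rewrite (bil_mderive_pulled a b c gE gs gs' Uy) (bil_mderive_pulled b a c gE gs gs' Uy) (bil_mderive_pulled c a b gE gs gs' Uy) in K.
have K2 := koszul gmW (F a y) (F b y) (F c y) Wy.
rewrite (vderive_sym oU phis b a Uy) (vderive_sym oU phis c a Uy) (vderive_sym oU phis c b Uy) in K.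
rewrite (bilC (F b y) (vderive a (F c) y) (gsym Wy)) (bilC (F a y) (vderive b (F c) y) (gsym Wy)) in K.
move: K K2.
repeat match goal with
  | |- context [bil ?M ?a ?b] => generalize (bil M a b) end.
by intros; lra.
Qed.

(** Differentiating [u] along the field [vderive b phi] produces a second derivative of [phi], which
    is exactly the inhomogeneous term in [christoffel_pulled]; the two cancel. *)
Lemma hessian_pulled u y a b : smooth_on W u -> U y ->
  bil (hessian g' (fun z => u (phi z)) y) a b =
  bil (hessian gm u (phi y)) (F a y) (F b y).
Proof.
move=> us Uy; have Wy := phiUW Uy.
have us' : smooth_on U (fun z => u (phi z)) by exact: smooth_comp phiUW phis us.
rewrite (bil_hessian gmU a b us' Uy) (bil_hessian gmW _ _ us Wy).
have E : {in U, 'D_b (fun z => u (phi z)) =1 (fun z => 'D_(F b z) u (phi z))}.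
  by move=> z; rewrite inE => Uz; have [_ ->] := derive_phi oW phiUW phis b us Uz.
rewrite (derive_eq_on _ oU E Uy).
rewrite (derive_vfield oU oW phiUW phis a us (vsmooth_F b) Uy).
have [_ ->] := derive_phi oW phiUW phis (chris g' y a b) us Uy.
rewrite (christoffel_pulled _ _ Uy) (derive_dirD _ _ oW (smooth_Ck 1 us) Wy).
repeat match goal with |- context [derive ?f ?a ?b] => generalize (derive f a b) end.
by intros; lra.
Qed.

Lemma hessian_pulled_mx u y : smooth_on W u -> U y ->
  hessian g' (fun z => u (phi z)) y = J y *m hessian gm u (phi y) *m (J y)^T.
Proof.
move=> us Uy; apply/matrixP => i j.
rewrite -[LHS]bil_delta -[RHS]bil_delta hessian_pulled// bil_mul.
by rewrite !(vderive_jac oU phis _ Uy).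
Qed.

Lemma invmx_pulled y : U y ->
  invmx (g' y) = (invmx (J y))^T *m invmx (gm (phi y)) *m invmx (J y).
Proof.
move=> Uy; have uJ := jac_unit Uy; have ug := gU (phiUW Uy).
have H : g' y *m ((invmx (J y))^T *m invmx (gm (phi y)) *m invmx (J y)) = 1%:M.
  rewrite gE// trmx_inv !mulmxA mulmxK ?unitmx_tr// mulmxK//.
  by rewrite mulmxV.
by rewrite -[LHS]mulmx1 -H mulmxA mulVmx ?gU'// mul1mx.
Qed.

Lemma laplacianE (h : rV -> 'M[R]_n) u y :
  laplacian h u y = \tr (invmx (h y) *m (hessian h u y)^T).
Proof.
rewrite /laplacian /mxtrace; apply: eq_bigr => i _; rewrite [RHS]mxE.
by apply: eq_bigr => j _; rewrite [_^T _ _]mxE.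
Qed.

(** The Jacobian factors of the Hessian and of the inverse metric cancel under the trace. *)
Lemma laplacian_pulled u y : smooth_on W u -> U y ->
  laplacian g' (fun z => u (phi z)) y = laplacian gm u (phi y).
Proof.
move=> us Uy; have uJ := jac_unit Uy.
rewrite !laplacianE hessian_pulled_mx// invmx_pulled// !trmx_mul trmxK.
rewrite -!mulmxA (mulmxA (invmx (J y))) mulVmx// mul1mx.
rewrite mxtrace_mulC -!mulmxA -trmx_mul mulVmx// trmx1 mulmx1.
by [].
Qed.

Definition grad (u : rV -> R) y : rV := \row_i pd i u y.

Lemma grad_sqE (h : rV -> 'M[R]_n) u y :
  grad_sq h u y = bil (invmx (h y)) (grad u y) (grad u y).
Proof.
rewrite bilE; apply: eq_bigr => i _; apply: eq_bigr => j _.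
by rewrite /grad [(\row__ _) 0 i]mxE [(\row__ _) 0 j]mxE [RHS]mulrC mulrA.
Qed.

Lemma grad_pulled u y : smooth_on W u -> U y ->
  grad (fun z => u (phi z)) y = grad u (phi y) *m (J y)^T.
Proof.
move=> us Uy; apply/rowP => i; rewrite mxE /pd.
have [_ ->] := derive_phi oW phiUW phis (delta_mx 0 i) us Uy.
rewrite (derive_coord _ oW (smooth_Ck 1 us) (phiUW Uy)) mxE.
by apply: eq_bigr => k _; rewrite vderiveE !mxE mulrC.
Qed.

Lemma grad_sq_pulled u y : smooth_on W u -> U y ->
  grad_sq g' (fun z => u (phi z)) y = grad_sq gm u (phi y).
Proof.
move=> us Uy; have uJ := jac_unit Uy.
rewrite !grad_sqE grad_pulled// invmx_pulled//.
rewrite -{2}[invmx (J y)]trmxK bil_mul -!mulmxA -trmx_mul mulVmx// trmx1.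
by rewrite mulmx1.
Qed.

End Pullback.

(** * Curvature, Ricci tensor and its covariant derivative, with their transformation laws *)

HB.lock Definition curv (R : realType) n (gm : 'rV[R]_n -> 'M[R]_n)
    (x a b c : 'rV[R]_n) : 'rV[R]_n :=
  \row_l \sum_i \sum_j \sum_k a 0 i * b 0 j * c 0 k * riemann gm l k i j x.

HB.lock Definition dchris (R : realType) n (gm : 'rV[R]_n -> 'M[R]_n)
    (x a b c : 'rV[R]_n) : 'rV[R]_n :=
  \row_k bil (mderive a (christoffel_mx gm k) x) b c.

HB.lock Definition ricci_mx (R : realType) n (gm : 'rV[R]_n -> 'M[R]_n)
    (x : 'rV[R]_n) : 'M[R]_n :=
  \matrix_(j, k) ricci gm j k x.

Section Curvature.
Variables (R : realType) (n : nat).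
Local Notation rV := 'rV[R]_n.
Implicit Types (a b c v w x y : rV) (gm : rV -> 'M[R]_n).

Lemma sum_delta (i0 : 'I_n) (f : 'I_n -> R) :
  \sum_i (delta_mx 0 i0 : rV) 0 i * f i = f i0.
Proof.
rewrite (bigD1 i0)//= mxE !eqxx mul1r big1 ?addr0// => i ne.
by rewrite mxE (negbTE ne) andbF mul0r.
Qed.

Lemma curv_entry gm x a b c l : curv gm x a b c 0 l =
  \sum_i \sum_j \sum_k a 0 i * b 0 j * c 0 k * riemann gm l k i j x.
Proof. by rewrite curv.unlock mxE. Qed.

Lemma dchrisE gm x a b c k : dchris gm x a b c 0 k = bil (mderive a (christoffel_mx gm k) x) b c.
Proof. by rewrite dchris.unlock mxE. Qed.

Lemma ricci_mxE gm x j k : ricci_mx gm x j k = ricci gm j k x.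
Proof. by rewrite ricci_mx.unlock mxE. Qed.

Definition nabla_ricci_form gm x a b c : R := bil (mderive a (ricci_mx gm) x) b c
  - bil (ricci_mx gm x) (chris gm x a b) c - bil (ricci_mx gm x) b (chris gm x a c).

Lemma curv_sum gm x a b c l : curv gm x a b c 0 l =
  \sum_i a 0 i * \sum_j b 0 j * \sum_k c 0 k * riemann gm l k i j x.
Proof.
rewrite curv_entry; apply: eq_bigr => i _; rewrite big_distrr/=; apply: eq_bigr => j _.
rewrite !big_distrr/=; apply: eq_bigr => k _; by rewrite !mulrA.
Qed.

Lemma curv_delta gm x i j k l :
  curv gm x (delta_mx 0 i) (delta_mx 0 j) (delta_mx 0 k) 0 l = riemann gm l k i j x.
Proof.
rewrite curv_sum (sum_delta i (fun i => \sum_j' (delta_mx 0 j : rV) 0 j' *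
  \sum_k' (delta_mx 0 k : rV) 0 k' * riemann gm l k' i j' x)).
rewrite (sum_delta j (fun j' =>
  \sum_k' (delta_mx 0 k : rV) 0 k' * riemann gm l k' i j' x)).
exact: (sum_delta k (fun k' => riemann gm l k' i j x)).
Qed.

Lemma linear_form_coords (f : 'I_n -> R) : linear_form (fun a => \sum_i a 0 i * f i).
Proof.
move=> k a b; rewrite big_distrr/= -big_split/=; apply: eq_bigr => i _.
by rewrite !mxE mulrDl mulrA.
Qed.

Lemma linear_form_sum (F : 'I_n -> rV -> R) : (forall i, linear_form (F i)) ->
  linear_form (fun a => \sum_i F i a).
Proof.
move=> lF k a b; rewrite big_distrr/= -big_split/=.
by apply: eq_bigr => i _; rewrite lF.
Qed.

Lemma linear_form_curv1 gm x b c l : linear_form (fun a => curv gm x a b c 0 l).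
Proof. by move=> k a a'; rewrite !curv_sum linear_form_coords. Qed.

Lemma linear_form_curv2 gm x b c l : linear_form (fun a => curv gm x b a c 0 l).
Proof.
move=> k a a'; rewrite !curv_sum.
by rewrite (linear_form_sum (fun i => linear_formZ (b 0 i) (linear_form_coords _))).
Qed.

Lemma linear_form_curv3 gm x b c l : linear_form (fun a => curv gm x b c a 0 l).
Proof.
move=> k a a'; rewrite !curv_sum.
by rewrite (linear_form_sum (fun i => linear_formZ (b 0 i)
  (linear_form_sum (fun j => linear_formZ (c 0 j) (linear_form_coords _))))).
Qed.

Lemma linear_form_chris3 gm x M b c : linear_form (fun a => bil M c (chris gm x a b)).
Proof. by move=> k a a'; rewrite chris_linl bilDr bilZr. Qed.

Lemma linear_form_chris4 gm x M b c : linear_form (fun a => bil M c (chris gm x b a)).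
Proof. by move=> k a a'; rewrite chris_linr bilDr bilZr. Qed.

Lemma christoffel_mx_entry gm k i j : (fun z => christoffel_mx gm k z i j) = christoffel gm k i j.
Proof. by apply/funext => z; rewrite christoffel_mxE. Qed.

Lemma bil_deltal (M : 'M[R]_n) i b : bil M (delta_mx 0 i) b = \sum_m b 0 m * M i m.
Proof.
rewrite bilE; under eq_bigr do under eq_bigr do rewrite -mulrA.
under eq_bigr do rewrite -big_distrr/=.
by rewrite (sum_delta i (fun i => \sum_j b 0 j * M i j)).
Qed.

Lemma bil_deltar (M : 'M[R]_n) i b : bil M b (delta_mx 0 i) = \sum_m b 0 m * M m i.
Proof.
rewrite bilE; apply: eq_bigr => j _.
under eq_bigr do rewrite mulrAC mulrC.
by rewrite (sum_delta i (fun i => b 0 j * M j i)).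
Qed.

Section OnMetric.
Variables (W : set rV) (gm : rV -> 'M[R]_n).
Hypothesis gmW : metric_on W gm.
Let oW : open W. Proof. by case: gmW. Qed.
Let sC k := msmooth_christoffel_mx gmW k.

(** Exhibits the curvature as the antisymmetrization in [a] and [b] of a single expression, the
    derivative of the Christoffel map plus its iterate; changes of coordinates can be followed on
    that expression. *)
Lemma curvE x a b c : W x -> curv gm x a b c =
  dchris gm x a b c + chris gm x a (chris gm x b c)
  - (dchris gm x b a c + chris gm x b (chris gm x a c)).
Proof.
move=> Wx; apply/rowP => l.
have -> : (dchris gm x a b c + chris gm x a (chris gm x b c)
    - (dchris gm x b a c + chris gm x b (chris gm x a c))) 0 l =
    bil (mderive a (christoffel_mx gm l) x) b c + bil (christoffel_mx gm l x) a (chris gm x b c)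
    - (bil (mderive b (christoffel_mx gm l) x) a c + bil (christoffel_mx gm l x) b (chris gm x a c)).
  by rewrite !(mxE, dchrisE, chrisE).
move: a; apply: linear_form_eq => [||i]; first exact: linear_form_curv1.
  apply: linear_formB; apply: linear_formD; [exact: (linear_form_mderive gmW)|exact: linear_form_bil1|exact: linear_form_bil1|].
  exact: linear_form_chris3.
move: b; apply: linear_form_eq => [||j]; first exact: linear_form_curv2.
  apply: linear_formB; apply: linear_formD; [exact: linear_form_bil1|exact: linear_form_chris3|exact: (linear_form_mderive gmW)|].
  exact: linear_form_bil1.
move: c; apply: linear_form_eq => [||k]; first exact: linear_form_curv3.
  apply: linear_formB; apply: linear_formD; [exact: linear_form_bil2|exact: linear_form_chris4|exact: linear_form_bil2|].
  exact: linear_form_chris4.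
rewrite curv_delta !bil_delta !mderiveE !christoffel_mx_entry !bil_deltal /riemann.
have E p q s t : chris gm x (delta_mx 0 p) (delta_mx 0 q) 0 s * christoffel_mx gm l x t s =
   christoffel gm s p q x * christoffel gm l t s x.
  by rewrite chrisE bil_delta !christoffel_mxE.
under [X in _ = (_ + X) - _]eq_bigr do rewrite E.
under [X in _ = _ - (_ + X)]eq_bigr do rewrite E.
by rewrite sumrB opprD addrACA.
Qed.

Lemma smooth_riemann l k i j : smooth_on W (riemann gm l k i j).
Proof.
rewrite /riemann; apply: smoothD => //.
  apply: smoothB => //.
    exact: (smooth_derive (delta_mx 0 i) (smooth_christoffel gmW l j k)).
  exact: (smooth_derive (delta_mx 0 j) (smooth_christoffel gmW l i k)).
apply: smooth_sum => // m _; apply: smoothB => //; apply: smoothM => //;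
  exact: (smooth_christoffel gmW).
Qed.

Lemma msmooth_ricci_mx : msmooth W (ricci_mx gm).
Proof.
move=> j k; apply: (@smooth_eq _ _ _ (fun x => \sum_i riemann gm i k i j x)) => //.
  by move=> z _; rewrite ricci_mxE.
by apply: smooth_sum => // i _; exact: smooth_riemann.
Qed.

Lemma bil_ricci_mx x b c : bil (ricci_mx gm x) b c =
  \tr (\matrix_(i, l) curv gm x (delta_mx 0 i) b c 0 l).
Proof.
rewrite /mxtrace bilE.
under [RHS]eq_bigr do rewrite mxE curv_sum sum_delta.
rewrite [RHS]exchange_big/=; apply: eq_bigr => j _.
rewrite -[RHS]big_distrr/= exchange_big/= big_distrr/=; apply: eq_bigr => k _.
by rewrite ricci_mxE -big_distrr/= mulrA.
Qed.

Lemma nabla_ricci_form_delta x k i j : nabla_ricci_form gm x (delta_mx 0 k) (delta_mx 0 i) (delta_mx 0 j)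
  = nabla_ricci gm k i j x.
Proof.
rewrite /nabla_ricci_form /nabla_ricci bil_delta bil_deltar bil_deltal mderiveE.
congr (_ - _ - _).
- by congr ('D_(delta_mx 0 k) _ x); apply/funext => z; rewrite ricci_mxE.
- by apply: eq_bigr => m _; rewrite chrisE bil_delta christoffel_mxE ricci_mxE.
- by apply: eq_bigr => m _; rewrite chrisE bil_delta christoffel_mxE ricci_mxE.
Qed.

Lemma nabla_ricci_form_eq0 x a b c : W x ->
  (forall k i j, nabla_ricci gm k i j x = 0) -> nabla_ricci_form gm x a b c = 0.
Proof.
move=> Wx N0.
have lin0 : linear_form (fun=> 0) by move=> k p q; rewrite mulr0 addr0.
move: a; apply: linear_form_eq => // [|k].
  apply: linear_formB; first apply: linear_formB; [exact: (linear_form_mderive gmW _ _ msmooth_ricci_mx)|exact: linear_form_chris1|].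
  exact: linear_form_chris3.
move: b; apply: linear_form_eq => // [|i].
  apply: linear_formB; first apply: linear_formB; [exact: linear_form_bil1|exact: linear_form_chris2|].
  exact: linear_form_bil1.
move: c; apply: linear_form_eq => // [|j].
  apply: linear_formB; first apply: linear_formB; [exact: linear_form_bil2|exact: linear_form_bil2|].
  exact: linear_form_chris4.
by rewrite nabla_ricci_form_delta.
Qed.

End OnMetric.
End Curvature.

Section CurvaturePullback.
Variables (R : realType) (n : nat).
Local Notation rV := 'rV[R]_n.
Implicit Types (a b c v w x y : rV).
Variables (U W : set rV) (phi : rV -> rV) (g' gm : rV -> 'M[R]_n).
Hypothesis gmW : metric_on W gm.
Hypothesis gmU : metric_on U g'.
Hypothesis phiUW : forall y, U y -> W (phi y).
Hypothesis phis : vsmooth U phi.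
Hypothesis gE : pulled U phi g' gm.
Local Notation J := (jac phi).
Local Notation F a := (vderive a phi).

Let oW : open W. Proof. by case: gmW. Qed.
Let oU : open U. Proof. by case: gmU. Qed.

(* The derivative along [a] of [christoffel_pulled].  All terms on the right that
   involve second or third derivatives of [phi] are symmetric in [a] and [b], so
   antisymmetrizing gives the transformation law of the curvature. *)
Lemma christoffel_derivative_pulled y a b c : U y ->
  F (dchris g' y a b c + chris g' y a (chris g' y b c)) y =
  vderive a (vderive b (F c)) y + dchris gm (phi y) (F a y) (F b y) (F c y)
  + chris gm (phi y) (vderive a (F b) y) (F c y)
  + chris gm (phi y) (F b y) (vderive a (F c) y)
  + chris gm (phi y) (F a y) (vderive b (F c) y)
  + chris gm (phi y) (F a y) (chris gm (phi y) (F b y) (F c y)).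
Proof.
move=> Uy.
have CP := christoffel_pulled gmW gmU phiUW phis gE.
pose w := chris g' y b c.
have Fw : F w y = vderive b (F c) y + chris gm (phi y) (F b y) (F c y) by exact: CP.
have Faw := CP y a w Uy; rewrite {1}/w Fw chrisDr in Faw.
suff K : F (dchris g' y a b c) y + vderive a (F w) y =
    vderive a (vderive b (F c)) y + dchris gm (phi y) (F a y) (F b y) (F c y)
  + chris gm (phi y) (vderive a (F b) y) (F c y)
  + chris gm (phi y) (F b y) (vderive a (F c) y).
  rewrite -[dchris g' y a b c]scale1r (vderive_linear oU phis _ _ _ Uy) scale1r Faw.
  by rewrite addrA K -!addrA.
apply/rowP => k.
have L : 'D_a (fun z => 'D_(chris g' z b c) (fun z => phi z 0 k) z) y =
    (F (dchris g' y a b c) y + vderive a (F w) y) 0 k.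
  have sid : vsmooth U (fun z : rV => z).
    by move=> j; exact: smooth_coord.
  rewrite (derive_vfield oU oU (fun z Uz => Uz) sid a (phis k) (vsmooth_chris gmU b c) Uy).
  rewrite [RHS]mxE !vderiveE; congr (_ + _).
    congr ('D_ _ _ _); apply/rowP => j; rewrite vderiveE dchrisE.
    rewrite (bil_mderive a b c (msmooth_christoffel_mx gmU j) Uy).
    by congr ('D_a _ y); apply/funext => z; rewrite chrisE.
  have -> : vderive a (fun z : rV => z) y = a by apply/rowP => j; rewrite vderiveE; have [_ ->] := is_derive_coord j y a.
  by rewrite vderive_entry.
rewrite -L.
have E : {in U, (fun z => 'D_(chris g' z b c) (fun z => phi z 0 k) z) =1
   (fun z => vderive b (F c) z 0 k + bil (christoffel_mx gm k (phi z)) (F b z) (F c z))}.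
  move=> z; rewrite inE => Uz; rewrite -chrisE -vderiveE.
  by rewrite (CP z b c Uz) mxE.
rewrite (derive_eq_on _ oU E Uy).
have s1 : smooth_on U (fun z => vderive b (F c) z 0 k).
  exact: (vsmooth_vderive _ oU (vsmooth_vderive _ oU phis)).
have s2 : smooth_on U (fun z => bil (christoffel_mx gm k (phi z)) (F b z) (F c z)).
  apply: (smooth_bil oU _ (vsmooth_vderive b oU phis) (vsmooth_vderive c oU phis)) => i j.
  exact: (smooth_comp oU oW phiUW phis (msmooth_christoffel_mx gmW k i j)).
have [_ ->] := is_deriveD (smooth_is_derive a s1 Uy) (smooth_is_derive a s2 Uy).
rewrite (derive_bil_phi oW phiUW phis a (msmooth_christoffel_mx gmW k)
  (vsmooth_vderive b oU phis) (vsmooth_vderive c oU phis) Uy).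
by rewrite !mxE dchrisE !chrisE vderiveE !addrA.
Qed.

Lemma curv_pulled y a b c : U y ->
  F (curv g' y a b c) y = curv gm (phi y) (F a y) (F b y) (F c y).
Proof.
move=> Uy; rewrite (curvE gmU a b c Uy) (curvE gmW _ _ _ (phiUW Uy)).
set X := dchris g' y a b c + _; set Y := dchris g' y b a c + _.
have -> : X - Y = (-1) *: Y + X by rewrite scaleN1r addrC.
rewrite (vderive_linear oU phis _ _ _ Uy) scaleN1r addrC.
rewrite (christoffel_derivative_pulled a b c Uy) (christoffel_derivative_pulled b a c Uy).
have -> : vderive b (vderive a (F c)) y = vderive a (vderive b (F c)) y.
  apply/rowP => k; rewrite !vderiveE !vderive_entry.
  exact: (schwarz _ _ oU (smooth_Ck 2 (smooth_derive c (phis k))) Uy).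
rewrite (vderive_sym oU phis b a Uy).
set A := vderive a (vderive b _) y; set B := dchris _ _ _ _ _; set C := dchris _ _ _ _ _.
set D := chris _ _ (vderive a _ _) _; set E := chris _ _ (F b y) _.
set G := chris _ _ (F a y) _; set H := chris _ _ (F a y) _.
set I := chris _ _ (F b y) _.
apply/rowP => k; rewrite !mxE; ring.
Qed.

(** The endomorphism sending [X] to [R (X, b) c] is conjugated by the Jacobian, and the trace is
    invariant under conjugation. *)
Lemma ricci_mx_pulled : pulled U phi (ricci_mx g') (ricci_mx gm).
Proof.
move=> y Uy; apply/matrixP => j k; rewrite -[LHS]bil_delta -[RHS]bil_delta bil_mul.
rewrite -!(vderive_jac oU phis _ Uy) !bil_ricci_mx.
set b := delta_mx 0 j; set c := delta_mx 0 k.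
set T' := \matrix_(i, l) _; set T := \matrix_(i, l) _.
have uJ := jac_unit gmU gE Uy.
suff E : T' *m J y = J y *m T.
  by rewrite -[T'](mulmxK uJ) E mxtrace_mulC mulmxA mulVmx// mul1mx.
apply/row_matrixP => i; rewrite !row_mul.
have -> : row i T' = curv g' y (delta_mx 0 i) b c by apply/rowP => l; rewrite !mxE.
rewrite -(vderive_jac oU phis _ Uy) (curv_pulled _ _ _ Uy).
have -> : F (delta_mx 0 i) y = row i (J y) by rewrite (vderive_jac oU phis _ Uy) rowE.
apply/rowP => l; rewrite [RHS]mxE.
rewrite (linear_form_coord _ (linear_form_curv1 gm _ _ _ l)); apply: eq_bigr => p _.
by rewrite [T _ _]mxE.
Qed.

(** The second derivatives of [phi] that arise from differentiating [ricci_mx] are cancelled by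
    those in the transformation law of [chris]. *)
Lemma nabla_ricci_form_pulled y a b c : U y ->
  nabla_ricci_form g' y a b c = nabla_ricci_form gm (phi y) (F a y) (F b y) (F c y).
Proof.
move=> Uy.
have CP := christoffel_pulled gmW gmU phiUW phis gE.
rewrite /nabla_ricci_form (bil_mderive_pulled gmW gmU phiUW phis _ _ _ ricci_mx_pulled (msmooth_ricci_mx gmW)
  (msmooth_ricci_mx gmU) Uy).
rewrite !(bil_pulled gmU phis _ _ ricci_mx_pulled Uy) !(CP _ _ _ Uy) bilDl bilDr.
repeat match goal with |- context [bil ?M ?a ?b] => generalize (bil M a b) end.
by intros; lra.
Qed.

End CurvaturePullback.

(** * Leibniz rules for first and second derivatives *)

Section SmoothDerivatives.
Variables (R : realType) (V : normedModType R) (U : set V).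
Hypothesis oU : open U.
Implicit Types (f h : V -> R) (v y : V).

Lemma deriveD_smooth f h v y : smooth_on U f -> smooth_on U h -> U y ->
  'D_v (fun z => f z + h z) y = 'D_v f y + 'D_v h y.
Proof.
move=> sf sh Uy.
by have [_ ->] := is_deriveD (smooth_is_derive v sf Uy) (smooth_is_derive v sh Uy).
Qed.

Lemma deriveB_smooth f h v y : smooth_on U f -> smooth_on U h -> U y ->
  'D_v (fun z => f z - h z) y = 'D_v f y - 'D_v h y.
Proof.
move=> sf sh Uy.
by have [_ ->] := is_deriveB (smooth_is_derive v sf Uy) (smooth_is_derive v sh Uy).
Qed.

Lemma deriveZ_smooth f (k : R) v y : smooth_on U f -> U y ->
  'D_v (fun z => k * f z) y = k * 'D_v f y.
Proof.
by move=> sf Uy; have [_ ->] := is_deriveZ k (smooth_is_derive v sf Uy).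
Qed.

Lemma deriveM_smooth f h v y : smooth_on U f -> smooth_on U h -> U y ->
  'D_v (fun z => f z * h z) y = 'D_v f y * h y + f y * 'D_v h y.
Proof.
move=> sf sh Uy.
have [_ ->] := is_deriveM (smooth_is_derive v sf Uy) (smooth_is_derive v sh Uy).
by rewrite addrC /GRing.scale/= [h y * _]mulrC.
Qed.

Lemma derive_sum_smooth (I : Type) (r : seq I) (f : I -> V -> R) v y :
  (forall i, smooth_on U (f i)) -> U y ->
  'D_v (fun z => \sum_(i <- r) f i z) y = \sum_(i <- r) 'D_v (f i) y.
Proof.
move=> sf Uy.
by have [_ ->] := is_derive_sum_fun r (fun i => smooth_is_derive v (sf i) Uy).
Qed.

Lemma derive2_eq f h v w y : {in U, f =1 h} -> U y ->
  'D_w ('D_v f) y = 'D_w ('D_v h) y.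
Proof.
move=> E Uy; apply: (derive_eq_on _ oU _ Uy) => z; rewrite inE => Uz.
exact: (derive_eq_on _ oU E Uz).
Qed.

Lemma derive2D f h v w y : smooth_on U f -> smooth_on U h -> U y ->
  'D_w ('D_v (fun z => f z + h z)) y = 'D_w ('D_v f) y + 'D_w ('D_v h) y.
Proof.
move=> sf sh Uy.
rewrite -(deriveD_smooth _ (smooth_derive v sf) (smooth_derive v sh) Uy).
apply: (derive_eq_on _ oU _ Uy) => z; rewrite inE => Uz.
exact: deriveD_smooth.
Qed.

Lemma derive2B f h v w y : smooth_on U f -> smooth_on U h -> U y ->
  'D_w ('D_v (fun z => f z - h z)) y = 'D_w ('D_v f) y - 'D_w ('D_v h) y.
Proof.
move=> sf sh Uy.
rewrite -(deriveB_smooth _ (smooth_derive v sf) (smooth_derive v sh) Uy).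
apply: (derive_eq_on _ oU _ Uy) => z; rewrite inE => Uz.
exact: deriveB_smooth.
Qed.

Lemma derive2Z f (k : R) v w y : smooth_on U f -> U y ->
  'D_w ('D_v (fun z => k * f z)) y = k * 'D_w ('D_v f) y.
Proof.
move=> sf Uy; rewrite -(deriveZ_smooth _ _ (smooth_derive v sf) Uy).
apply: (derive_eq_on _ oU _ Uy) => z; rewrite inE => Uz.
exact: deriveZ_smooth.
Qed.

Lemma derive2_sum (I : Type) (r : seq I) (f : I -> V -> R) v w y :
  (forall i, smooth_on U (f i)) -> U y ->
  'D_w ('D_v (fun z => \sum_(i <- r) f i z)) y = \sum_(i <- r) 'D_w ('D_v (f i)) y.
Proof.
move=> sf Uy.
rewrite -(derive_sum_smooth _ _ (fun i => smooth_derive v (sf i)) Uy).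
apply: (derive_eq_on _ oU _ Uy) => z; rewrite inE => Uz.
exact: derive_sum_smooth.
Qed.

Lemma derive2M f h v w y : smooth_on U f -> smooth_on U h -> U y ->
  'D_w ('D_v (fun z => f z * h z)) y = 'D_w ('D_v f) y * h y
  + 'D_v f y * 'D_w h y + 'D_w f y * 'D_v h y + f y * 'D_w ('D_v h) y.
Proof.
move=> sf sh Uy.
have E : {in U, 'D_v (fun z => f z * h z) =1 (fun z => 'D_v f z * h z + f z * 'D_v h z)}.
  by move=> z; rewrite inE => Uz; exact: deriveM_smooth.
rewrite (derive_eq_on _ oU E Uy).
have sf' := smooth_derive v sf; have sh' := smooth_derive v sh.
rewrite (deriveD_smooth _ (smoothM oU sf' sh) (smoothM oU sf sh') Uy).
by rewrite (deriveM_smooth _ sf' sh Uy) (deriveM_smooth _ sf sh' Uy) addrA.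
Qed.

End SmoothDerivatives.

(** * Metric, Christoffel symbols and curvature at the centre of normal coordinates *)

Section NormalCoordinates.
Variables (R : realType) (n : nat).
Local Notation rV := 'rV[R]_n.
Implicit Types (a b c d e v w x y p : rV).
Variables (U : set rV) (g : rV -> 'M[R]_n) (o : rV).
Hypothesis gU : metric_on U g.
Hypothesis Uo : U o.
Hypothesis go : g o = 1%:M.
Hypothesis chris_o : forall a b, chris g o a b = 0.
Let oU : open U. Proof. by case: gU. Qed.
Let gs : msmooth U g. Proof. by case: gU. Qed.
Let gsym x : U x -> (g x)^T = g x. Proof. by case: gU => _ _ + _; apply. Qed.

Definition metric_form a b x := bil (g x) a b.
Definition chris_d1 e a b := vderive e (fun z => chris g z a b) o.
Definition chris_d2 e f a b := vderive e (vderive f (fun z => chris g z a b)) o.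
Definition dot a b := bil (1%:M : 'M[R]_n) a b.

Lemma smooth_metric_form a b : smooth_on U (metric_form a b).
Proof. exact: (smooth_bil oU gs (@vsmooth_cst R n U a) (@vsmooth_cst R n U b)). Qed.

Lemma metric_form_sym a b : {in U, metric_form a b =1 metric_form b a}.
Proof. by move=> x; rewrite inE => Ux; exact/bilC/gsym. Qed.

Lemma dotE a b : dot a b = \sum_k a 0 k * b 0 k.
Proof.
rewrite /dot bilE; apply: eq_bigr => i _.
rewrite (bigD1 i)//= mxE eqxx mulr1 big1 ?addr0// => j ji.
by rewrite mxE eq_sym (negbTE ji) mulr0.
Qed.

Lemma dotC a b : dot a b = dot b a.
Proof. by apply: bilC; rewrite trmx1. Qed.

Lemma dot_delta a k : dot a (delta_mx 0 k) = a 0 k.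
Proof.
by rewrite dotC dotE (sum_delta k (fun i => a 0 i)).
Qed.

Lemma mderive_metric_form a b c x : U x -> bil (mderive a g x) b c = 'D_a (metric_form b c) x.
Proof. exact: bil_mderive. Qed.

Lemma koszul_form a b c x : U x -> 2 * bil (g x) (chris g x a b) c =
  'D_a (metric_form b c) x + 'D_b (metric_form a c) x - 'D_c (metric_form a b) x.
Proof. by move=> Ux; rewrite (koszul gU) // !mderive_metric_form. Qed.

(** Adding the Koszul formulas for [(a, b, c)] and [(a, c, b)] isolates ['D_a] of the metric, so
    vanishing Christoffel symbols make it vanish. *)
Lemma derive_metric0 a b c : 'D_a (metric_form b c) o = 0.
Proof.
have E1 := koszul_form a b c Uo; have E2 := koszul_form a c b Uo.
have S p q r : 'D_p (metric_form q r) o = 'D_p (metric_form r q) o.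
  exact: (derive_eq_on _ oU (metric_form_sym q r) Uo).
rewrite chris_o bil0l mulr0 in E1; rewrite chris_o bil0l mulr0 in E2.
rewrite (S a c b) (S c a b) (S b a c) in E2; rewrite (S b a c) in E1.
move: E1 E2; rewrite (S c b a) (S c a b) (S b c a).
repeat match goal with |- context [derive ?f ?a ?b] => generalize (derive f a b) end.
by intros; lra.
Qed.

Lemma mderive_metric0 a : mderive a g o = 0.
Proof. by apply/matrixP => i j; rewrite -bil_delta mderive_metric_form// derive_metric0 mxE. Qed.

Lemma christoffel_mx0 k : christoffel_mx g k o = 0.
Proof.
by apply/matrixP => i j; rewrite -bil_delta -chrisE chris_o !mxE.
Qed.

Lemma derive_bil_cst B X c e x : msmooth U B -> vsmooth U X -> U x ->
  'D_e (fun z => bil (B z) (X z) c) x =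
  bil (mderive e B x) (X x) c + bil (B x) (vderive e X x) c.
Proof.
move=> sB sX Ux.
have [|||_ ->] := @is_derive_bil R n B X (fun=> c) e x.
- by move=> i j; exact: smooth_derivable (sB i j) Ux.
- by move=> i; exact: smooth_derivable (sX i) Ux.
- by move=> i; exact: derivable_cst.
have -> : vderive e (fun=> c) x = 0.
  by apply/rowP => k; rewrite vderiveE [RHS]mxE; exact: derive_cst.
by rewrite bil0r addr0.
Qed.

Lemma vsmooth_chris_U a b : vsmooth U (fun z => chris g z a b).
Proof. exact: vsmooth_chris. Qed.

Let E1 a b c : {in U, (fun z => 2 * bil (g z) (chris g z a b) c) =1
  (fun z => 'D_a (metric_form b c) z + 'D_b (metric_form a c) z - 'D_c (metric_form a b) z)}.
Proof. by move=> z; rewrite inE => Uz; exact: koszul_form. Qed.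

Let sB a b c : smooth_on U (fun z => bil (g z) (chris g z a b) c).
Proof. exact: (smooth_bil oU gs (vsmooth_chris_U a b) (@vsmooth_cst R n U c)). Qed.

Let sD a b c : smooth_on U ('D_a (metric_form b c)).
Proof. exact: (smooth_derive a (smooth_metric_form b c)). Qed.

Lemma chris_d1E e a b c : 2 * dot (chris_d1 e a b) c =
  'D_e ('D_a (metric_form b c)) o + 'D_e ('D_b (metric_form a c)) o - 'D_e ('D_c (metric_form a b)) o.
Proof.
have := derive_eq_on e oU (E1 a b c) Uo.
rewrite (deriveZ_smooth _ _ (sB a b c) Uo) (derive_bil_cst _ _ gs (vsmooth_chris_U a b) Uo).
rewrite chris_o bil0l add0r go => ->.
rewrite (deriveB_smooth _ (smoothD oU (sD a b c) (sD b a c)) (sD c a b) Uo).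
by rewrite (deriveD_smooth _ (sD a b c) (sD b a c) Uo).
Qed.

(** The Koszul formula differentiated twice. Every cross term contains a first derivative of the
    metric or the value of [chris], both zero at [o]. *)
Lemma chris_d2E e f a b c : 2 * dot (chris_d2 e f a b) c =
  'D_e ('D_f ('D_a (metric_form b c))) o + 'D_e ('D_f ('D_b (metric_form a c))) o
  - 'D_e ('D_f ('D_c (metric_form a b))) o.
Proof.
have := derive2_eq oU f e (E1 a b c) Uo.
rewrite (derive2Z oU _ _ _ (sB a b c) Uo).
have -> : 'D_e ('D_f (fun z => bil (g z) (chris g z a b) c)) o = dot (chris_d2 e f a b) c.
  have E : {in U, 'D_f (fun z => bil (g z) (chris g z a b) c) =1
    (fun z => bil (mderive f g z) (chris g z a b) c + bil (g z) (vderive f (fun z => chris g z a b) z) c)}.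
    by move=> z; rewrite inE => Uz; exact: (derive_bil_cst _ _ gs (vsmooth_chris_U a b) Uz).
  rewrite (derive_eq_on _ oU E Uo).
  have s1 : smooth_on U (fun z => bil (mderive f g z) (chris g z a b) c).
    exact: (smooth_bil oU (msmooth_mderive f oU gs) (vsmooth_chris_U a b) (@vsmooth_cst R n U c)).
  have s2 : smooth_on U (fun z => bil (g z) (vderive f (fun z => chris g z a b) z) c).
    exact: (smooth_bil oU gs (vsmooth_vderive f oU (vsmooth_chris_U a b)) (@vsmooth_cst R n U c)).
  rewrite (deriveD_smooth _ s1 s2 Uo).
  rewrite (derive_bil_cst _ _ (msmooth_mderive _ oU gs) (vsmooth_chris_U a b) Uo).
  rewrite (derive_bil_cst _ _ gs (vsmooth_vderive _ oU (vsmooth_chris_U a b)) Uo).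
  have b0 p q : bil (0 : 'M[R]_n) p q = 0 by rewrite bilM mulmx0 mul0mx mxE.
  by rewrite chris_o bil0l !mderive_metric0 !b0 !add0r go.
move=> ->.
rewrite (derive2B oU _ _ (smoothD oU (sD a b c) (sD b a c)) (sD c a b) Uo).
by rewrite (derive2D oU _ _ (sD a b c) (sD b a c) Uo).
Qed.

Lemma curv_center a b c : curv g o a b c = chris_d1 a b c - chris_d1 b a c.
Proof.
rewrite (curvE gU _ _ _ Uo) !chris_o.
have DG p q r : dchris g o p q r = chris_d1 p q r.
  apply/rowP => k; rewrite dchrisE vderiveE (bil_mderive _ _ _ (msmooth_christoffel_mx gU k) Uo).
  by congr ('D_p _ o); apply/funext => z; rewrite chrisE.
by rewrite !DG !addr0.
Qed.

(** The quadratic part of the curvature is a product of two quantities vanishing at [o], so it drops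
    out of the first derivative; the Christoffel corrections vanish there as well. *)
Lemma nabla_ricci_form_center a b c : nabla_ricci_form g o a b c =
  \sum_i (chris_d2 a (delta_mx 0 i) b c 0 i - chris_d2 a b (delta_mx 0 i) c 0 i).
Proof.
rewrite /nabla_ricci_form !chris_o bil0l bil0r !subr0 (bil_mderive _ _ _ (msmooth_ricci_mx gU) Uo).
pose q p r s i x := bil (christoffel_mx g i x) p (chris g x r s).
have E : {in U, (fun z => bil (ricci_mx g z) b c) =1 (fun z => \sum_i
  ((vderive (delta_mx 0 i) (fun x => chris g x b c) z 0 i + q (delta_mx 0 i) b c i z)
  - (vderive b (fun x => chris g x (delta_mx 0 i) c) z 0 i + q b (delta_mx 0 i) c i z)))}.
  move=> z; rewrite inE => Uz; rewrite bil_ricci_mx /mxtrace; apply: eq_bigr => i _.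
  rewrite mxE (curvE gU _ _ _ Uz).
  have DG p r s : dchris g z p r s 0 i = vderive p (fun x => chris g x r s) z 0 i.
    rewrite dchrisE vderiveE (bil_mderive _ _ _ (msmooth_christoffel_mx gU i) Uz).
    by congr ('D_p _ z); apply/funext => x; rewrite chrisE.
  by rewrite !(mxE, chrisE, DG).
rewrite (derive_eq_on _ oU E Uo).
have sv p r s i : smooth_on U (fun z => vderive p (fun x => chris g x r s) z 0 i).
  exact: (vsmooth_vderive _ oU (vsmooth_chris_U r s)).
have sq p r s i : smooth_on U (q p r s i).
  exact: (smooth_bil oU (msmooth_christoffel_mx gU i) (@vsmooth_cst R n U p) (vsmooth_chris_U r s)).
rewrite (derive_sum_smooth _ _ _ Uo); last first.
  by move=> i; apply: smoothB => //; apply: smoothD.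
apply: eq_bigr => i _.
rewrite (deriveB_smooth _ (smoothD oU (sv _ _ _ _) (sq _ _ _ _)) (smoothD oU (sv _ _ _ _) (sq _ _ _ _)) Uo).
rewrite (deriveD_smooth _ (sv _ _ _ _) (sq _ _ _ _) Uo).
rewrite (deriveD_smooth _ (sv _ _ _ _) (sq _ _ _ _) Uo).
have Q0 p r s : 'D_a (q p r s i) o = 0.
  have [|||_ ->] := @is_derive_bil R n (christoffel_mx g i) (fun=> p) (fun x => chris g x r s) a o.
  - by move=> j k; exact: smooth_derivable (msmooth_christoffel_mx gU i j k) Uo.
  - by move=> j; exact: derivable_cst.
  - by move=> j; exact: smooth_derivable (vsmooth_chris_U r s j) Uo.
  have b0 t t' : bil (0 : 'M[R]_n) t t' = 0 by rewrite bilM mulmx0 mul0mx mxE.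
  by rewrite chris_o bil0r christoffel_mx0 !b0 !addr0.
by rewrite !Q0 !addr0 /chris_d2 !vderiveE.
Qed.

End NormalCoordinates.

(** * The Hessian at a null vector, in normal coordinates *)

Section VectorFieldDerivatives.
Variables (R : realType) (n : nat).
Local Notation rV := 'rV[R]_n.
Implicit Types (a b v x y : rV).
Variables (U : set rV) (u : rV -> R) (X : rV -> rV).
Hypothesis oU : open U.
Hypothesis us : smooth_on U u.
Hypothesis sX : vsmooth U X.

Lemma smooth_vfield (w : rV -> R) (Y : rV -> rV) : smooth_on U w -> vsmooth U Y ->
  smooth_on U (fun z => 'D_(Y z) w z).
Proof.
move=> sw sY; apply: (@smooth_eq _ _ _ (fun z => \sum_k Y z 0 k * pd k w z)) => //.
  move=> z; rewrite inE => Uz.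
  by rewrite (derive_coord _ oU (smooth_Ck 1 sw) Uz).
apply: smooth_sum => [|k _]; first exact: oU.
exact: (smoothM oU (sY k) (smooth_derive (delta_mx 0 k) sw)).
Qed.

Lemma derive_vfield1 (w : rV -> R) (Y : rV -> rV) a y : smooth_on U w -> vsmooth U Y ->
  U y ->
  'D_a (fun z => 'D_(Y z) w z) y = 'D_(vderive a Y y) w y + 'D_(Y y) ('D_a w) y.
Proof.
move=> sw sY Uy.
have sid : vsmooth U (fun z : rV => z) by move=> j; exact: smooth_coord.
rewrite (derive_vfield oU oU (fun z Uz => Uz) sid a sw sY Uy).
have -> : vderive a (fun z : rV => z) y = a.
  by apply/rowP => j; rewrite vderiveE; have [_ ->] := is_derive_coord j y a.
by rewrite (schwarz _ _ oU (smooth_Ck 2 sw) Uy).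
Qed.

Lemma derive2_vfield a b y : U y ->
  'D_b ('D_a (fun z => 'D_(X z) u z)) y =
  'D_(vderive b (vderive a X) y) u y + 'D_(vderive a X y) ('D_b u) y
  + 'D_(vderive b X y) ('D_a u) y + 'D_(X y) ('D_b ('D_a u)) y.
Proof.
move=> Uy.
have E : {in U, 'D_a (fun z => 'D_(X z) u z) =1
    (fun z => 'D_(vderive a X z) u z + 'D_(X z) ('D_a u) z)}.
  by move=> z; rewrite inE => Uz; exact: derive_vfield1.
have sX' := vsmooth_vderive a oU sX; have su' := smooth_derive a us.
refine (etrans (derive_eq_on b oU E Uy) _).
refine (etrans (deriveD_smooth b (smooth_vfield us sX') (smooth_vfield su' sX) Uy) _).
refine (etrans (congr2 +%R (derive_vfield1 b us sX' Uy) (derive_vfield1 b su' sX Uy)) _).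
exact: addrA.
Qed.

End VectorFieldDerivatives.

(** Locked so that each third derivative is one atom when an identity is handed to linear
    arithmetic. *)
HB.lock Definition third_derive (R : realType) n (o : 'rV[R]_n) (h : 'rV[R]_n -> R)
    (a b e : 'rV[R]_n) : R := 'D_a ('D_b ('D_e h)) o.

Section NormalStatic.
Variables (R : realType) (n : nat).
Local Notation rV := 'rV[R]_n.
Implicit Types (a b e w x y p : rV) (i j k : 'I_n).
Variables (U : set rV) (g : rV -> 'M[R]_n) (o : rV) (u : rV -> R) (Fr : R -> R)
  (c : R) (v : rV).
Hypothesis gU : metric_on U g.
Hypothesis Uo : U o.
Hypothesis go : g o = 1%:M.
Hypothesis chris_o : forall a b, chris g o a b = 0.
Hypothesis sec : forall a b, 0 <= bil (g o) (curv g o a b b) a.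
Hypothesis ric : forall a b d, nabla_ricci_form g o a b d = 0.
Hypothesis us : smooth_on U u.
Hypothesis Frs : smooth_on [set: R] Fr.
Hypothesis Fr2 : forall t : R, 0 <= 'D_1 ('D_1 Fr) t.
Hypothesis psdU : forall x, U x -> psd (hessian g u x + c *: g x).
Hypothesis null : bil (hessian g u o + c *: g o) v v = 0.

Let oU : open U. Proof. by case: gU. Qed.
Let gs : msmooth U g. Proof. by case: gU. Qed.
Local Notation chris_d1 := (chris_d1 g o).
Local Notation chris_d2 := (chris_d2 g o).
Local Notation dot := (@dot R n).
Local Notation metric_form := (metric_form g).
Local Notation "''e_' i" := (delta_mx 0 i : rV) (at level 8, i at level 2).

Lemma third_deriveE (h : rV -> R) a b e : third_derive o h a b e = 'D_a ('D_b ('D_e h)) o.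
Proof. by rewrite third_derive.unlock. Qed.

Lemma third_rot (h : rV -> R) a b e : smooth_on U h ->
  third_derive o h a b e = third_derive o h b a e.
Proof.
move=> sh; rewrite !third_deriveE.
exact: (schwarz b a oU (smooth_Ck 2 (smooth_derive e sh)) Uo).
Qed.

Lemma third_in (h : rV -> R) a b e : smooth_on U h ->
  third_derive o h a b e = third_derive o h a e b.
Proof.
move=> sh; rewrite !third_deriveE; apply: (derive_eq_on a oU _ Uo) => z.
rewrite inE => Uz; exact: (schwarz e b oU (smooth_Ck 2 sh) Uz).
Qed.

Lemma third_sym p q a b e : third_derive o (metric_form p q) a b e = third_derive o (metric_form q p) a b e.
Proof.
rewrite !third_deriveE; apply: (derive_eq_on a oU _ Uo) => z; rewrite inE => Uz.
by apply: (derive2_eq oU e b _ Uz) => x; exact: (metric_form_sym gU).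
Qed.

Lemma chris_d2_third e f a b p : 2 * dot (chris_d2 e f a b) p =
  third_derive o (metric_form b p) e f a + third_derive o (metric_form a p) e f b - third_derive o (metric_form a b) e f p.
Proof. by rewrite !third_deriveE; exact: (chris_d2E gU Uo go chris_o). Qed.

(* Summed over [i], the right-hand side is
   [2 (nabla_v Ric) (v, p) - (nabla_p Ric) (v, v)]. *)
Lemma ricci_combination i p :
  dot (chris_d2 v v 'e_i 'e_i) p - dot (chris_d2 'e_i 'e_i v v) p =
  2 * (dot (chris_d2 v 'e_i v p) 'e_i - dot (chris_d2 v v 'e_i p) 'e_i)
  - (dot (chris_d2 p 'e_i v v) 'e_i - dot (chris_d2 p v 'e_i v) 'e_i).
Proof.
have sg := smooth_metric_form gU.
(* The Koszul formula expands the six terms into third derivatives of the metric; the equations [Q1]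
   to [Q8] identify those that agree by symmetry of mixed derivatives and of the metric, which
   leaves a linear identity. *)
have K1 := chris_d2_third v v 'e_i 'e_i p; have K2 := chris_d2_third 'e_i 'e_i v v p.
have K3 := chris_d2_third v 'e_i v p 'e_i; have K4 := chris_d2_third v v 'e_i p 'e_i.
have K5 := chris_d2_third p 'e_i v v 'e_i; have K6 := chris_d2_third p v 'e_i v 'e_i.
have rot q r a b e := @third_rot (metric_form q r) a b e (sg q r).
have inn q r a b e := @third_in (metric_form q r) a b e (sg q r).
have Q1 := third_sym p 'e_i v v 'e_i.
have Q2 : third_derive o (metric_form p 'e_i) v 'e_i v = third_derive o (metric_form 'e_i p) v v 'e_i.
  by rewrite third_sym inn.
have Q3 : third_derive o (metric_form v 'e_i) v 'e_i p = third_derive o (metric_form v 'e_i) p 'e_i v.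
  by rewrite rot inn rot inn.
have Q4 : third_derive o (metric_form v p) v 'e_i 'e_i = third_derive o (metric_form v p) 'e_i 'e_i v.
  by rewrite rot inn.
have Q5 : third_derive o (metric_form v v) p 'e_i 'e_i = third_derive o (metric_form v v) 'e_i 'e_i p.
  by rewrite rot inn.
have Q6 := third_sym 'e_i v p v 'e_i.
have Q7 : third_derive o (metric_form 'e_i 'e_i) p v v = third_derive o (metric_form 'e_i 'e_i) v v p.
  by rewrite rot inn.
have Q8 : third_derive o (metric_form v 'e_i) p v 'e_i = third_derive o (metric_form v 'e_i) p 'e_i v by rewrite inn.
clear rot inn; move: K1 K2 K3 K4 K5 K6 Q1 Q2 Q3 Q4 Q5 Q6 Q7 Q8.
repeat match goal with
  | |- context [third_derive ?o ?f ?a ?b ?e] => generalize (third_derive o f a b e)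
  | |- context [dot ?a ?b] => generalize (dot a b) end.
by intros; lra.
Qed.

(** This vector is paired with [grad u] when [Delta psi] is compared with the second derivative of
    the Laplacian of [u]; parallel Ricci curvature enters the argument here. *)
Lemma chris_d2_trace : \sum_i (chris_d2 v v 'e_i 'e_i - chris_d2 'e_i 'e_i v v) = 0.
Proof.
apply/rowP => k; rewrite summxE [RHS]mxE.
have subE (p q : rV) : (p - q) 0 k = dot p 'e_k - dot q 'e_k.
  by rewrite !dot_delta !mxE.
under eq_bigr do rewrite subE ricci_combination 4!dot_delta.
rewrite sumrB -big_distrr/=.
rewrite -(nabla_ricci_form_center gU Uo chris_o v v 'e_k) -(nabla_ricci_form_center gU Uo chris_o 'e_k v v).
by rewrite !ric mulr0 subr0.
Qed.

(* Its quadratic form is [w |-> 2 <R (w, v) v, w>]; see [curvature_mx_psd]. *)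
Definition curvature_mx : 'M[R]_n :=
  - mderive v (mderive v g) o + 2 *: \matrix_(i, j) chris_d1 'e_i v v 0 j.

Lemma bil_mderive2 w : bil (mderive v (mderive v g) o) w w = 'D_v ('D_v (metric_form w w)) o.
Proof.
rewrite (bil_mderive v w w (msmooth_mderive v oU gs) Uo).
apply: (derive_eq_on v oU _ Uo) => z; rewrite inE => Uz.
exact: (mderive_metric_form gU v w w Uz).
Qed.

Lemma linear_form_chris_d1 a b p : linear_form (fun e => dot (chris_d1 e a b) p).
Proof.
move=> k e e'; rewrite /chris_d1 (vderive_linear oU (vsmooth_chris_U gU a b) e e' k Uo).
by rewrite /dot bilDl bilZl.
Qed.

Lemma bil_chris_d1 w p : bil (\matrix_(i, j) chris_d1 'e_i v v 0 j) w p = dot (chris_d1 w v v) p.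
Proof.
rewrite (linear_form_coord w (linear_form_chris_d1 v v p)) bilE; apply: eq_bigr => i _.
rewrite dotE big_distrr/=; apply: eq_bigr => j _.
by rewrite mxE -mulrA; congr (_ * _); exact: mulrC.
Qed.

(** In the Koszul formula for [2 * dot (chris_d1 v w v) w] the mixed terms cancel and leave
    ['D_v ('D_v (metric_form w w))]. The quadratic form is therefore twice the expression given by
    [curv_center], to which [sec] applies. *)
Lemma curvature_mx_psd : psd curvature_mx.
Proof.
move=> w; rewrite -bilM /curvature_mx bilDm bilZm bil_chris_d1 -scaleN1r bilZm mulN1r bil_mderive2.
have K := sec w v; rewrite (curv_center gU Uo chris_o) go bilBl -/(dot _ _) -/(dot _ _) in K.
have K1 := chris_d1E gU Uo go chris_o v w v w.
have S : 'D_v ('D_w (metric_form v w)) o = 'D_v ('D_w (metric_form w v)) o.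
  by apply: (derive2_eq oU w v _ Uo) => x; exact: (metric_form_sym gU).
move: K K1 S.
repeat match goal with
  | |- context [derive ?f ?a ?b] => generalize (derive f a b)
  | |- context [dot ?a ?b] => generalize (dot a b) end.
by intros; lra.
Qed.

End NormalStatic.

(** * Second derivatives of contractions and of the Hessian at the centre *)

Section NormalAssembly.
Variables (R : realType) (n : nat).
Local Notation rV := 'rV[R]_n.
Implicit Types (a b e w x y p : rV) (i j k : 'I_n).
Variables (U : set rV) (g : rV -> 'M[R]_n) (o : rV) (u : rV -> R) (Fr : R -> R)
  (c : R) (v : rV).
Hypothesis gU : metric_on U g.
Hypothesis Uo : U o.
Hypothesis go : g o = 1%:M.
Hypothesis chris_o : forall a b, chris g o a b = 0.
Hypothesis us : smooth_on U u.

Let oU : open U. Proof. by case: gU. Qed.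
Let gs : msmooth U g. Proof. by case: gU. Qed.
Local Notation chris_d1 := (chris_d1 g o).
Local Notation chris_d2 := (chris_d2 g o).
Local Notation dot := (@dot R n).
Local Notation metric_form := (metric_form g).
Local Notation "''e_' i" := (delta_mx 0 i : rV) (at level 8, i at level 2).
Local Notation H := (hessian g u o + c *: g o).
Local Notation gr := (grad u o).
Local Notation S := (curvature_mx g o v).
Local Notation D2g := (mderive v (mderive v g) o).

Lemma derive_grad w : 'D_w u o = dot w gr.
Proof.
rewrite (derive_coord _ oU (smooth_Ck 1 us) Uo) dotE.
by apply: eq_bigr => k _; rewrite [gr 0 k]mxE.
Qed.

Lemma derive_hess a b : 'D_a ('D_b u) o = bil H a b - c * dot a b.
Proof.
rewrite bilDm bilZm go -/(dot a b) addrK (bil_hessian gU _ _ us Uo) chris_o.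
by rewrite derive0 subr0.
Qed.

Lemma H_sym : H^T = H.
Proof.
apply/matrixP => i j; rewrite mxE -[LHS]bil_delta -[RHS]bil_delta.
have E a b : bil H a b = 'D_a ('D_b u) o + c * dot a b by rewrite derive_hess subrK.
refine (etrans (E _ _) (etrans _ (esym (E _ _)))).
refine (congr2 +%R (schwarz _ _ oU (smooth_Ck 2 us) Uo) (congr1 ( *%R c) _)).
exact: dotC.
Qed.

Definition inv_metric i j x := invmx (g x) i j.

Lemma smooth_ginv i j : smooth_on U (inv_metric i j).
Proof. by case: gU => *; exact: smooth_invmx. Qed.

Lemma ginv_o i j : inv_metric i j o = (i == j)%:R.
Proof. by rewrite /inv_metric go invmx1 mxE. Qed.

Lemma ginv_mul i j : {in U, (fun x => \sum_k inv_metric i k x * metric_form 'e_k 'e_j x) =1 (fun=> (i == j)%:R)}.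
Proof.
move=> x; rewrite inE => Ux.
have gx : g x \in unitmx by case: gU => _ _ _; apply.
have := congr1 (fun M : 'M[R]_n => M i j) (mulVmx gx); rewrite !mxE => <-.
by apply: eq_bigr => k _; rewrite /metric_form bil_delta.
Qed.

Lemma sum_delta_r (f : 'I_n -> R) j : \sum_k f k * (k == j)%:R = f j.
Proof.
rewrite (bigD1 j)//= eqxx mulr1 big1 ?addr0// => k kj.
by rewrite (negbTE kj) mulr0.
Qed.

Lemma sum_delta_l (f : 'I_n -> R) j : \sum_k (j == k)%:R * f k = f j.
Proof.
by under eq_bigr do rewrite mulrC eq_sym; exact: sum_delta_r.
Qed.

Lemma metric_form_o i j : metric_form 'e_i 'e_j o = (i == j)%:R.
Proof. by rewrite /metric_form bil_delta go mxE. Qed.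

Lemma derive_ginv a i j : 'D_a (inv_metric i j) o = 0.
Proof.
have sm k : smooth_on U (fun x => inv_metric i k x * metric_form 'e_k 'e_j x).
  exact: (smoothM oU (smooth_ginv i k) (smooth_metric_form gU 'e_k 'e_j)).
have := derive_eq_on a oU (ginv_mul i j) Uo.
rewrite derive_cst (derive_sum_smooth _ a sm Uo) => <-.
rewrite -[LHS](sum_delta_r (fun k => 'D_a (inv_metric i k) o)); apply: eq_bigr => k _.
rewrite (deriveM_smooth a (smooth_ginv i k) (smooth_metric_form gU 'e_k 'e_j) Uo).
by rewrite (derive_metric0 gU Uo chris_o) mulr0 addr0 metric_form_o.
Qed.

(** Differentiate [g^-1 g = 1] twice: first derivatives of both factors vanish at [o], and the two
    pure second derivatives add up to zero. *)
Lemma derive2_ginv i j : 'D_v ('D_v (inv_metric i j)) o = - D2g i j.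
Proof.
have sm k : smooth_on U (fun x => inv_metric i k x * metric_form 'e_k 'e_j x).
  exact: (smoothM oU (smooth_ginv i k) (smooth_metric_form gU 'e_k 'e_j)).
have := derive2_eq oU v v (ginv_mul i j) Uo.
have -> : 'D_v (fun=> (i == j)%:R : R) = (fun=> 0) :> (rV -> R).
  by apply/funext => x; exact: derive_cst.
rewrite derive_cst (derive2_sum oU _ v v sm Uo).
under eq_bigr => k _.
  rewrite (derive2M oU v v (smooth_ginv i k) (smooth_metric_form gU 'e_k 'e_j) Uo).
  rewrite (derive_metric0 gU Uo chris_o) !mulr0 !addr0 metric_form_o ginv_o.
  over.
rewrite big_split/= sum_delta_r sum_delta_l => /eqP; rewrite addr_eq0 => /eqP ->.
congr (- _); rewrite -[RHS]bil_delta (bil_mderive v _ _ (msmooth_mderive v oU gs) Uo).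
apply/esym/(derive_eq_on v oU _ Uo) => z; rewrite inE => Uz.
exact: (mderive_metric_form gU v _ _ Uz).
Qed.

(** Serves the Laplacian and [grad_sq] alike, both being contractions with the inverse metric; the
    cross terms vanish by [derive_ginv]. *)
Lemma derive2_contraction (k : 'I_n -> 'I_n -> rV -> R) :
  (forall i j, smooth_on U (k i j)) ->
  'D_v ('D_v (fun x => \sum_i \sum_j inv_metric i j x * k i j x)) o =
  \sum_i (- (\sum_j D2g i j * k i j o) + 'D_v ('D_v (k i i)) o).
Proof.
move=> sk.
have sm i j : smooth_on U (fun x => inv_metric i j x * k i j x).
  exact: (smoothM oU (smooth_ginv i j) (sk i j)).
have ss i : smooth_on U (fun x => \sum_j inv_metric i j x * k i j x).
  by apply: smooth_sum => [|j _]; [exact: oU|exact: sm].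
rewrite (derive2_sum oU _ v v ss Uo); apply: eq_bigr => i _.
rewrite (derive2_sum oU _ v v (sm i) Uo).
under eq_bigr => j _.
  rewrite (derive2M oU v v (smooth_ginv i j) (sk i j) Uo).
  rewrite derive_ginv derive2_ginv !mul0r !addr0 ginv_o.
  over.
rewrite big_split/= (sum_delta_l (fun j => 'D_v ('D_v (k i j)) o)) -sumrN.
by congr (_ + _); apply: eq_bigr => j _; rewrite mulNr.
Qed.

Definition hessian_form a b x := 'D_a ('D_b u) x - 'D_(chris g x a b) u x.

Lemma smooth_hessian_form a b : smooth_on U (hessian_form a b).
Proof.
apply: (smoothB oU (smooth_derive a (smooth_derive b us))).
exact: (smooth_vfield oU us (vsmooth_chris_U gU a b)).
Qed.

Lemma hessian_formE x a b : U x -> bil (hessian g u x) a b = hessian_form a b x.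
Proof. by move=> Ux; rewrite (bil_hessian gU _ _ us Ux). Qed.

Definition fourth_derive a b d e := third_derive o ('D_e u) a b d.

(** One order of derivatives comes from the Laplacian of [psi], the other from the second derivative
    of the Laplacian of [u]. *)
Lemma fourth_swap a b : fourth_derive a a b b = fourth_derive b b a a.
Proof.
have sb := smooth_derive b us; have sa := smooth_derive a us.
rewrite /fourth_derive (third_in gU Uo _ _ _ sb).
have -> : third_derive o ('D_b u) a b a = third_derive o ('D_a u) a b b.
  rewrite !third_deriveE; apply: (derive_eq_on a oU _ Uo) => z; rewrite inE => Uz.
  apply: (derive_eq_on b oU _ Uz) => x; rewrite inE => Ux.
  exact: (schwarz b a oU (smooth_Ck 2 us) Ux).
by rewrite (third_rot gU Uo _ _ _ sa) (third_in gU Uo _ _ _ sa).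
Qed.

Lemma derive_hessian_form e a b : 'D_e (hessian_form a b) o = third_derive o u e a b - dot (chris_d1 e a b) gr.
Proof.
have sV := smooth_vfield oU us (vsmooth_chris_U gU a b).
rewrite /hessian_form (deriveB_smooth e (smooth_derive a (smooth_derive b us)) sV Uo).
rewrite (derive_vfield1 oU e us (vsmooth_chris_U gU a b) Uo) chris_o derive0 addr0.
by rewrite third_deriveE -derive_grad.
Qed.

(** The factor 2 collects the two mixed Leibniz terms. They contain the Hessian of [u], which is
    traded for [H] minus [c] times the metric so that nullity can be exploited; the third
    derivatives of [u] are multiplied by [chris] at [o], which is zero. *)
Lemma derive2_hessian_form e a b : 'D_e ('D_e (hessian_form a b)) o =
  fourth_derive e e a b - (dot (chris_d2 e e a b) gr
                    + 2 * (bil H (chris_d1 e a b) e - c * dot (chris_d1 e a b) e)).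
Proof.
have sV := smooth_vfield oU us (vsmooth_chris_U gU a b).
refine (etrans (derive2B oU e e (smooth_derive a (smooth_derive b us)) sV Uo) _).
rewrite /fourth_derive third_deriveE; refine (congr1 (fun q => _ - q) _).
refine (etrans (derive2_vfield oU us (vsmooth_chris_U gU a b) e e Uo) _).
rewrite -derive_grad -derive_hess.
have : 'D_(chris g o a b) ('D_e ('D_e u)) o = 0 by rewrite chris_o derive0.
rewrite -/(chris_d1 e a b) -/(chris_d2 e e a b).
repeat match goal with |- context [derive ?f ?a ?b] => generalize (derive f a b) end.
by intros; lra.
Qed.

End NormalAssembly.

(** [T] and [T'] are the mixed second derivatives of the metric in the two orders. By the Koszul
    formula the multiples of [c] amount to [2 * c * T] on one side and [2 * c * T'] on the other, so
    they cancel. *)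
Lemma laplacian_arith (R : realType) (c f4 a' a h da dv T T' L Dv Z : R) :
  0 <= f4 - (a' + 2 * (h - c * da)) + c * L ->
  2 * dv = T + T - Dv -> 2 * da = T' + T' - L -> T = T' ->
  - Z + 2 * h - (a - a') <= - (Z - c * Dv) + (f4 - (a + 2 * (0 - c * dv))).
Proof.
move=> K K1 K2 TT; have {K1} := congr1 ( *%R c) K1; have {K2} := congr1 ( *%R c) K2.
by rewrite -TT; lra.
Qed.

Lemma static_arith (R : realType) (c p q r t s : R) :
  0 <= p -> 0 <= q -> 0 <= r ->
  (2 * c ^+ 2 - s * c) * t <= p + (q + 2 * c ^+ 2 * t) + (r - s * c * t).
Proof. by lra. Qed.

(** * The spatial inequality at the centre of normal coordinates *)

Section NormalStatic.
Variables (R : realType) (n : nat).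
Local Notation rV := 'rV[R]_n.
Implicit Types (a b e w x y p : rV) (i j k : 'I_n).
Variables (U : set rV) (g : rV -> 'M[R]_n) (o : rV) (u : rV -> R) (Fr : R -> R)
  (c : R) (v : rV).
Hypothesis gU : metric_on U g.
Hypothesis Uo : U o.
Hypothesis go : g o = 1%:M.
Hypothesis chris_o : forall a b, chris g o a b = 0.
Hypothesis sec : forall a b, 0 <= bil (g o) (curv g o a b b) a.
Hypothesis ric : forall a b d, nabla_ricci_form g o a b d = 0.
Hypothesis us : smooth_on U u.
Hypothesis Frs : smooth_on [set: R] Fr.
Hypothesis Fr2 : forall t : R, 0 <= 'D_1 ('D_1 Fr) t.
Hypothesis psdU : forall x, U x -> psd (hessian g u x + c *: g x).
Hypothesis null : bil (hessian g u o + c *: g o) v v = 0.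

Let oU : open U. Proof. by case: gU. Qed.
Let gs : msmooth U g. Proof. by case: gU. Qed.
Local Notation chris_d1 := (chris_d1 g o).
Local Notation chris_d2 := (chris_d2 g o).
Local Notation dot := (@dot R n).
Local Notation metric_form := (metric_form g).
Local Notation "''e_' i" := (delta_mx 0 i : rV) (at level 8, i at level 2).
Local Notation H := (hessian g u o + c *: g o).
Local Notation gr := (grad u o).
Local Notation S := (curvature_mx g o v).
Local Notation D2g := (mderive v (mderive v g) o).

Lemma H_null a : bil H v a = 0.
Proof.
have psdo := psdU Uo; have symo := H_sym c gU Uo go chris_o us.
have /(psd_null symo psdo) : (v *m H *m v^T) 0 0 = 0 by rewrite -bilM.
by rewrite bilM => ->; rewrite mul0mx mxE.
Qed.

Lemma H_null_r a : bil H a v = 0.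
Proof. by rewrite (bilC _ _ (H_sym c gU Uo go chris_o us)) H_null. Qed.

Definition psi x := hessian_form g u v v x + c * metric_form v v x.

Lemma psi_smooth : smooth_on U psi.
Proof.
exact: (smoothD oU (smooth_hessian_form gU us v v) (smoothM oU (@smooth_cst _ _ U c) (smooth_metric_form gU v v))).
Qed.

Lemma psi_min y : U y -> psi o <= psi y.
Proof.
have E x : U x -> psi x = bil (hessian g u x + c *: g x) v v.
  by move=> Ux; rewrite bilDm bilZm (hessian_formE gU us _ _ Ux).
move=> Uy; rewrite (E o Uo) (E y Uy) null bilM; exact: psdU.
Qed.

(* [psi] has a critical point at [o]. *)
Lemma third_null a : third_derive o u a v v = dot (chris_d1 a v v) gr.
Proof.
have := local_min_derive a oU (smooth_Ck 1 psi_smooth) Uo psi_min.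
have sg := smoothM oU (@smooth_cst _ _ U c) (smooth_metric_form gU v v).
rewrite /psi (deriveD_smooth a (smooth_hessian_form gU us v v) sg Uo).
rewrite (deriveZ_smooth c a (smooth_metric_form gU v v) Uo) (derive_metric0 gU Uo chris_o) mulr0 addr0.
rewrite (derive_hessian_form gU Uo chris_o us) => /eqP.
by rewrite subr_eq0 => /eqP.
Qed.

Lemma psi_second a : 0 <= fourth_derive o u a a v v - (dot (chris_d2 a a v v) gr
   + 2 * (bil H (chris_d1 a v v) a - c * dot (chris_d1 a v v) a)) + c * 'D_a ('D_a (metric_form v v)) o.
Proof.
have := local_min_derive2 a oU (smooth_Ck 2 psi_smooth) Uo psi_min.
have sg := smoothM oU (@smooth_cst _ _ U c) (smooth_metric_form gU v v).
rewrite /psi (derive2D oU a a (smooth_hessian_form gU us v v) sg Uo).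
rewrite (derive2Z oU c a a (smooth_metric_form gU v v) Uo).
by rewrite (derive2_hessian_form c gU Uo go chris_o us).
Qed.

Lemma curvature_mx_entry i j : S i j = - D2g i j + 2 * chris_d1 'e_i v v 0 j.
Proof. by rewrite /curvature_mx !mxE. Qed.

(* The inequality is [Delta psi >= 0], term by term. *)
Lemma laplacian_term i :
  \sum_j H i j * S i j - dot (chris_d2 v v 'e_i 'e_i - chris_d2 'e_i 'e_i v v) gr <=
  - (\sum_j D2g i j * hessian_form g u 'e_i 'e_j o) + 'D_v ('D_v (hessian_form g u 'e_i 'e_i)) o.
Proof.
have K := psi_second 'e_i.
have dotB p q r : dot (p - q) r = dot p r - dot q r by exact: bilBl.
rewrite dotB (derive2_hessian_form c gU Uo go chris_o us v).
rewrite (fourth_swap gU Uo us v 'e_i) H_null_r.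
have -> : \sum_j H i j * S i j = - (\sum_j D2g i j * H i j) + 2 * bil H (chris_d1 'e_i v v) 'e_i.
  rewrite (bilC _ _ (H_sym c gU Uo go chris_o us)) bil_deltal big_distrr/= -sumrN -big_split/=.
  apply: eq_bigr => j _; rewrite curvature_mx_entry.
  move: (H i j) (D2g i j) (chris_d1 _ _ _ _ _) => p q r; ring.
have -> : \sum_j D2g i j * hessian_form g u 'e_i 'e_j o = \sum_j D2g i j * H i j - c * D2g i i.
  transitivity (\sum_j (D2g i j * H i j - c * (D2g i j * (j == i)%:R))).
    apply: eq_bigr => j _.
    rewrite -(hessian_formE gU us _ _ Uo) [H i j]mxE bil_delta [(c *: g o) i j]mxE go [1%:M i j]mxE eq_sym.
    move: (hessian g u o i j) (D2g i j) (_%:R) => p q r; ring.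
  by rewrite sumrB -big_distrr/= sum_delta_r.
have -> : D2g i i = 'D_v ('D_v (metric_form 'e_i 'e_i)) o by rewrite -(bil_mderive2 v gU Uo) bil_delta.
have K1 := chris_d1E gU Uo go chris_o v 'e_i 'e_i v.
have K2 := chris_d1E gU Uo go chris_o 'e_i v v 'e_i.
have Q1 : 'D_v ('D_('e_i) (metric_form 'e_i v)) o = 'D_('e_i) ('D_v (metric_form v 'e_i)) o.
  refine (etrans (schwarz _ _ oU (smooth_Ck 2 (smooth_metric_form gU 'e_i v)) Uo) _).
  by apply: (derive2_eq oU v 'e_i _ Uo) => x; exact: (metric_form_sym gU).
exact: laplacian_arith K K1 K2 Q1.
Qed.

(** The second derivative along [v] of the Laplacian of [u] at [o], by [derive2_laplacian]; the name
    refers to what survives in its lower bound. *)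
Definition curvature_part := \sum_i (- (\sum_j D2g i j * hessian_form g u 'e_i 'e_j o) + 'D_v ('D_v (hessian_form g u 'e_i 'e_i)) o).

(** Summing [laplacian_term] over the basis removes the gradient terms and leaves the contraction of
    two semidefinite matrices, [H] and [curvature_mx]. *)
Lemma curvature_part_ge0 : 0 <= curvature_part.
Proof.
apply: (@le_trans _ _ (\sum_i \sum_j H i j * S i j)).
  apply: (trace_psd_ge0 (H_sym c gU Uo go chris_o us) (psdU Uo)).
  exact: (curvature_mx_psd v gU Uo go chris_o sec).
rewrite -[leLHS]subr0.
have Z : \sum_i dot (chris_d2 v v 'e_i 'e_i - chris_d2 'e_i 'e_i v v) gr = 0.
  by rewrite /dot -bil_suml (chris_d2_trace _ gU Uo go chris_o ric) bil0l.
rewrite -[X in _ - X <= _]Z -sumrB; apply: ler_sum => i _; exact: laplacian_term.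
Qed.

Lemma derive2_laplacian : 'D_v ('D_v (laplacian g u)) o = curvature_part.
Proof.
have E : {in U, laplacian g u =1
    (fun x => \sum_i \sum_j inv_metric g i j x * hessian_form g u 'e_i 'e_j x)}.
  move=> x; rewrite inE => Ux; apply: eq_bigr => i _; apply: eq_bigr => j _.
  by rewrite -(hessian_formE gU us _ _ Ux) bil_delta.
refine (etrans (derive2_eq oU v v E Uo) _).
exact: (derive2_contraction v gU Uo go chris_o (fun i j => smooth_hessian_form gU us 'e_i 'e_j)).
Qed.

Lemma laplacian_smooth : smooth_on U (laplacian g u).
Proof.
apply: (@smooth_eq _ _ _ (fun x => \sum_i \sum_j inv_metric g i j x * hessian_form g u 'e_i 'e_j x)) => //.
  move=> x; rewrite inE => Ux; apply: eq_bigr => i _; apply: eq_bigr => j _.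
  by rewrite -(hessian_formE gU us _ _ Ux) bil_delta.
apply: smooth_sum => [|i _]; first exact: oU.
apply: smooth_sum => [|j _]; first exact: oU.
exact: (smoothM oU (smooth_ginv gU i j) (smooth_hessian_form gU us 'e_i 'e_j)).
Qed.

Let sq i j : smooth_on U (fun x => pd i u x * pd j u x).
Proof. exact: (smoothM oU (smooth_derive 'e_i us) (smooth_derive 'e_j us)). Qed.

Let grad_sq_sum x : grad_sq g u x = \sum_i \sum_j inv_metric g i j x * (pd i u x * pd j u x).
Proof. by apply: eq_bigr => i _; apply: eq_bigr => j _; rewrite mulrA. Qed.

Lemma grad_sq_smooth : smooth_on U (grad_sq g u).
Proof.
apply: (@smooth_eq _ _ _ (fun x => \sum_i \sum_j inv_metric g i j x * (pd i u x * pd j u x))) => //.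
apply: smooth_sum => [|i _]; first exact: oU.
apply: smooth_sum => [|j _]; first exact: oU.
exact: (smoothM oU (smooth_ginv gU i j) (sq i j)).
Qed.

(** The second derivative of the inverse metric and the third derivatives of [u], known from
    [third_null], combine to [curvature_mx]. The squares of ['D_v ('D_('e_i) u)], which nullity
    makes equal to [- c * v 0 i], give the last term. *)
Lemma derive2_grad_sq : 'D_v ('D_v (grad_sq g u)) o =
  bil S gr gr + 2 * c ^+ 2 * dot v v.
Proof.
have E : {in U, grad_sq g u =1
    (fun x => \sum_i \sum_j inv_metric g i j x * (pd i u x * pd j u x))}.
  by move=> x _; exact: grad_sq_sum.
refine (etrans (derive2_eq oU v v E Uo) _).
refine (etrans (derive2_contraction v gU Uo go chris_o sq) _).
have -> : bil S gr gr = \sum_i (- (\sum_j D2g i j * (gr 0 i * gr 0 j))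
    + 2 * (gr 0 i * dot (chris_d1 'e_i v v) gr)).
  rewrite bilDm bilZm (bil_chris_d1 v gU Uo) (linear_form_coord _ (linear_form_chris_d1 gU Uo v v gr)).
  rewrite -scaleN1r bilZm mulN1r bilE big_split/= sumrN big_distrr/=; congr (- _ + _).
  by apply: eq_bigr => i _; apply: eq_bigr => j _; rewrite mulrC.
rewrite dotE big_distrr/= -big_split/=; apply: eq_bigr => i _.
rewrite -[RHS]addrA; congr (_ + _).
  by congr (- _); apply: eq_bigr => j _; rewrite /grad !mxE.
have du := smooth_derive 'e_i us.
refine (etrans (derive2M oU v v du du Uo) _).
have D1 : 'D_v ('D_('e_i) u) o = - (c * v 0 i).
  by rewrite (derive_hess c gU Uo go chris_o us) H_null add0r -dot_delta.
have D2 : 'D_v ('D_v ('D_('e_i) u)) o = dot (chris_d1 'e_i v v) gr.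
  by rewrite -third_deriveE (third_in gU Uo _ _ _ us) (third_rot gU Uo _ _ _ us) third_null.
have E1 : gr 0 i = 'D_('e_i) u o by rewrite /grad mxE.
rewrite D1 D2 -E1; move: (v 0 i) (gr 0 i) (dot _ _) => p q r; ring.
Qed.

Lemma real_comp_smooth : smooth_on U (fun x => Fr (u x)).
Proof. exact: smooth_real_comp. Qed.

(** Nullity turns the second derivative of [u] along [v] into [- c * dot v v]. *)
Lemma derive2_real_comp : 'D_v ('D_v (fun x => Fr (u x))) o =
  'D_1 ('D_1 Fr) (u o) * ('D_v u o) ^+ 2 - 'D_1 Fr (u o) * c * dot v v.
Proof.
have Frs1 : smooth_on [set: R] ('D_1 Fr) by exact: (smooth_derive (1 : R) Frs).
have E : {in U, 'D_v (fun x => Fr (u x)) =1 (fun x => 'D_1 Fr (u x) * 'D_v u x)}.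
  move=> x; rewrite inE => Ux.
  by have [_ ->] := is_derive_real_comp (smooth_derivable Frs I)
    (smooth_derivable (v := v) us Ux).
refine (etrans (derive_eq_on v oU E Uo) _).
refine (etrans (deriveM_smooth v (smooth_real_comp oU Frs1 us) (smooth_derive v us) Uo) _).
have [_ ->] := is_derive_real_comp (smooth_derivable Frs1 I)
    (smooth_derivable (v := v) us Uo).
rewrite (derive_hess c gU Uo go chris_o us) H_null add0r.
by rewrite expr2 mulrN !mulrA.
Qed.

Theorem normal_static :
  (2 * c ^+ 2 - 'D_1 Fr (u o) * c) * bil (g o) v v <=
  bil (hessian g (fun x => laplacian g u x + grad_sq g u x + Fr (u x)) o) v v.
Proof.
have sPQ := smoothD oU laplacian_smooth grad_sq_smooth.
have sN := smoothD oU sPQ real_comp_smooth.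
rewrite (bil_hessian gU _ _ sN Uo) chris_o derive0 subr0.
rewrite (derive2D oU v v sPQ real_comp_smooth Uo).
rewrite (derive2D oU v v laplacian_smooth grad_sq_smooth Uo).
rewrite derive2_laplacian derive2_grad_sq derive2_real_comp go -/(dot v v).
have P1 := curvature_part_ge0.
have P2 : 0 <= bil S gr gr by rewrite bilM; exact: (curvature_mx_psd v gU Uo go chris_o sec).
have P3 := mulr_ge0 (Fr2 (u o)) (sqr_ge0 ('D_v u o)).
exact: (static_arith c _ _ P1 P2 P3).
Qed.

End NormalStatic.

Lemma vsmooth_continuous (R : realType) n (U : set 'rV[R]_n) X (y : 'rV[R]_n) :
  vsmooth U X -> U y -> {for y, continuous X}.
Proof.
move=> sX Uy; apply: (@cvg_mx_entries R _ (nbhs y) (nbhs_filter y)) => i j.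
by rewrite ord1; exact: smooth_continuous (sX j) Uy.
Qed.

(** * Reduction to normal coordinates *)

Section LinearMaps.
Variables (R : realType) (n : nat).
Local Notation rV := 'rV[R]_n.
Implicit Types (a b y : rV) (A : 'M[R]_n).

Lemma is_derive_mulmx A k a y :
  is_derive y a (fun z : rV => (z *m A) 0 k) ((a *m A) 0 k).
Proof.
under eq_fun do rewrite mxE; rewrite mxE; apply: is_derive_sum_fun => j.
have := is_deriveM (is_derive_coord j y a) (is_derive_cst (A j k) y a).
by rewrite scaler0 add0r [_ *: _]mulrC.
Qed.

Lemma vderive_mulmx A a y : vderive a (fun z : rV => z *m A) y = a *m A.
Proof. by apply/rowP => k; rewrite vderiveE; have [_ ->] := is_derive_mulmx A k a y. Qed.

Lemma vsmooth_mulmx U A : open U -> vsmooth U (fun z : rV => z *m A).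
Proof.
move=> oU k; apply: (@smooth_eq _ _ _ (fun z : rV => \sum_j z 0 j * A j k)) => //.
  by move=> z _; rewrite mxE.
apply: smooth_sum => // j _.
exact: (smoothM oU (@smooth_coord _ _ U j) (@smooth_cst _ _ U (A j k))).
Qed.

Lemma open_unitmx (U : set rV) (A : rV -> 'M[R]_n) : open U -> msmooth U A ->
  open [set y | U y /\ A y \in unitmx].
Proof.
move=> oU sA; have sd := smooth_det oU sA.
rewrite openE => y [Uy uy]; rewrite /interior.
have N1 : \forall z \near y, U z by apply: open_nbhs_nbhs.
have N2 : \forall z \near y, \det (A z) != 0.
  move: uy; rewrite unitmxE unitfE => dn; exact: (cvgr_neq0 _ (smooth_continuous sd Uy) dn).
apply: filterS2 N1 N2 => z Uz dz; split=> //.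
by rewrite unitmxE unitfE.
Qed.

End LinearMaps.

Section NormalChart.
Variables (R : realType) (n : nat).
Local Notation rV := 'rV[R]_n.
Implicit Types (a b y w : rV).
Variables (W : set rV) (gm : rV -> 'M[R]_n) (x0 : rV) (A : 'M[R]_n).
Hypothesis gmW : metric_on W gm.
Hypothesis Wx0 : W x0.
Hypothesis uA : A \in unitmx.
Hypothesis AgA : A *m gm x0 *m A^T = 1%:M.
Let oW : open W. Proof. by case: gmW. Qed.
Let gs : msmooth W gm. Proof. by case: gmW. Qed.

(* The quadratic term makes the Christoffel symbols vanish at 0, and [A], with
   [A g A^T = 1], makes the metric the identity there. *)
Definition normal_map y : rV :=
  x0 + y *m A - 2^-1 *: chris gm x0 (y *m A) (y *m A).
Local Notation phi := normal_map.

Lemma normal_map_entry y k : phi y 0 k =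
  x0 0 k + (y *m A) 0 k - 2^-1 * bil (christoffel_mx gm k x0) (y *m A) (y *m A).
Proof. by rewrite !mxE chrisE. Qed.

Lemma normal_map_smooth (U : set rV) : open U -> vsmooth U phi.
Proof.
move=> oU k; apply: (@smooth_eq _ _ _ (fun y => x0 0 k + (y *m A) 0 k
  - 2^-1 * bil (christoffel_mx gm k x0) (y *m A) (y *m A))) => //.
  by move=> z _; rewrite normal_map_entry.
have sm := @vsmooth_mulmx R n U A oU.
have sC : msmooth U (fun=> christoffel_mx gm k x0) by move=> i j; exact: smooth_cst.
have s1 := smoothD oU (@smooth_cst _ _ U (x0 0 k)) (sm k).
exact: (smoothB oU s1 (smoothM oU (@smooth_cst _ _ U 2^-1) (smooth_bil oU sC sm sm))).
Qed.

Lemma vderive_normal_map a y : vderive a phi y = a *m A - chris gm x0 (a *m A) (y *m A).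
Proof.
apply/rowP => k; rewrite vderiveE.
have -> : (fun z => phi z 0 k) = (fun z => x0 0 k + (z *m A) 0 k
  - 2^-1 * bil (christoffel_mx gm k x0) (z *m A) (z *m A)).
  by apply/funext => z; rewrite normal_map_entry.
have d1 := is_deriveD (is_derive_cst (x0 0 k) y a) (is_derive_mulmx A k a y).
have d2 : is_derive y a (fun z : rV => bil (christoffel_mx gm k x0) (z *m A) (z *m A))
    (2 * bil (christoffel_mx gm k x0) (a *m A) (y *m A)).
  have [|||H1 H2] := @is_derive_bil R n (fun=> christoffel_mx gm k x0) (mulmx^~ A) (mulmx^~ A) a y.
  - by move=> i j; exact: derivable_cst.
  - by move=> i; have [] := is_derive_mulmx A i a y.
  - by move=> i; have [] := is_derive_mulmx A i a y.
  apply: DeriveDef; first exact: H1.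
  rewrite H2 vderive_mulmx -2!chrisE (chris_sym gmW (y *m A) (a *m A) Wx0).
  have -> : bil (mderive a (fun=> christoffel_mx gm k x0) y) (y *m A) (y *m A) = 0.
    have -> : mderive a (fun=> christoffel_mx gm k x0) y = 0.
      by apply/matrixP => i j; rewrite mderiveE [RHS]mxE; exact: derive_cst.
    by rewrite bilM mulmx0 mul0mx mxE.
  by rewrite add0r mulr2n mulrDl mul1r.
have [_ ->] := is_deriveB d1 (is_deriveZ 2^-1 d2).
rewrite add0r [RHS]mxE [X in _ = _ + X]mxE chrisE; congr (_ - _).
by rewrite /GRing.scale/= mulrA mulVf ?mul1r.
Qed.

Lemma vderive2_normal_map a b y : vderive a (vderive b phi) y = - chris gm x0 (b *m A) (a *m A).
Proof.
apply/rowP => k; rewrite vderiveE.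
have -> : (fun z => vderive b phi z 0 k) =
    (fun z => (b *m A) 0 k - \sum_j (b *m A *m christoffel_mx gm k x0) 0 j * (z *m A) 0 j).
  apply/funext => z; rewrite vderive_normal_map [LHS]mxE [X in _ + X]mxE chrisE; congr (_ - _).
  by rewrite bilM mxE; apply: eq_bigr => j _; rewrite [(_^T) _ _]mxE.
have d (j : 'I_n) : is_derive y a
    (fun z : rV => (b *m A *m christoffel_mx gm k x0) 0 j * (z *m A) 0 j)
    ((b *m A *m christoffel_mx gm k x0) 0 j * (a *m A) 0 j).
  exact: (is_deriveZ _ (is_derive_mulmx A j a y)).
have [_ ->] := is_deriveB (is_derive_cst ((b *m A) 0 k) y a) (is_derive_sum_fun (index_enum 'I_n) d).
rewrite sub0r [RHS]mxE chrisE; congr (- _).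
by rewrite bilM [RHS]mxE; apply: eq_bigr => j _; rewrite [(_^T) _ _]mxE.
Qed.

Let oT : open [set: rV]. Proof. exact: openT. Qed.

(** Everything is pulled back along [normal_map], so an invertible Jacobian is what matters; no
    inverse map is constructed. *)
Definition normal_dom := [set y | (phi @^-1` W) y /\ jac phi y \in unitmx].
Definition normal_metric y := jac phi y *m gm (phi y) *m (jac phi y)^T.
Local Notation U := normal_dom.
Local Notation g' := normal_metric.

Lemma jac_smooth V : open V -> msmooth V (jac phi).
Proof.
move=> oV i j; apply: (@smooth_eq _ _ _ (fun z => 'D_(delta_mx 0 i) (fun z => phi z 0 j) z)) => //.
  by move=> z _; rewrite mxE.
exact: (smooth_derive (delta_mx 0 i) (normal_map_smooth oV j)).
Qed.

Lemma normal_dom_open : open U.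
Proof.
have oP : open (phi @^-1` W).
  apply: open_comp => // y _; exact: vsmooth_continuous (normal_map_smooth oT) I.
exact: (open_unitmx oP (jac_smooth oP)).
Qed.

Lemma normal_map0 : phi 0 = x0.
Proof.
rewrite /phi mul0mx; have -> : chris gm x0 0 0 = 0.
  by apply/rowP => k; rewrite chrisE bil0l mxE.
by rewrite scaler0 subr0 addr0.
Qed.

Lemma chris0r a : chris gm x0 a 0 = 0.
Proof. by apply/rowP => k; rewrite chrisE bil0r mxE. Qed.

Lemma jac_normal_map0 : jac phi 0 = A.
Proof.
apply/row_matrixP => i; rewrite rowE -(vderive_jac oT (normal_map_smooth oT) _ I).
by rewrite vderive_normal_map mul0mx chris0r subr0 -rowE.
Qed.

Lemma normal_dom0 : U 0.
Proof. by split; rewrite /= ?jac_normal_map0// normal_map0. Qed.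

Lemma normal_metric_on : metric_on U g'.
Proof.
have oU := normal_dom_open; have phis := normal_map_smooth oU.
have UW y : U y -> W (phi y) by case.
split=> //.
- move=> i j; apply: (@smooth_eq _ _ _ (fun y =>
     bil (gm (phi y)) (row i (jac phi y)) (row j (jac phi y)))) => //.
    move=> y _; rewrite -[RHS]bil_delta bil_mul -!rowE //.
  have sr k : vsmooth U (fun y => row k (jac phi y)).
    move=> l; apply: (smooth_eq oU _ (jac_smooth oU k l)) => z _.
    by rewrite [RHS]mxE.
  apply: (smooth_bil oU _ (sr i) (sr j)) => k l.
  exact: (smooth_comp oU oW UW phis (gs k l)).
- move=> y [Wy _]; rewrite /g' !trmx_mul trmxK mulmxA.
  by case: gmW => _ _ -> .
- move=> y [Wy uy]; rewrite /g' !unitmx_mul unitmx_tr uy !andbT.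
  by case: gmW => _ _ _ ->.
Qed.

Lemma normal_pulled : pulled U phi g' gm.
Proof. by []. Qed.

Lemma normal_metric0 : g' 0 = 1%:M.
Proof. by rewrite /g' jac_normal_map0 normal_map0. Qed.

(** By [christoffel_pulled] the new symbols are, up to [A], the second derivative of [normal_map]
    plus the symbols at [x0], and these are opposite. *)
Lemma normal_christoffel0 a b : chris g' 0 a b = 0.
Proof.
have UW y : U y -> W (phi y) by case.
have phis := normal_map_smooth normal_dom_open.
have := christoffel_pulled gmW normal_metric_on UW phis normal_pulled a b normal_dom0.
rewrite vderive2_normal_map !vderive_normal_map mul0mx !chris0r !subr0 normal_map0.
rewrite (chris_sym gmW (b *m A) (a *m A) Wx0) addNr => /(congr1 (mulmx^~ (invmx A))).
by rewrite mulmxK// mul0mx.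
Qed.

End NormalChart.

Lemma hessian_eq_on (R : realType) n (U : set 'rV[R]_n) (g : 'rV[R]_n -> 'M[R]_n)
    u w y : open U -> {in U, u =1 w} -> U y -> hessian g u y = hessian g w y.
Proof.
move=> oU E Uy; apply/matrixP => i j; rewrite [LHS]mxE [RHS]mxE.
refine (congr2 (fun p q => p - q) (derive2_eq oU (delta_mx 0 j) (delta_mx 0 i) E Uy) _).
apply: eq_bigr => k _; congr (_ * _).
exact: (derive_eq_on (delta_mx 0 k) oU E Uy).
Qed.

Section StaticInequality.
Variables (R : realType) (n : nat).
Local Notation rV := 'rV[R]_n.
Implicit Types (a b y w : rV).

(** [normal_static] is applied to [u] composed with [normal_map] and to [v *m invmx A], which the
    differential at 0 sends to [v]. *)
Theorem static_inequality (W : set rV) (gm : rV -> 'M[R]_n) (x0 : rV)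
    (u : rV -> R) (Fr : R -> R) (c : R) (v : rV) :
  metric_on W gm -> W x0 ->
  (forall w, w != 0 -> 0 < bil (gm x0) w w) ->
  (forall a b, 0 <= bil (gm x0) (curv gm x0 a b b) a) ->
  (forall a b d, nabla_ricci_form gm x0 a b d = 0) ->
  smooth_on W u -> smooth_on [set: R] Fr ->
  (forall t : R, 0 <= 'D_1 ('D_1 Fr) t) ->
  (forall x, W x -> psd (hessian gm u x + c *: gm x)) ->
  bil (hessian gm u x0 + c *: gm x0) v v = 0 ->
  (2 * c ^+ 2 - 'D_1 Fr (u x0) * c) * bil (gm x0) v v <=
  bil (hessian gm (fun x => laplacian gm u x + grad_sq gm u x + Fr (u x)) x0) v v.
Proof.
move=> gmW Wx0 pos sec ric us Frs Fr2 psdW null.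
have sym0 : (gm x0)^T = gm x0 by case: gmW => _ _ + _; apply.
have [A uA AgA] : exists2 A : 'M[R]_n, A \in unitmx & A *m gm x0 *m A^T = 1%:M.
  by apply: posdef_orthonormal => // w w0; rewrite -bilM; exact: pos.
pose phi := normal_map gm x0 A; pose U := normal_dom W gm x0 A.
pose g' := normal_metric gm x0 A.
have gU : metric_on U g' := normal_metric_on x0 A gmW.
have oU : open U by case: gU.
have oW : open W by case: gmW.
have phis : vsmooth U phi := normal_map_smooth gm x0 A oU.
have UW y : U y -> W (phi y) by case.
have U0 : U 0 := normal_dom0 gmW Wx0 uA.
have gE : pulled U phi g' gm by exact: (@normal_pulled R n W gm x0 A).
have go : g' 0 = 1%:M := normal_metric0 gmW Wx0 AgA.
have chris_o : forall a b, chris g' 0 a b = 0 := normal_christoffel0 gmW Wx0 uA.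
have p0 : phi 0 = x0 := normal_map0 gm x0 A.
have F0 a : vderive a phi 0 = a *m A.
  by rewrite (vderive_jac oU phis a U0) (jac_normal_map0 A gmW Wx0).
pose us' := smooth_comp oU oW UW phis us.
pose v' := v *m invmx A.
have v'A : v' *m A = v by rewrite mulmxKV.
have E y : U y -> hessian g' (fun z => u (phi z)) y + c *: g' y =
   jac phi y *m (hessian gm u (phi y) + c *: gm (phi y)) *m (jac phi y)^T.
  move=> Uy; rewrite (hessian_pulled_mx gmW gU UW phis gE us Uy).
  by rewrite mulmxDr mulmxDl -scalemxAr -scalemxAl.
have := @normal_static R n U g' 0 (fun z => u (phi z)) Fr c v' gU U0 go chris_o.
have sec' a b : 0 <= bil (g' 0) (curv g' 0 a b b) a.
  rewrite (bil_pulled gU phis _ _ gE U0) p0.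
  by rewrite (curv_pulled gmW gU UW phis gE _ _ _ U0) p0; exact: sec.
have ric' a b d : nabla_ricci_form g' 0 a b d = 0.
  by rewrite (nabla_ricci_form_pulled gmW gU UW phis gE _ _ _ U0) p0; exact: ric.
move=> /(_ sec' ric' us' Frs Fr2).
have psd' x : U x -> psd (hessian g' (fun z => u (phi z)) x + c *: g' x).
  move=> Ux w; rewrite E// -bilM bil_mul bilM; exact: (psdW _ (UW _ Ux)).
have null' : bil (hessian g' (fun z => u (phi z)) 0 + c *: g' 0) v' v' = 0.
  by rewrite E// bil_mul (jac_normal_map0 A gmW Wx0) v'A p0.
move=> /(_ psd' null').
have sN : smooth_on W (fun x => laplacian gm u x + grad_sq gm u x + Fr (u x)).
  apply: (smoothD oW (smoothD oW _ _) (smooth_real_comp oW Frs us)).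
    exact: (laplacian_smooth gmW us).
  exact: (grad_sq_smooth gmW us).
(* The two functions agree on a whole neighbourhood of 0, as is necessary before comparing their
   Hessians. *)
have -> : hessian g' (fun x => laplacian g' (fun z => u (phi z)) x
    + grad_sq g' (fun z => u (phi z)) x + Fr (u (phi x))) 0 =
  hessian g' (fun x => (fun x => laplacian gm u x + grad_sq gm u x + Fr (u x)) (phi x)) 0.
  apply: (hessian_eq_on _ oU _ U0) => y; rewrite inE => Uy.
  rewrite (laplacian_pulled gmW gU UW phis gE us Uy).
  by rewrite (grad_sq_pulled gmW gU UW phis gE us Uy).
rewrite (hessian_pulled gmW gU UW phis gE _ _ sN U0).
rewrite (bil_pulled gU phis _ _ gE U0)//.
by rewrite F0 v'A p0.
Qed.

End StaticInequality.

(** * Real induction and one-sided derivatives *)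

Section RealLemmas.
Variable R : realType.

(** At the infimum of the times where [P] fails, the step gives [P] there and on an interval to the
    right, so the infimum would be larger. The base case is the step at 0, where nothing
    precedes. *)
Lemma real_induction (P : R -> Prop) (b : R) :
  (forall t, 0 <= t <= b -> (forall s, 0 <= s < t -> P s) ->
     P t /\ exists2 d : R, 0 < d & forall s, t < s < t + d -> s <= b -> P s) ->
  forall t, 0 <= t <= b -> P t.
Proof.
move=> step t tb; apply: contrapT => nPt.
pose B := [set s | 0 <= s <= b /\ ~ P s].
have B0 : has_inf B.
  split; first by exists t.
  by exists 0 => s [/andP[]].
have Bt : B t by [].
pose tau := inf B.
have tau0 : 0 <= tau by apply: lb_le_inf B0.1 _ => s [/andP[]].
have taut : tau <= t by apply: (inf_lbound B0.2).
have taub : 0 <= tau <= b by rewrite tau0 (le_trans taut)//; case/andP: tb.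
have below s : 0 <= s < tau -> P s.
  move=> /andP[s0 st]; apply: contrapT => nPs.
  have : tau <= s by apply: (inf_lbound B0.2); split=> //; rewrite s0 (le_trans (ltW st))//; case/andP: taub.
  by rewrite leNgt st.
have [Ptau [d d0 near]] := step tau taub below.
have : tau + d <= tau.
  apply: lb_le_inf B0.1 _ => s [/andP[s0 sb] nPs].
  rewrite leNgt; apply/negP => sd.
  have ts : tau <= s by apply: (inf_lbound B0.2); split=> //; rewrite s0.
  move: ts; rewrite le_eqVlt => /predU1P[E|ts]; first by apply: nPs; rewrite -E.
  by apply: nPs; apply: near => //; rewrite ts.
by rewrite -lerBrDl subrr leNgt d0.
Qed.

Lemma has_derivative_within_is_derive (D : set R) (u : R -> R) (t l : R) :
  nbhs t D -> has_derivative_within D u t l -> is_derive t 1 u l.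
Proof.
move=> Dt; rewrite /has_derivative_within => H.
have H1 : (u s - u t) / (s - t) @[s --> t^'] --> l.
  move=> P /H; rewrite /= !nbhs_simpl /within/= => Q.
  have Q2 : \forall s \near t^', D s by apply: nbhs_dnbhs.
  by apply: filterS2 Q Q2 => s /= h Ds; exact: h.
have H2 : h^-1 *: (u (h *: (1:R) + t) - u t) @[h --> (0:R)^'] --> l.
  have C : h + t @[h --> (0:R)^'] --> t^'.
    move=> P; rewrite /= !nbhs_simpl => /nbhs_ballP[e /= e0 He].
    apply/nbhs_ballP; exists e => // h; rewrite -ball_normE/= sub0r normrN => he h0.
    apply: He; first by rewrite -ball_normE/= opprD addrCA subrr addr0 normrN.
    by apply: contra_neq h0 => /eqP; rewrite -subr_eq0 addrK => /eqP.
  have := cvg_comp _ _ C H1; apply: cvg_trans; apply: near_eq_cvg.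
  near=> h; rewrite /= addrK [h *: (1:R)]mulr1 mulrC //.
by apply: DeriveDef; [apply/cvg_ex; eexists; exact: H2|exact: (cvg_lim _ H2)].
Unshelve. all: by end_near. Qed.

Lemma left_min_derive_le0 (h : R -> R) (t l d : R) : 0 < d -> is_derive t 1 h l ->
  h t = 0 -> (forall s, t - d < s < t -> 0 <= h s) -> l <= 0.
Proof.
move=> d0 [dh hl] ht0 hpos; rewrite leNgt; apply/negP => l0.
have C : k^-1 *: (h (k *: (1:R) + t) - h t) @[k --> (0:R)^'] --> l.
  by rewrite -hl; exact: dh.
have N : \forall k \near (0:R)^', 0 < k^-1 *: (h (k *: (1:R) + t) - h t).
  exact: (cvgr_gt _ C).
move: N => /nbhs_ballP[e /= e0 He].
(* A negative increment inside both radii; the half makes the bounds strict. *)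
pose k := - (Num.min e d / 2).
have m0 : 0 < Num.min e d by rewrite lt_min e0.
have k0 : k < 0 by rewrite oppr_lt0 divr_gt0.
have ke : `|k| < e.
  rewrite ltr0_norm// opprK ltr_pdivrMr// (@le_lt_trans _ _ e) ?ge_min ?lexx//.
  by rewrite ltr_pMr// ltr1n.
have kd : - d < k.
  rewrite ltrN2 ltr_pdivrMr// (@le_lt_trans _ _ d) ?ge_min ?lexx ?orbT//.
  by rewrite ltr_pMr// ltr1n.
have := He k; rewrite -ball_normE/= sub0r normrN => /(_ ke (ltr0_neq0 k0)).
rewrite ht0 subr0 [k *: (1:R)]mulr1 [_ *: _]/(_ * _) nmulr_rgt0 ?invr_lt0// ltNge.
by rewrite hpos// -ltrBlDr addrAC subrr sub0r kd/= gtrDr.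
Qed.

End RealLemmas.

(** * Positive definiteness persists under small perturbations *)

Section PosdefNear.
Variables (R : realType) (n : nat).

(** By [2 |w_i w_j| <= w_i^2 + w_j^2] the perturbation costs at most [n / (n + 1)] of the squared
    norm; [n + 1] also avoids dividing by zero in dimension 0. *)
Lemma near_identity_psd (E : 'M[R]_n) :
  (forall i j, `|E i j - (i == j)%:R| <= (n.+1%:R)^-1) -> psd E.
Proof.
move=> H w; rewrite -bilM bilE.
have -> : \sum_i \sum_j w 0 i * w 0 j * E i j =
  \sum_i w 0 i ^+ 2 + \sum_i \sum_j w 0 i * w 0 j * (E i j - (i == j)%:R).
  rewrite -big_split/=; apply: eq_bigr => i _.
  under [X in _ = _ + X]eq_bigr do rewrite mulrBr.
  have D : \sum_j w 0 i * w 0 j * (i == j)%:R = w 0 i ^+ 2.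
    rewrite (bigD1 i)//= eqxx mulr1 big1 ?addr0 ?expr2// => j.
    by rewrite eq_sym => /negbTE ->; rewrite mulr0.
  by rewrite sumrB D addrC subrK.
pose s := \sum_i w 0 i ^+ 2.
pose k : R := (n.+1%:R)^-1.
have k0 : 0 < k by rewrite invr_gt0 ltr0n.
have B : - (\sum_i \sum_j (w 0 i ^+ 2 + w 0 j ^+ 2) / 2 * k) <=
  \sum_i \sum_j w 0 i * w 0 j * (E i j - (i == j)%:R).
  rewrite -sumrN; apply: ler_sum => i _; rewrite -sumrN; apply: ler_sum => j _.
  rewrite lerNl; apply: le_trans (ler_norm _) _; rewrite normrN normrM.
  apply: ler_pM => //.
  rewrite ler_norml; have := sqr_ge0 (w 0 i - w 0 j); have := sqr_ge0 (w 0 i + w 0 j).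
  move: (w 0 i) (w 0 j) => a b h1 h2; apply/andP; split; nra.
apply: le_trans (lerD (lexx s) B).
have -> : \sum_i \sum_j (w 0 i ^+ 2 + w 0 j ^+ 2) / 2 * k = n%:R * s * k.
  under eq_bigr do rewrite -mulr_suml -mulr_suml big_split/= sumr_const card_ord.
  rewrite -!mulr_suml big_split/= sumr_const card_ord -/s sumrMnl -/s.
  by rewrite -mulr_natl; field.
rewrite subr_ge0 mulrAC -[leRHS]mul1r ler_wpM2r//; first by rewrite sumr_ge0// => i _; exact: sqr_ge0.
by rewrite ler_pdivrMr ?ltr0n// mul1r ler_nat.
Qed.

(** A congruence turns [M0] into the identity and preserves semidefiniteness; then finitely many
    entries have to be close. The filter is arbitrary because times are restricted to the interval
    in the application. *)
Lemma posdef_near (T : Type) (F : set_system T) (FF : Filter F) (Mf : T -> 'M[R]_n)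
    (M0 : 'M[R]_n) : M0^T = M0 -> (forall v : 'rV[R]_n, v != 0 -> 0 < bil M0 v v) ->
  (forall i j, Mf z i j @[z --> F] --> M0 i j) -> \forall z \near F, psd (Mf z).
Proof.
move=> sM pM cM.
have [A uA AMA] : exists2 A : 'M[R]_n, A \in unitmx & A *m M0 *m A^T = 1%:M.
  by apply: posdef_orthonormal => // w w0; rewrite -bilM; exact: pM.
have c1 i j : (A *m Mf z *m A^T) i j @[z --> F] --> ((i == j)%:R : R).
  have -> : (i == j)%:R = (A *m M0 *m A^T) i j by rewrite AMA mxE.
  rewrite mxE; under eq_fun do rewrite mxE.
  apply: cvg_sum_seq => k; apply: cvgM; last exact: cvg_cst.
  rewrite mxE; under eq_fun do rewrite mxE.
  by apply: cvg_sum_seq => l; apply: cvgM; [exact: cvg_cst|exact: cM].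
have k0 : 0 < (n.+1%:R : R)^-1 by rewrite invr_gt0 ltr0n.
have N : \forall z \near F, forall i j, `|(A *m Mf z *m A^T) i j - (i == j)%:R| <= (n.+1%:R)^-1.
  near=> z => i j; rewrite distrC; move: i j; near: z.
  apply: filter_forall => i; apply: filter_forall => j.
  by have /cvgrPdist_le := c1 i j; apply.
apply: filterS N => z /near_identity_psd P w.
have := P (w *m invmx A); rewrite -!bilM bil_mul mulmxKV//.
Unshelve. all: by end_near. Qed.

End PosdefNear.

(** * From charts to the manifold *)

Section Charts.
Variables (R : realType) (n : nat) (M : topologicalType).
Variable g : riemannianManifold R n M.
Implicit Types (a b : atlas_index g) (x v w : 'rV[R]_n) (u : M -> R) (p : M).

Lemma chart_posdef a x v : cimg (atlas a) x -> v != 0 -> 0 < bil (metric a x) v v.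
Proof. by move=> Wx v0; rewrite bilM; exact: (metric_pos Wx v0). Qed.

Lemma chart_metric_on a : metric_on (cimg (atlas a)) (metric a).
Proof.
split; [exact: cimg_open|by move=> i j; exact: metric_smooth| |].
  by move=> x Wx; exact: (Defs.metric_sym Wx).
move=> x Wx; apply: posdef_unitmx => v v0; exact: (metric_pos Wx v0).
Qed.

Lemma metric_onS (U W : set 'rV[R]_n) gm : open U -> U `<=` W -> metric_on W gm ->
  metric_on U gm.
Proof.
move=> oU UW [oW sW symW uW]; split=> //.
- by move=> i j; exact: (smooth_onS UW (sW i j)).
- by move=> x /UW; exact: symW.
- by move=> x /UW; exact: uW.
Qed.

Lemma curvature_vwwE gm x v w : curvature_vww gm x v w = curv gm x v w w.
Proof. by apply/rowP => l; rewrite curv_entry mxE. Qed.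

Lemma curv_diag (W : set 'rV[R]_n) gm x v : metric_on W gm -> W x -> curv gm x v v v = 0.
Proof. by move=> gW Wx; rewrite (curvE gW _ _ _ Wx) subrr. Qed.

(** Strict Cauchy-Schwarz: the form is positive on the difference between [v] and its projection to
    [w]. *)
Lemma gram_pos (N : 'M[R]_n) v w : N^T = N ->
  (forall z, z != 0 -> 0 < bil N z z) -> w != 0 ->
  (forall k : R, v != k *: w) ->
  0 < bil N v v * bil N w w - bil N v w ^+ 2.
Proof.
move=> sN pN w0 vw; have ww := pN w w0.
pose k := bil N v w / bil N w w.
have vk : v - k *: w != 0 by rewrite subr_eq0.
have := pN _ vk; rewrite bilBl !bilBr !bilZl !bilZr (bilC w v sN).
have -> : bil N v v - k * bil N v w - (k * bil N v w - k * (k * bil N w w)) =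
    (bil N v v * bil N w w - bil N v w ^+ 2) / bil N w w.
  by rewrite /k; field; rewrite gt_eqF.
by rewrite pmulr_lgt0 ?invr_gt0.
Qed.

Lemma row_free_pair v w : w != 0 -> (forall k : R, v != k *: w) ->
  row_free (col_mx v w).
Proof.
move=> w0 vw; rewrite -kermx_eq0; apply/negPn/negP => /rowV0Pn[z].
move=> /sub_kermxP; rewrite -[z](@hsubmxK _ 1 1 1) mul_row_col.
rewrite [lsubmx z]mx11_scalar [rsubmx z]mx11_scalar !mul_scalar_mx.
set s := lsubmx z 0 0; set t := rsubmx z 0 0 => E.
have [s0|s0] := eqVneq s 0.
  have [t0|t0] := eqVneq t 0.
    by rewrite s0 t0 => /eqP; apply; rewrite !raddf0 row_mx0.
  by move: E; rewrite s0 scale0r add0r => /eqP; rewrite scaler_eq0 (negbTE t0) (negbTE w0).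
move=> _; have /eqP := vw (- (t / s)); apply.
move: E => /eqP; rewrite addr_eq0 => /eqP E.
have := congr1 (fun y => s^-1 *: y) E; rewrite scalerA mulVf// scale1r => ->.
by rewrite scalerN scalerA scaleNr mulrC.
Qed.

(** [nonneg_sectional] speaks of independent pairs; for dependent ones the curvature vector
    vanishes, by linearity if [w = 0] and by antisymmetry otherwise. *)
Lemma chart_sectional a x v w : nonneg_sectional g -> cimg (atlas a) x ->
  0 <= bil (metric a x) (curv (metric a) x v w w) v.
Proof.
move=> sec Wx; have gW := chart_metric_on a.
have Rm0 z : curv (metric a) x v 0 z = 0.
  apply/rowP => l; rewrite [RHS]mxE.
  by have := linear_form_curv2 (metric a) x v z l 1 0 0; rewrite scale1r addr0 mul1r; lra.
have [->|w0] := eqVneq w 0; first by rewrite Rm0 bil0l.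
have [[k ->]|nk] := pselect (exists k, v = k *: w).
  have -> : curv (metric a) x (k *: w) w w = 0.
    apply/rowP => l; rewrite [RHS]mxE.
    have := linear_form_curv1 (metric a) x w w l k w 0; rewrite addr0 => ->.
    have := linear_form_curv1 (metric a) x w w l 1 0 0; rewrite scale1r addr0 mul1r.
    by rewrite (curv_diag w gW Wx) mxE mulr0 add0r; lra.
  by rewrite bil0l.
have vw k : v != k *: w by apply/eqP => E; apply: nk; exists k.
have := sec a x v w Wx (row_free_pair w0 vw).
rewrite /sectional /inner -!bilM curvature_vwwE pmulr_lge0// invr_gt0.
by apply: gram_pos => //; [exact: Defs.metric_sym|move=> z z0; exact: chart_posdef].
Qed.

Lemma overlap_open a b : open (overlap (atlas a) (atlas b)).
Proof.
rewrite openE => x [Wx Dx]; rewrite /interior.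
have N1 : \forall y \near x, cimg (atlas a) y.
  by apply: open_nbhs_nbhs; split=> //; exact: cimg_open.
have c : {for x, continuous (cinv (atlas a))} by apply: cinv_continuous; rewrite inE.
have N2 : \forall q \near cinv (atlas a) x, cdom (atlas b) q.
  by apply: open_nbhs_nbhs; split=> //; exact: cdom_open.
have N3 : \forall y \near x, cdom (atlas b) (cinv (atlas a) y) by exact: (c _ N2).
by apply: filterS2 N1 N3.
Qed.

Definition shifted_hessian a u (c : R) x := hessian (metric a) (in_chart a u) x + c *: metric a x.

(** The transition map is an instance of the pullback. A neighbourhood found in one chart thus
    serves every chart that meets it. *)
Lemma psd_transfer a b p u c : cdom (atlas a) p -> cdom (atlas b) p ->
  smooth_on (cimg (atlas b)) (in_chart b u) ->
  psd (shifted_hessian b u c (cmap (atlas b) p)) -> psd (shifted_hessian a u c (cmap (atlas a) p)).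
Proof.
move=> pa pb su; set x := cmap (atlas a) p.
pose U := overlap (atlas a) (atlas b).
pose phi y := cmap (atlas b) (cinv (atlas a) y).
have oU : open U := @overlap_open a b.
have gW := chart_metric_on b; have oW : open (cimg (atlas b)) by case: gW.
have gU : metric_on U (metric a).
  by apply: metric_onS (chart_metric_on a) => // y [].
have UW y : U y -> cimg (atlas b) (phi y) by move=> [_]; exact: cmap_img.
have phis : vsmooth U phi by move=> k; exact: (@atlas_smooth _ _ _ g a b k).
have gE : pulled U phi (metric a) (metric b).
  move=> y Uy; apply/matrixP => i j; rewrite (metric_transform Uy).
  rewrite -[RHS]bil_delta bil_mul bilE; apply: eq_bigr => k _; apply: eq_bigr => l _.
  by rewrite -!rowE !mxE.
have Ux : U x by split; [exact: cmap_img|rewrite cmapK].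
have uE : {in U, in_chart a u =1 (fun y => in_chart b u (phi y))}.
  by move=> y; rewrite inE => -[_ Dy]; rewrite /in_chart /phi cmapK.
have phix : phi x = cmap (atlas b) p by rewrite /phi cmapK.
move=> P v; rewrite -bilM /shifted_hessian (hessian_eq_on _ oU uE Ux).
rewrite bilDm bilZm (hessian_pulled gW gU UW phis gE _ _ su Ux).
rewrite (bil_pulled gU phis _ _ gE Ux) -bilZm -bilDm phix bilM.
exact: P.
Qed.

End Charts.

(** * Time slices of functions on space-time *)

Section Slices.
Variables (R : realType) (V : normedModType R).
Implicit Types (w : V * R -> R) (W : set (V * R)) (x v : V) (t : R).

Definition slice t w : V -> R := fun x => w (x, t).

Lemma slice_quotient_dir w x t v (h : R) :
  w (h *: ((v, 0) : V * R) + (x, t)) = w (h *: v + x, t).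
Proof.
have -> : h *: ((v, 0) : V * R) + (x, t) = (h *: v + x, h *: (0 : R) + t) by [].
by rewrite scaler0 add0r.
Qed.

Lemma slice_quotient_time w x t (h : R) :
  w (h *: ((0, 1) : V * R) + (x, t)) = w (x, h *: (1 : R) + t).
Proof.
have -> : h *: ((0, 1) : V * R) + (x, t) = (h *: (0 : V) + x, h *: (1 : R) + t) by [].
by rewrite scaler0 add0r.
Qed.

Lemma slice_derive_dir t w v : 'D_v (slice t w) = slice t ('D_((v, 0) : V * R) w).
Proof.
apply/funext => x; rewrite /slice /derive.
have -> : (fun h : R => h^-1 *: (((fun y => w (y, t)) \o shift x) (h *: v) - w (x, t))) =
  (fun h => h^-1 *: ((w \o shift (x, t)) (h *: ((v, 0) : V * R)) - w (x, t))) => //.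
by apply/funext => h /=; rewrite slice_quotient_dir.
Qed.

Lemma slice_derive_time w x t : 'D_1 (fun s => w (x, s)) t = 'D_((0, 1) : V * R) w (x, t).
Proof.
rewrite /derive.
have -> : (fun h : R => h^-1 *: (((fun s => w (x, s)) \o shift t) (h *: (1:R)) - w (x, t))) =
  (fun h => h^-1 *: ((w \o shift (x, t)) (h *: ((0, 1) : V * R)) - w (x, t))) => //.
by apply/funext => h /=; rewrite slice_quotient_time.
Qed.

Lemma slice_derivable_dir t w x v : derivable w (x, t) ((v, 0) : V * R) ->
  derivable (slice t w) x v.
Proof.
rewrite /derivable.
suff -> : (fun h : R => h^-1 *: ((w \o shift (x, t)) (h *: ((v, 0) : V * R)) - w (x, t))) =
  (fun h : R => h^-1 *: ((slice t w \o shift x) (h *: v) - slice t w x)) by [].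
by apply/funext => h /=; rewrite slice_quotient_dir.
Qed.

Lemma slice_derivable_time w x t : derivable w (x, t) ((0, 1) : V * R) ->
  derivable (fun s => w (x, s)) t 1.
Proof.
rewrite /derivable.
suff -> : (fun h : R => h^-1 *: ((w \o shift (x, t)) (h *: ((0, 1) : V * R)) - w (x, t))) =
  (fun h : R => h^-1 *: (((fun s => w (x, s)) \o shift t) (h *: (1 : R)) - w (x, t))) by [].
by apply/funext => h /=; rewrite slice_quotient_time.
Qed.

Lemma cvg_slice x t : (y, t) @[y --> x] --> (x, t).
Proof.
apply: (@cvg_pair _ _ _ _ (nbhs x) (nbhs t)) => /=; first exact: cvg_id.
exact: cvg_cst.
Qed.

Lemma slice_continuous W w x t : {for (x, t), continuous w} ->
  {for x, continuous (slice t w)}.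
Proof.
move=> c P Pw; have Q := c P Pw; have Q2 := cvg_slice Q; exact: Q2.
Qed.

Lemma slice_smooth W w t : smooth_on W w -> smooth_on [set x | W (x, t)] (slice t w).
Proof.
move=> sw s; elim/last_ind: s w sw => [|s v IH] w sw x /= Wx.
  have [c d] := sw [::] _ Wx; split; first exact: slice_continuous.
  by move=> v; apply: slice_derivable_dir; exact: d.
rewrite iter_derive_rcons slice_derive_dir; apply: IH => //.
exact: smooth_derive.
Qed.

Lemma slice_open W t : open W -> open [set x | W (x, t)].
Proof.
move=> oW; rewrite openE => x /= Wx; rewrite /interior.
exact: (cvg_slice (open_nbhs_nbhs (conj oW Wx))).
Qed.

End Slices.

Lemma nbhs_time_interval (R : realType) (T : \bar R) (t : R) :
  0 < t -> (t%:E < T)%E -> nbhs t (time_interval T).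
Proof.
move=> t0 tT; have N1 : \forall s \near t, 0 < s by apply: (cvgr_gt t cvg_id).
case: T tT => [r| |//] tT.
  rewrite lte_fin in tT.
  have N2 : \forall s \near t, s < r by apply: (cvgr_lt t cvg_id).
  apply: filterS2 N1 N2 => s s0 sr; split; first exact: ltW.
  by rewrite lte_fin.
by apply: filterS N1 => s s0; split; [exact: ltW|exact: ltry].
Qed.

(** * The first touching time *)

Section Spacetime.
Variables (R : realType) (n : nat).
Local Notation rV := 'rV[R]_n.
Local Notation st := (rV * R)%type.
Variables (W : set rV) (gm : rV -> 'M[R]_n) (Om : set st) (w : st -> R).
Hypothesis gW : metric_on W gm.
Hypothesis oO : open Om.
Hypothesis sw : smooth_on Om w.
Local Notation "''d_' i" := ((delta_mx 0 i, 0) : st) (at level 8, i at level 2).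

Lemma hessian_slice (h : st -> R) x t i j : hessian gm (slice t h) x i j =
  'D_('d_i) ('D_('d_j) h) (x, t) - \sum_k christoffel gm k i j x * 'D_('d_k) h (x, t).
Proof.
have E (q : st -> R) k : pd k (slice t q) = slice t ('D_('d_k) q).
  exact: (slice_derive_dir t q (delta_mx 0 k)).
rewrite mxE !E; congr (_ - _); apply: eq_bigr => k _.
by rewrite E.
Qed.

Lemma hessian_slice_cvg x t i j : Om (x, t) -> W x ->
  hessian gm (slice z.2 w) z.1 i j @[z --> (x, t)] --> hessian gm (slice t w) x i j.
Proof.
move=> Ox Wx; rewrite hessian_slice; under eq_fun do rewrite hessian_slice.
have c2 : {for (x, t), continuous (fun z => 'D_('d_i) ('D_('d_j) w) z)}.
  exact: (smooth_continuous (smooth_derive _ (smooth_derive _ sw)) Ox).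
have E : (fun z : st => 'D_('d_i) ('D_('d_j) w) (z.1, z.2)) = 'D_('d_i) ('D_('d_j) w).
  by apply/funext => -[].
apply: cvgB.
  by rewrite -[X in X @ _ --> _]/(fun z : st => 'D_('d_i) ('D_('d_j) w) (z.1, z.2)) E; exact: c2.
apply: cvg_sum_seq => k; apply: cvgM.
  have c := smooth_continuous (smooth_christoffel gW k i j) Wx.
  move=> P Pw; have Q := c P Pw; have Q2 := @cvg_fst _ _ (nbhs x) (nbhs t) _ _ Q.
  exact: Q2.
have E' : (fun z : st => 'D_('d_k) w (z.1, z.2)) = 'D_('d_k) w.
  by apply/funext => -[].
rewrite E'; exact: (smooth_continuous (smooth_derive _ sw) Ox).
Qed.

Lemma is_derive_time (h : st -> R) x t : smooth_on Om h -> Om (x, t) ->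
  is_derive t 1 (fun s => h (x, s)) ('D_((0, 1) : st) h (x, t)).
Proof.
move=> sh Ox; apply: DeriveDef; last exact: slice_derive_time.
by apply: slice_derivable_time; exact: smooth_derivable sh Ox.
Qed.

(** The metric does not depend on time, so the time derivative passes through the Christoffel terms,
    and through the space derivatives by symmetry. *)
Lemma hessian_slice_time x t i j : Om (x, t) ->
  is_derive t 1 (fun s => hessian gm (slice s w) x i j)
    (hessian gm (slice t ('D_((0, 1) : st) w)) x i j).
Proof.
move=> Ox; rewrite hessian_slice; under eq_fun do rewrite hessian_slice.
have S1 k : {in Om, 'D_((0, 1) : st) ('D_('d_k) w) =1 'D_('d_k) ('D_((0, 1) : st) w)}.
  by move=> z; rewrite inE => Oz; exact: (schwarz _ _ oO (smooth_Ck 2 sw) Oz).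
have S2 : 'D_((0, 1) : st) ('D_('d_i) ('D_('d_j) w)) (x, t) =
    'D_('d_i) ('D_('d_j) ('D_((0, 1) : st) w)) (x, t).
  refine (etrans (schwarz _ _ oO (smooth_Ck 2 (smooth_derive _ sw)) Ox) _).
  exact: (derive_eq_on _ oO (S1 j) Ox).
rewrite -S2; apply: is_deriveB.
  exact: (is_derive_time (smooth_derive _ (smooth_derive _ sw)) Ox).
apply: is_derive_sum_fun => k.
have dk := is_deriveZ (christoffel gm k i j x)
  (is_derive_time (smooth_derive ('d_k) sw) Ox).
apply: (is_derive_eq dk); apply: congr1.
exact: (schwarz _ _ oO (smooth_Ck 2 sw) Ox).
Qed.

End Spacetime.

Section NoTouch.
Variables (R : realType) (n : nat) (M : topologicalType).
Variable g : riemannianManifold R n M.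
Hypothesis sec_ge0 : nonneg_sectional g.
Hypothesis ric_parallel : parallel_ricci g.
Variables (F : R -> R) (T : \bar R) (L : R -> M -> R).
Hypothesis F_smooth : smooth_on [set: R] F.
Hypothesis F_convex : forall y : R, 0 <= derive1n 2 F y.
Hypothesis L_smooth : smooth_spacetime g (time_interval T) L.
Hypothesis L_heat : heat_solution g (time_interval T) F L.
Local Notation D := (time_interval T).
Local Notation rV := 'rV[R]_n.
Local Notation st := (rV * R)%type.
Implicit Types (a : atlas_index g) (x v : rV) (t s : R).

Lemma F_convex' y : 0 <= 'D_1 ('D_1 F) y.
Proof.
have E : F^`()%classic = 'D_1 F by apply/funext => z; exact: derive1E.
by have := F_convex y; rewrite derive1nS derive1n1 derive1E -E.
Qed.

(** [Om] may contain times outside the interval, notably negative ones when [t = 0]; there [w] is a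
    mere extension of [L]. *)
Lemma local_extension a x t : cimg (atlas a) x -> D t ->
  exists (Om : set st) (w : st -> R), [/\ open Om, Om (x, t), smooth_on Om w &
    forall y s, Om (y, s) -> cimg (atlas a) y -> D s -> w (y, s) = in_chart a (L s) y].
Proof.
move=> Wx Dt; have [Om [w [oO Ox sw wE]]] := L_smooth (a := a) (p := (x, t)) (conj Wx Dt).
by exists Om, w; split=> // y s Oy Wy Ds; exact: (wE (y, s) Oy (conj Wy Ds)).
Qed.

Lemma hessian_extension a x t (Om : set st) (w : st -> R) : open Om ->
  (forall y s, Om (y, s) -> cimg (atlas a) y -> D s -> w (y, s) = in_chart a (L s) y) ->
  cimg (atlas a) x -> D t -> Om (x, t) ->
  hessian (metric a) (in_chart a (L t)) x = hessian (metric a) (slice t w) x.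
Proof.
move=> oO wE Wx Dt Ox.
have oU : open ([set y | Om (y, t)] `&` cimg (atlas a)).
  by apply: openI; [exact: slice_open|exact: cimg_open].
apply: (hessian_eq_on _ oU) => // y; rewrite inE => -[Oy Wy].
by rewrite /slice wE.
Qed.

Lemma in_chart_smooth a t : D t -> smooth_on (cimg (atlas a)) (in_chart a (L t)).
Proof.
move=> Dt; apply: smooth_local => x Wx.
have [Om [w [oO Ox sw wE]]] := local_extension Wx Dt.
exists ([set y | Om (y, t)] `&` cimg (atlas a)), (slice t w); split=> //.
- by apply: openI; [exact: slice_open|exact: cimg_open].
- by apply: smooth_onS (slice_smooth sw) => y [].
- by move=> y; rewrite inE => -[Oy Wy]; rewrite /slice wE.
Qed.

(** The bound is required at time [t] on the whole chart, for the minimum in space, and at earlier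
    times at the point [x], for the sign of the time derivative. *)
Lemma no_touch a x t v (fe : R -> R) (c' d : R) :
  cimg (atlas a) x -> 0 < t -> (t%:E < T)%E -> is_derive t 1 fe c' ->
  (forall y, cimg (atlas a) y -> psd (shifted_hessian a (L t) (fe t) y)) ->
  0 < d -> (forall s, t - d < s < t -> 0 <= s -> psd (shifted_hessian a (L s) (fe s) x)) ->
  v != 0 -> bil (shifted_hessian a (L t) (fe t) x) v v = 0 ->
  0 < 2 * fe t ^+ 2 - 'D_1 F (in_chart a (L t) x) * fe t + c' -> False.
Proof.
move=> Wx t0 tT dfe psdt d0 psds v0 null pos.
have Dn := nbhs_time_interval t0 tT.
have Dt : D t by split; [exact: ltW|].
have gW := chart_metric_on a.
have [Om [w [oO Ox sw wE]]] := local_extension Wx Dt.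
pose N y := laplacian (metric a) (in_chart a (L t)) y
   + grad_sq (metric a) (in_chart a (L t)) y + F (in_chart a (L t) y).
(* The heat equation identifies the time derivative of the extension on an open part of the slice,
   so that its spatial Hessian is known at [x]. *)
have timeE : {in [set y | Om (y, t)] `&` cimg (atlas a),
    slice t ('D_((0, 1) : st) w) =1 N}.
  move=> y; rewrite inE => -[Oy Wy].
  have [_ E1] := has_derivative_within_is_derive Dn (L_heat Wy Dt).
  refine (etrans _ E1); rewrite /slice -slice_derive_time; apply: near_eq_derive.
  have N1 : \forall s \near t, Om (y, s).
    have c2 : (y, s) @[s --> t] --> (y, t).
      by apply: (@cvg_pair _ _ _ _ (nbhs y) (nbhs t)) => /=; [exact: cvg_cst|exact: cvg_id].
    exact: (c2 _ (open_nbhs_nbhs (conj oO Oy))).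
  by apply: filterS2 N1 Dn => s Os Ds; exact: wE.
have oU : open ([set y | Om (y, t)] `&` cimg (atlas a)).
  by apply: openI; [exact: slice_open|exact: cimg_open].
pose hess s := bil (hessian (metric a) (slice s w) x) v v.
have dhess : is_derive t 1 hess (bil (hessian (metric a) N x) v v).
  have -> : hessian (metric a) N x = hessian (metric a) (slice t ('D_((0, 1) : st) w)) x.
    apply: (hessian_eq_on _ oU) => // y Hy; exact/esym/timeE.
  rewrite /hess bilE; under eq_fun do rewrite bilE.
  apply: is_derive_sum_fun => i; apply: is_derive_sum_fun => j.
  by apply: is_deriveZ; exact: (hessian_slice_time (metric a) oO sw i j Ox).
pose h s := hess s + fe s * bil (metric a x) v v.
have dh : is_derive t 1 h (bil (hessian (metric a) N x) v v + c' * bil (metric a x) v v).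
  have d1 : is_derive t 1 (fun s => fe s * bil (metric a x) v v)
      (c' * bil (metric a x) v v).
    have H := is_deriveM dfe (is_derive_cst (bil (metric a x) v v) t (1:R)).
    by apply: (is_derive_eq H); rewrite scaler0 add0r; exact: mulrC.
  exact: (is_deriveD dhess d1).
have N1 : \forall s \near t, Om (x, s).
  have c2 : (x, s) @[s --> t] --> (x, t).
    by apply: (@cvg_pair _ _ _ _ (nbhs x) (nbhs t)) => /=; [exact: cvg_cst|exact: cvg_id].
  exact: (c2 _ (open_nbhs_nbhs (conj oO Ox))).
have hE s : D s -> Om (x, s) -> h s = bil (shifted_hessian a (L s) (fe s) x) v v.
  move=> Ds Os; rewrite /h /hess /shifted_hessian bilDm bilZm.
  by rewrite (hessian_extension oO wE Wx Ds Os).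
have ht : h t = 0 by rewrite hE.
have le0 : bil (hessian (metric a) N x) v v + c' * bil (metric a x) v v <= 0.
  have /nbhs_ballP[e /= e0 He] : nbhs t [set s | Om (x, s) /\ D s] by exact: filterI.
  (* Within the smaller radius both the extension and the earlier bound are available. *)
  apply: (@left_min_derive_le0 R h t _ (Num.min e d)) => //.
    by rewrite lt_min e0.
  move=> s /andP[s1 s2].
  have [Os Ds] : [set s | Om (x, s) /\ D s] s.
    apply: He; rewrite -ball_normE/= gtr0_norm ?subr_gt0// ltrBlDr -ltrBlDl.
    by apply: le_lt_trans s1; rewrite lerD2l lerN2 ge_min lexx.
  rewrite hE// bilM; apply: psds; last by case: Ds.
  rewrite s2 andbT; apply: le_lt_trans s1.
  by rewrite lerD2l lerN2 ge_min lexx orbT.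
have := static_inequality gW Wx (fun z => chart_posdef Wx) (fun b e => chart_sectional _ _ sec_ge0 Wx)
  (fun b e k => nabla_ricci_form_eq0 gW b e k Wx (ric_parallel Wx)) (@in_chart_smooth a t Dt)
  F_smooth F_convex' psdt null.
rewrite -/N => st.
have vv := chart_posdef Wx v0.
have : 0 < (2 * fe t ^+ 2 - 'D_1 F (in_chart a (L t) x) * fe t + c') * bil (metric a x) v v.
  exact: mulr_gt0.
rewrite mulrDl ltNge => /negP; apply.
by apply: le_trans le0; rewrite lerD2r.
Qed.

End NoTouch.

(** The difference quotient times [s - t] tends to 0; the value [s = t], which the punctured filter
    omits, is trivial. *)
Lemma has_derivative_within_cvg (R : realType) (D : set R) (u : R -> R) (t l : R) :
  has_derivative_within D u t l -> u s @[s --> within D (nbhs t)] --> u t.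
Proof.
move=> H; have [G [FG GE]] : exists G, Filter G /\ G = within D t^'.
  by exists (within D t^'); split=> //; exact: within_filter.
have H0 : (u s - u t) / (s - t) @[s --> G] --> l by rewrite GE; exact: H.
have Gt : s @[s --> G] --> t.
  rewrite GE => P /= nP; apply: filterS (nbhs_dnbhs nP) => s Ps _; exact: Ps.
have H1 : (u s - u t) / (s - t) * (s - t) @[s --> G] --> l * (t - t).
  by apply: cvgM => //; apply: cvgB => //; exact: cvg_cst.
rewrite subrr mulr0 in H1.
apply/cvgrPdist_lt => e e0.
have N : \forall s \near G, `|0 - (u s - u t) / (s - t) * (s - t)| < e.
  by have /cvgrPdist_lt := H1; apply.
have N' : \forall s \near t, s != t -> D s -> `|u t - u s| < e.
  have N2 : \forall s \near t, s != t -> D s ->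
      `|0 - (u s - u t) / (s - t) * (s - t)| < e by rewrite GE in N.
  apply: filterS N2 => s Hs st Ds; have := Hs st Ds.
  by rewrite sub0r normrN divfK ?subr_eq0// distrC.
rewrite /within/=; apply: filterS N' => s Hs Ds.
by have [->|st] := eqVneq s t; [rewrite subrr normr0|exact: Hs].
Qed.

Lemma hessian_sym (R : realType) n (W : set 'rV[R]_n) gm u x :
  metric_on W gm -> smooth_on W u -> W x -> (hessian gm u x)^T = hessian gm u x.
Proof.
move=> gW us Wx; have oW : open W by case: gW.
apply/matrixP => i j; rewrite mxE -[LHS]bil_delta -[RHS]bil_delta.
rewrite (bil_hessian gW _ _ us Wx) (bil_hessian gW _ _ us Wx).
refine (congr2 (fun p q => p - q) (schwarz _ _ oW (smooth_Ck 2 us) Wx) _).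
by rewrite (chris_sym gW _ _ Wx).
Qed.

(** * Compactness, and propagation of the perturbed bound in time *)

Section Global.
Variables (R : realType) (n : nat) (M : topologicalType).
Variable g : riemannianManifold R n M.
Hypothesis compactM : compact [set: M].
Hypothesis sec_ge0 : nonneg_sectional g.
Hypothesis ric_parallel : parallel_ricci g.
Variables (F : R -> R) (T : \bar R) (L : R -> M -> R).
Hypothesis F_smooth : smooth_on [set: R] F.
Hypothesis F_convex : forall y : R, 0 <= derive1n 2 F y.
Hypothesis L_smooth : smooth_spacetime g (time_interval T) L.
Hypothesis L_heat : heat_solution g (time_interval T) F L.
Local Notation D := (time_interval T).
Local Notation rV := 'rV[R]_n.
Local Notation st := (rV * R)%type.
Implicit Types (a b : atlas_index g) (x v : rV) (t s : R) (p : M).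
Local Notation nbhs_within x t := (filter_prod (nbhs x) (within D (nbhs t))).

Lemma cvg_nbhs_within x t : nbhs_within x t `=>` nbhs (x, t).
Proof.
move=> P [[P1 P2] [/= H1 H2] HP]; exists (P1, P2) => //; split=> //=.
exact: (@cvg_within _ (nbhs t) _ D).
Qed.

Lemma shifted_hessian_cvg a x t (fe : R -> R) i j : cimg (atlas a) x -> D t ->
  fe s @[s --> within D (nbhs t)] --> fe t ->
  shifted_hessian a (L z.2) (fe z.2) z.1 i j @[z --> nbhs_within x t] --> shifted_hessian a (L t) (fe t) x i j.
Proof.
move=> Wx Dt cfe; have gW := chart_metric_on a.
have [Om [w [oO Ox sw wE]]] := local_extension L_smooth Wx Dt.
have N1 : \forall z \near nbhs_within x t, Om z.
  by apply: cvg_nbhs_within; exact: open_nbhs_nbhs.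
have N2 : \forall z \near nbhs_within x t, cimg (atlas a) z.1.
  by apply: (@cvg_fst _ _ (nbhs x)); apply: open_nbhs_nbhs; split=> //; exact: cimg_open.
have N3 : \forall z \near nbhs_within x t, D z.2.
  by apply: (@cvg_snd _ _ (nbhs x) (within D (nbhs t))); exact: withinT.
have C : hessian (metric a) (slice z.2 w) z.1 i j + fe z.2 * metric a z.1 i j
    @[z --> nbhs_within x t] --> shifted_hessian a (L t) (fe t) x i j.
  rewrite /shifted_hessian (hessian_extension oO wE Wx Dt Ox) [X in _ --> X]mxE [X in _ --> _ + X]mxE.
  apply: cvgD.
    have Q1 := @hessian_slice_cvg _ _ _ _ _ _ gW sw x t i j Ox Wx.
    move=> P Q; apply: cvg_nbhs_within; exact: (Q1 P Q).
  apply: cvgM.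
    move=> P Q; have Q2 := cfe P Q.
    exact: (@cvg_snd _ _ (nbhs x) (within D (nbhs t)) _ _ Q2).
  have cg := smooth_continuous (metric_smooth (a := a) i j) Wx.
  move=> P Q; have Q2 := cg P Q.
  exact: (@cvg_fst _ _ (nbhs x) (within D (nbhs t)) _ _ Q2).
apply: cvg_trans C; apply: near_eq_cvg.
apply: filterS3 N1 N2 N3 => -[y s] /= Oy Wy Ds.
by rewrite /shifted_hessian (hessian_extension oO wE Wy Ds Oy) [RHS]mxE [X in _ = _ + X]mxE.
Qed.

Definition bound_at (fe : R -> R) t :=
  forall a x, cimg (atlas a) x -> psd (shifted_hessian a (L t) (fe t) x).
Definition strict_bound_at (fe : R -> R) t :=
  forall a x v, cimg (atlas a) x -> v != 0 -> 0 < bil (shifted_hessian a (L t) (fe t) x) v v.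

(** Each point has a product neighbourhood in space and time on which the form stays semidefinite;
    compactness of [M] extracts a common neighbourhood in time. *)
Lemma posdef_good_near (fe : R -> R) t : D t ->
  fe s @[s --> within D (nbhs t)] --> fe t -> strict_bound_at fe t ->
  \forall s \near within D (nbhs t), bound_at fe s.
Proof.
move=> Dt cfe pd.
have cov := (compact_near_coveringP [set: M]).1 compactM.
(* The cover is indexed by points of [M], so the property at a point includes every chart around
   it. *)
pose P s p := D s -> forall b, cdom (atlas b) p -> psd (shifted_hessian b (L s) (fe s) (cmap (atlas b) p)).
have : \forall s \near within D (nbhs t), [set: M] `<=` P s.
  apply: cov => p _; have [a pa] := atlas_cover g p.
  set x := cmap (atlas a) p; have Wx : cimg (atlas a) x by exact: cmap_img.
  have sym : (shifted_hessian a (L t) (fe t) x)^T = shifted_hessian a (L t) (fe t) x.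
    rewrite /shifted_hessian linearD /= linearZ /= (Defs.metric_sym Wx).
    by rewrite (hessian_sym (chart_metric_on a) (in_chart_smooth L_smooth (a := a) Dt) Wx).
  have pdx v : v != 0 -> 0 < bil (shifted_hessian a (L t) (fe t) x) v v by exact: pd.
  have FF : Filter (nbhs_within x t) by exact: filter_prod_filter.
  have [[P1 P2] [/= H1 H2] HP] := posdef_near FF sym pdx (fun i j => @shifted_hessian_cvg a x t fe i j Wx Dt cfe).
  have c : {for p, continuous (cmap (atlas a))} by apply: cmap_continuous; rewrite inE.
  have N : \forall q \near p, cdom (atlas a) q.
    by apply: open_nbhs_nbhs; split=> //; exact: cdom_open.
  exists ((cdom (atlas a)) `&` [set q | P1 (cmap (atlas a) q)], P2).
    by split=> //=; apply: filterI => //; exact: (c _ H1).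
  move=> [q s] [/= [qa Pq] Ps] Ds b qb.
  apply: (psd_transfer qb qa); first exact: in_chart_smooth.
  exact: (HP (cmap (atlas a) q, s)).
have DN : \forall s \near within D (nbhs t), D s by exact: withinT.
move=> N; apply: filterS2 DN N => s Ds Ps a x Wx.
by have := Ps (cinv (atlas a) x) I Ds a (cinv_dom Wx); rewrite cinvK.
Qed.

(** A negative value at time [t] would persist at slightly earlier times. *)
Lemma good_left_limit (fe : R -> R) t : 0 < t -> D t ->
  fe s @[s --> within D (nbhs t)] --> fe t ->
  (forall s, 0 <= s < t -> bound_at fe s) -> bound_at fe t.
Proof.
move=> t0 Dt cfe H a x Wx v; rewrite -bilM leNgt; apply/negP => neg.
have C : bil (shifted_hessian a (L s) (fe s) x) v v @[s --> within D (nbhs t)]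
    --> bil (shifted_hessian a (L t) (fe t) x) v v.
  rewrite bilE; under eq_fun do rewrite bilE.
  apply: cvg_sum_seq => i; apply: cvg_sum_seq => j.
  apply: cvgM; first exact: cvg_cst.
  move=> P Q; have [[P1 P2] [/= H1 H2] HP] := @shifted_hessian_cvg a x t fe i j Wx Dt cfe _ Q.
  apply: filterS H2 => s Hs.
  exact: (HP (x, s) (conj (nbhs_singleton H1) Hs)).
have N : \forall s \near within D (nbhs t), bil (shifted_hessian a (L s) (fe s) x) v v < 0.
  exact: (cvgr_lt _ C).
move: N => /nbhs_ballP[e /= e0 He].
(* With half of the smaller radius, [t - m] lies both in the ball and in [[0, t)]. *)
pose m := Num.min e t / 2; have m0 : 0 < m by rewrite divr_gt0// lt_min e0.
have mm : m < Num.min e t by rewrite ltr_pdivrMr// ltr_pMr ?lt_min ?e0// ltr1n.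
have me : m < e by apply: lt_le_trans mm _; rewrite ge_min lexx.
have mt : m < t by apply: lt_le_trans mm _; rewrite ge_min lexx orbT.
have s0 : 0 <= t - m by rewrite subr_ge0 ltW.
have st : t - m < t by rewrite gtrBl.
have Ds : D (t - m).
  by split=> //; case: Dt => _; apply: le_lt_trans; rewrite lee_fin ltW.
have := He (t - m); rewrite -ball_normE/= opprB addrC subrK gtr0_norm// => /(_ me Ds).
by rewrite ltNge bilM => /negP; apply; apply: H => //; rewrite s0.
Qed.

Variables (f f' : R -> R).
Hypothesis f_der : forall t, D t -> has_derivative_within D f t (f' t).
Hypothesis f_ineq : forall t p, D t ->
   0 <= 2 * f t ^+ 2 - derive1 F (L t p) * f t + f' t.
Hypothesis init : hessian_lower_bound g (L 0) (f 0).

(** Compactness is used for [M] near a fixed time, then for [[0, t1]]. The bound is a variable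
    tending to [+oo], so no maximum over a finite cover has to be formed. *)
Lemma coefficient_bound t1 : 0 <= t1 -> (t1%:E < T)%E ->
  exists A : R, forall t p, 0 <= t <= t1 -> 'D_1 F (L t p) - 4 * f t < A.
Proof.
move=> t10 t1T.
pose P (A : R) t := D t -> forall p, 'D_1 F (L t p) - 4 * f t < A.
have cov := (compact_near_coveringP _).1 (@segment_compact R 0 t1).
have : \forall A \near +oo, `[0, t1]%classic `<=` P A.
  apply: cov => t; rewrite /= in_itv/= => /andP[tl tr].
  have Dt : D t by split=> //; apply: le_lt_trans t1T; rewrite lee_fin.
  have covM := (compact_near_coveringP [set: M]).1 compactM.
  pose Q (z : R * R) p := D z.1 -> 'D_1 F (L z.1 p) - 4 * f z.1 < z.2.
  have : \forall z \near filter_prod (within D (nbhs t)) +oo, [set: M] `<=` Q z.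
    apply: covM => p _; have [a pa] := atlas_cover g p.
    set x := cmap (atlas a) p; have Wx : cimg (atlas a) x by exact: cmap_img.
    have [Om [w [oO Ox sw wE]]] := local_extension L_smooth Wx Dt.
    have F1 : {for w (x, t), continuous ('D_1 F)}.
      exact: smooth_continuous (smooth_derive (1 : R) F_smooth) I.
    have cw : {for (x, t), continuous w} := smooth_continuous sw Ox.
    have C := cvg_comp _ _ cw F1.
    pose B := 'D_1 F (w (x, t)) + 1.
    have N1 : \forall z \near (x, t), 'D_1 F (w z) < B.
      by apply: (cvgr_lt _ C); rewrite /B ltrDl.
    have N2 : \forall z \near (x, t), Om z by exact: open_nbhs_nbhs.
    have [[P1 P2] [/= H1 H2] HP] := filterI N1 N2.
    have N3 : \forall s \near within D (nbhs t), f t - 1 < f s.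
      by apply: (cvgr_gt _ (has_derivative_within_cvg (f_der Dt))); rewrite gtrBl.
    have c : {for p, continuous (cmap (atlas a))} by apply: cmap_continuous; rewrite inE.
    have N : \forall q \near p, cdom (atlas a) q.
      by apply: open_nbhs_nbhs; split=> //; exact: cdom_open.
    (* Near [(x, t)] the derivative of [F] stays below [B] and [f] above [f t - 1]. *)
    pose A0 := B - 4 * (f t - 1).
    exists ((cdom (atlas a)) `&` [set q | P1 (cmap (atlas a) q)],
      [set z | (P2 z.1 /\ f t - 1 < f z.1) /\ A0 < z.2]).
      split=> /=; first by apply: filterI => //; exact: (c _ H1).
      exists ([set s | P2 s /\ f t - 1 < f s], [set A | A0 < A]) => //=.
      split=> /=; last by apply: nbhs_pinfty_gt; exact: num_real.
      apply: filterI => //; exact: (@cvg_within _ (nbhs t) _ D).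
    move=> [q [s A]] [/= [qa Pq] [[Ps fs] As]] Ds.
    have [/= B1 Os] := HP (cmap (atlas a) q, s) (conj Pq Ps).
    have E : L s q = w (cmap (atlas a) q, s).
      by rewrite wE//; [rewrite /in_chart cmapK|exact: cmap_img].
    apply: lt_trans As; rewrite E /A0 ltrB// ltr_pM2l//.
  move=> [[P1 P2] [/= H1 H2] HP].
  exists ([set s | D s -> P1 s], P2) => //= -[s A] [/= Hs HA] Ds p.
  exact: (HP (s, A) (conj (Hs Ds) HA) p I).
(* Holding near [+oo] means holding strictly beyond some threshold, hence at the threshold plus
   1. *)
move=> [A [_ HA]]; exists (A + 1) => t p /andP[tl tr].
apply: HA => //=; first by rewrite ltrDl.
- by rewrite in_itv/= tl.
- by split=> //; apply: le_lt_trans t1T; rewrite lee_fin.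
Qed.

(** Real induction replaces the choice of a first touching time: [good_left_limit] passes to the
    limit from the left, [no_touch] makes the bound strict, and [posdef_good_near] continues it to
    the right. *)
Lemma perturbed_bound (A e t1 : R) : 0 < e -> 0 <= t1 -> (t1%:E < T)%E ->
  (forall t p, 0 <= t <= t1 -> 'D_1 F (L t p) - 4 * f t < A) ->
  bound_at (fun s => f s + e * expR (A * s)) t1.
Proof.
move=> e0 t10 t1T bound; set fe := fun s => _.
apply: (@real_induction R (bound_at fe) t1) => [t /andP[tl tr] below|]; last first.
  by rewrite t10 lexx.
have Dt : D t by split=> //; apply: le_lt_trans t1T; rewrite lee_fin.
have dE : is_derive t 1 (fun s => e * expR (A * s)) (e * (A * expR (A * t))).
  have d1 : is_derive t 1 ( *%R A) A.
    by have := is_deriveZ A (is_derive_id t (1 : R)); rewrite [A *: (1 : R)]mulr1.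
  have d2 := is_derive1_comp (is_derive_expR (A * t)) d1.
  by apply: is_deriveZ; rewrite mulrC.
have cfe : fe s @[s --> within D (nbhs t)] --> fe t.
  apply: cvgD; first exact: has_derivative_within_cvg (f_der Dt).
  have c : {for t, continuous (fun s => e * expR (A * s))}.
    apply: differentiable_continuous; apply/derivable1_diffP; exact: ex_derive.
  by move=> P /c Q; exact: (@cvg_within _ (nbhs t) _ D).
have [Gt Pt] : bound_at fe t /\ strict_bound_at fe t.
  move: tl; rewrite le_eqVlt => /predU1P[t0|t0].
    (* At time 0 the added multiple [e] of the metric alone makes the form definite. *)
    have Pt : strict_bound_at fe t.
      move=> a x v Wx v0; rewrite /shifted_hessian /fe -t0 mulr0 expR0 mulr1 scalerDl addrA bilDm.
      rewrite bilZm ltr_wpDl//; first by rewrite bilM; exact: (init Wx).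
      by rewrite mulr_gt0// chart_posdef.
    split=> // a x Wx v; rewrite -bilM.
    by have [->|v0] := eqVneq v 0; [rewrite bil0l|exact/ltW/Pt].
  have Gt : bound_at fe t by exact: good_left_limit.
  split=> // a x v Wx v0; rewrite lt_neqAle; apply/andP; split; last first.
    by rewrite bilM; exact: Gt.
  apply/eqP => /esym null.
  have tT : (t%:E < T)%E by case: Dt.
  have dfe : is_derive t 1 fe (f' t + e * (A * expR (A * t))).
    apply: is_deriveD.
    exact: (has_derivative_within_is_derive (nbhs_time_interval t0 tT) (f_der Dt)).
  (* The bound is known on all of [[0, t)], so [t] itself serves as the radius. *)
  apply: (no_touch sec_ge0 ric_parallel F_smooth F_convex L_smooth L_heat Wx t0 tT dfe
    (Gt a) t0 _ v0 null).
    by move=> s /andP[_ st] s0; apply: below => //; rewrite s0.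
  have B := bound t (cinv (atlas a) x); rewrite (ltW t0) tr in B.
  have := f_ineq (cinv (atlas a) x) Dt; rewrite derive1E.
  move: (B isT); rewrite -/(in_chart a (L t) x) /fe.
  have: 0 < e * expR (A * t) by rewrite mulr_gt0// expR_gt0.
  rewrite [e * (A * _)]mulrCA; move: (e * _) ('D_1 F _) (f t) (f' t) => d p q r d0 h1 h2.
  have := mulr_gt0 d0 (_ : 0 < A - (p - 4 * q)); rewrite subr_gt0 => /(_ h1) h3.
  have h4 := sqr_ge0 d.
  (* With [d = e * expR (A * t)], the perturbation changes the scalar expression by
     [d * (A - (p - 4 * q)) + 2 * d ^+ 2]. Growth at rate [A] supplies the term [A * d], which
     explains the exponential and the bound on [p - 4 * q]. *)
  have -> : 2 * (q + d) ^+ 2 - p * (q + d) + (r + A * d) =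
    (2 * q ^+ 2 - p * q + r) + (d * (A - (p - 4 * q)) + 2 * d ^+ 2) by ring.
  by rewrite ltr_wpDl// ltr_pwDl// mulr_ge0.
split=> //; have N := posdef_good_near Dt cfe Pt.
move: N => /nbhs_ballP[d /= d0 Hd]; exists d => // s /andP[ts sd] st1.
apply: Hd; first by rewrite -ball_normE/= ltr0_norm ?subr_lt0// opprB ltrBlDl.
split; first by rewrite (le_trans tl)// ltW.
by apply: le_lt_trans t1T; rewrite lee_fin.
Qed.

Lemma hessian_bound t : 0 < t -> (t%:E < T)%E -> hessian_lower_bound g (L t) (f t).
Proof.
move=> t0 tT a x Wx v.
have [A bound] := coefficient_bound (ltW t0) tT.
pose k := expR (A * t) * bil (metric a x) v v.
have k0 : 0 <= k.
  rewrite mulr_ge0 ?expR_ge0//; have [->|v0] := eqVneq v 0; first by rewrite bil0l.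
  by rewrite ltW// chart_posdef.
apply/ler_addgt0Pr => e e0.
(* The resulting error [e * k / (k + 1)] is below [e], and the divisor is positive even if
   [k = 0]. *)
have e0' : 0 < e / (k + 1) by rewrite divr_gt0// ltr_wpDl.
have := perturbed_bound e0' (ltW t0) tT bound Wx v.
rewrite -bilM /shifted_hessian scalerDl addrA bilDm bilZm -bilM => H.
apply: le_trans H _; rewrite lerD2l -mulrA -/k mulrAC ler_pdivrMr ?ltr_wpDl//.
by rewrite ler_wpM2l ?ltW// ltrDl.
Qed.

End Global.

Theorem theorem1p5 (R : realType) (n : nat) (M : topologicalType)
    (g : riemannianManifold R n M)
    (compactM : compact [set: M])
    (sec_ge0 : nonneg_sectional g)
    (ric_parallel : parallel_ricci g)
    (F : R -> R)
    (F_smooth : smooth_on [set: R] F)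
    (F_convex : forall y : R, 0 <= derive1n 2 F y)
    (T : \bar R) (T_gt0 : (0 < T)%E)
    (L : R -> M -> R)
    (L_smooth : smooth_spacetime g (time_interval T) L)
    (L_heat : heat_solution g (time_interval T) F L)
    (f f' : R -> R)
    (f_C1 : C1_within (time_interval T) f f')
    (f_ineq : forall (t : R) (p : M), time_interval T t ->
       0 <= 2 * f t ^+ 2 - derive1 F (L t p) * f t + f' t)
    (init : hessian_lower_bound g (L 0) (f 0)) :
  forall t : R, 0 < t -> (t%:E < T)%E -> hessian_lower_bound g (L t) (f t).
Proof.
move=> t t0 tT.
apply: (hessian_bound compactM sec_ge0 ric_parallel F_smooth F_convex L_smooth
  L_heat _ f_ineq init t0 tT).
exact: f_C1.1.
Qed.
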